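(* Fix an integer $d\ge 2$, let $\alpha_d=(d+1)^{d+1}/d^d$, let $0\le\gamma<\alpha_d^{-1/d}$ be fixed, and let $Y\sim\mathcal Y_d(n,\gamma n^{-1/d})$. Let $\hat X$ be the fraction of sets $f\in\binom{[n]}{d+1}$ such that $Y$ admits a stacked contraction of $f$. Then $n^{1/d}\hat X\to\hat\gamma$ in probability as $n\to\infty$, where $\hat\gamma$ is the smallest nonnegative root of the polynomial $Q_\gamma(x)=x^{d+1}-x+\gamma$.
   Context: $[n]=\{1,\ldots,n\}$ and $\binom{[n]}{d+1}$ is the family of $(d+1)$-element subsets of $[n]$. A $d$-dimensional face (or $d$-simplex) of a simplicial complex is a face with $d+1$ elements. The random complex $\mathcal Y_d(n,p)$ (Linial--Meshulam model) is the random $d$-dimensional simplicial complex on vertex set $[n]$ that contains all subsets of $[n]$ of size at most $d$, and in which every $f\in\binom{[n]}{d+1}$ is included as a $d$-face independently with probability $p$. A bistellar $0$-move on a $d$-simplex $\{v_1,\ldots,v_{d+1}\}$ subdivides it, via a new vertex $u$ in its interior, into the $d+1$ simplices $(\{v_1,\ldots,v_{d+1}\}\setminus\{v_j\})\cup\{u\}$, $j=1,\ldots,d+1$. A stacked triangulation is a triangulation of the $d$-simplex obtained from the simplex by a finite sequence (possibly empty) of bistellar $0$-moves. A complex $Y$ on vertex set $[n]$ admits a stacked contraction of $f=\{v_1,\ldots,v_{d+1}\}\in\binom{[n]}{d+1}$ if there are a stacked triangulation $T$ and a labelling of the vertices of $T$ by elements of $[n]$ (labels may be repeated) such that the $d+1$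 boundary vertices of $T$ are labelled $v_1,\ldots,v_{d+1}$, and for every $d$-face of $T$ its $d+1$ vertices have distinct labels and their label set is a $d$-face of $Y$. *)

(* Defs.v *)
(* The vertex set [n] is 'I_n; a simplicial complex
   on [n] is given by its set of faces, of type {set {set 'I_n}}. *)
From HB Require Import structures.
From mathcomp Require Import all_boot all_order all_algebra.
From mathcomp Require Import all_classical all_reals all_analysis.
Import Order.TTheory GRing.Theory Num.Theory.
Import numFieldNormedType.Exports.

Set Implicit Arguments.
Unset Strict Implicit.
Unset Printing Implicit Defensive.

Local Open Scope ring_scope.

Definition simplices (n d : nat) : {set {set 'I_n}} :=
  [set f : {set 'I_n} | #|f| == d.+1]%SET.

Definition dfaces (n d : nat) (Y : {set {set 'I_n}}) : {set {set 'I_n}} :=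
  (Y :&: simplices n d)%SET.

Definition lm_complex (n d : nat) (F : {set {set 'I_n}}) : {set {set 'I_n}} :=
  ([set s : {set 'I_n} | (#|s| <= d)%N] :|: F)%SET.

(* Probability of the event E under the law of Y_d(n, p): F is the random set
   of d-faces, each of which is present independently with probability p. *)
Definition lm_prob (R : realType) (n d : nat) (p : R)
    (E : pred {set {set 'I_n}}) : R :=
  \sum_(F in powerset (simplices n d) | E (lm_complex d F))
    \prod_(f in simplices n d) (if f \in F then p else 1 - p).

(* Convergence in probability of X_n(Y_n) to the constant c, where
   Y_n ~ Y_d(n, p_n). *)
Definition lm_cvg_in_prob (R : realType) (d : nat) (p : nat -> R)
    (X : forall n : nat, {set {set 'I_n}} -> R) (c : R) : Prop :=
  forall eps : R, 0 < eps ->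
    ((fun n : nat => lm_prob d (p n) [pred Y | eps < `|X n Y - c|])
       @ \oo --> (0 : R))%classic.

Definition bistellar0 (V : finType) (T : {set {set V}}) (s : {set V}) (u : V) :
    {set {set V}} :=
  ((T :\ s) :|: [set u |: (s :\ v) | v in s])%SET.

(* A triangulation is represented by the set of its top-dimensional faces, so
   that its vertex set is [finset.cover T]; b is the set of boundary vertices, i.e.
   the vertices of the simplex being triangulated.  The type V is only a pool
   of available vertices and may be larger than that. *)
Inductive stacked_triangulation (V : finType) (b : {set V}) :
    {set {set V}} -> Prop :=
| stacked_simplex : stacked_triangulation b [set b]%SET
| stacked_bistellar0 (T : {set {set V}}) (s : {set V}) (u : V) :
    stacked_triangulation b T -> s \in T -> u \notin finset.cover T ->
    stacked_triangulation b (bistellar0 T s u).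

(* As #|b| = #|f| = d + 1, the condition lab @: b = f says that the boundary
   vertices are labelled bijectively by f. *)
Definition stacked_contraction (n d : nat) (Y : {set {set 'I_n}})
    (f : {set 'I_n}) : Prop :=
  exists (V : finType) (b : {set V}) (T : {set {set V}}) (lab : V -> 'I_n),
    [/\ #|b| = d.+1,
        stacked_triangulation b T,
        lab @: b = f &
        forall s : {set V}, s \in T ->
          {in s &, injective lab} /\ lab @: s \in dfaces d Y].

Definition contracted_fraction (R : realType) (n d : nat)
    (Y : {set {set 'I_n}}) : R :=
  #|[set f in simplices n d | `[< stacked_contraction d Y f >]]%SET|%:R
  / #|simplices n d|%:R.

Definition alpha (R : realType) (d : nat) : R :=
  d.+1%:R ^+ d.+1 / d%:R ^+ d.

Definition Qpoly (R : realType) (d : nat) (gamma : R) : {poly R} :=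
  'X^(d.+1) - 'X + gamma%:P.

Definition smallest_nonneg_root (R : realType) (q : {poly R}) (x : R) : Prop :=
  [/\ 0 <= x, root q x & forall y : R, 0 <= y -> root q y -> x <= y].

(* Main.v *)
Require Import Defs.
From HB Require Import structures.
From mathcomp Require Import boolp reals.
From mathcomp Require Import all_boot all_order all_algebra.
From mathcomp Require Import zify ring lra.
Import Order.TTheory GRing.Theory Num.Theory.

Set Implicit Arguments.
Unset Strict Implicit.
Unset Printing Implicit Defensive.

(** Call a face derivable if it is present or if, for some vertex [x] outside
    it, all the faces obtained by putting [x] in the place of one of its
    vertices are derivable.  Undoing the 0-moves of a stacked triangulation one
    by one, and conversely subdividing a simplex once for every step of a
    derivation, shows that the faces with a stacked contraction are exactly the
    derivable ones.  If derivations were trees without coincidences, the density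
    of the faces derivable in depth [t], multiplied by [n^(1/d)], would follow
    [g_0 = 0] and [g_(t+1) = gamma + g_t^(d+1)]: there are [n] choices for [x],
    and the [d+1] new faces are derivable independently.  Below the threshold
    these densities increase to the smallest root [gh] of [Q_gamma]
    ([smallest_root]).  What has to be shown is that coincidences, and
    derivations whose length grows with [n], do not contribute.

    Derivations are explored from their conclusion.  A run treats the faces of a
    stack in turn, each being claimed as present (a leaf) or expanded by a vertex
    [x], and the probability of a derivation is bounded by a union bound over
    runs, where a run with [l] leaves costs [p^l].  An expansion by a new vertex
    has [n] choices, which have to be paid by [d] more leaves, as [p^d] is about
    [1/n].  An expansion by a vertex already met could a priori spoil this balance.
    That it does not is a rank argument over the field with two elements: an
    expansion is a linear relation between boundaries mod 2 ([bd_children]), so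
    that the leaves span the boundaries of all the faces seen, among which one
    finds explicitly many independent ones ([chain_rank]).  It follows that a run
    with [k] target faces and [m] new vertices has [k + d m + e] leaves where
    [e >= 0] and the number of old expansions is bounded in terms of [e]; for
    [e = 0] there are none, and the run is called clean ([run_counts]).

    Clean runs have total weight at most [(gh n^(-1/d))^k] ([sum_clean_le]).  The
    other runs gain a factor [p] from the surplus leaf, and lose a factor
    polynomial in the length of the run for each old expansion ([sum_wt_le],
    [expect_reach_le]); this loss is harmless for runs of length of order [log n]
    with a surplus [e] of smaller order, and a larger surplus would need a small
    vertex set that carries too many faces ([expect_dense_le]).  Long derivations
    are excluded as in bootstrap percolation: a step of a derivation multiplies
    lengths by at most [d+1], so if some face needs a long derivation then some
    face needs one of a length between [L] and [(d+1) L + 1] ([no_jump]), with [L]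
    of order [log n], and such a run has so many new vertices that it is
    exponentially unlikely when [gamma] is strictly below the threshold
    ([stable_weights], [expect_jump_le]).

    For the second moment the same bound is applied to two disjoint target faces.
    For the mean from below, Bonferroni's inequality is applied to the clean runs
    of bounded length: two different ones with [m] new vertices altogether have at
    least [d m + 2] leaves altogether ([clean_pair]), so that their joint
    occurrence is negligible.  Chebyshev's inequality concludes. *)

(** Sizes and cardinals are generalized first, because the solver would otherwise
    compare their arguments; a hypothesis counts only if it stands in the goal. *)
Ltac clia := clear;
  repeat match goal with
  | |- context [size ?s] => generalize (size s)
  | |- context [card ?A] => generalize (card A)
  end; intros; lia.

(** * Mod 2 boundaries and triangular families of faces *)

Section Faces.
Variables (T : finType) (d : nat).
Implicit Types (f g h r s U V : {set T}) (x y u v w : T) (A B G : seq {set T}).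

(** The boundary mod 2. *)
Definition bd g : {ffun {set T} -> ('F_2)^o} :=
  [ffun r : {set T} => if (#|r| == d) && (r \subset g) then 1%R else 0%R].

Definition swap x h v : {set T} := x |: (h :\ v).

(** The facets of the simplex [x |: h] other than [h]. *)
Definition children x h := [seq swap x h v | v <- enum h].

Lemma mem_children x h g : reflect (exists2 v, v \in h & g = swap x h v) (g \in children x h).
Proof.
apply: (iffP mapP) => [[v hv ->]|[v hv ->]]; exists v => //; by rewrite mem_enum in hv *.
Qed.

Lemma card_swap x h v : x \notin h -> v \in h -> #|swap x h v| = #|h|.
Proof.
by move=> xh vh; rewrite cardsU1 !inE (negPf xh) andbF [RHS](cardsD1 v h) vh.
Qed.

Lemma size_children x h : size (children x h) = #|h|.
Proof. by rewrite size_map -cardE. Qed.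

Lemma swap_inj x h v v' : x \notin h -> v \in h -> v' \in h ->
  swap x h v = swap x h v' -> v = v'.
Proof.
move=> xh vh vh' e; apply/eqP; apply: contraT => ne.
have : v' \in swap x h v by rewrite !inE vh' (eq_sym v' v) ne orbT.
by rewrite e !inE eqxx /= orbF => /eqP xv; move: xh; rewrite -xv vh'.
Qed.

Lemma uniq_children x h : x \notin h -> uniq (children x h).
Proof.
move=> xh; rewrite map_inj_in_uniq ?enum_uniq // => v v'.
by rewrite !mem_enum => hv hv'; apply: swap_inj.
Qed.

(** A set of [d] vertices lies in no facet of the simplex [x |: h] or in exactly
    two, namely those opposite to the two missing vertices. *)
Lemma bd_children x h : x \notin h -> #|h| = d.+1 ->
  (bd h = \sum_(g <- children x h) bd g)%R.
Proof.
move=> xh ch; apply/ffunP => r; rewrite big_map big_enum /=.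
rewrite sum_ffunE !ffunE.
under eq_bigr => v _ do rewrite ffunE.
have [cr|] /= := eqVneq #|r| d; last by rewrite big1.
rewrite -big_mkcondr /= sumr_const.
have [rxh|rxh] := boolP (r \subset x |: h); last first.
  have -> : r \subset h = false.
    by apply: contraNF rxh => /subset_trans; apply; exact: subsetUr.
  rewrite (eq_card0 (A := _)) // => v; rewrite !inE; apply: contraNF rxh => /andP[_ /subset_trans]; apply.
  by rewrite setUS // subD1set.
have [xr|xr] := boolP (x \in r).
  have -> : r \subset h = false.
    by apply: contraNF xh => /subsetP /(_ _ xr).
  have -> : #|[pred i in h | r \subset swap x h i]| = #|h :\: r|.
    apply: eq_card => v; rewrite !inE [RHS]andbC; case vh: (v \in h) => //=.
    apply/idP/idP => [/subsetP sr|vr].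
      apply/negP => vr; have := sr _ vr; rewrite !inE eqxx /= orbF => /eqP e.
      by move: xh; rewrite -e vh.
    apply/subsetP => z zr; rewrite !inE; have := subsetP rxh _ zr; rewrite !inE.
    case/orP => [->//|->]; rewrite andbT; apply/orP; right.
    by apply: contraNneq vr => <-.
  have -> : #|h :\: r| = 2.
    have cxh : #|x |: h| = d.+2 by rewrite cardsU1 xh ch.
    have <- : (x |: h) :\: r = h :\: r.
      apply/setP => z; rewrite !inE; case: eqVneq => [->|//]; by rewrite xr.
    by rewrite cardsDS // cxh cr; clia.
  by apply/eqP.
have rh : r \subset h.
  apply/subsetP => z zr; have := subsetP rxh _ zr; rewrite !inE => /orP[/eqP e|//].
  by move: xr; rewrite -e zr.
rewrite rh.
have -> : #|[pred i in h | r \subset swap x h i]| = #|h :\: r|.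
  apply: eq_card => v; rewrite !inE [RHS]andbC; case vh: (v \in h) => //=.
  apply/idP/idP => [/subsetP sr|vr].
    apply/negP => vr; have := sr _ vr; rewrite !inE eqxx /= orbF => /eqP e.
    by move: xh; rewrite -e vh.
  apply/subsetP => z zr; rewrite !inE (subsetP rh _ zr) andbT; apply/orP; right.
  by apply: contraNneq vr => <-.
by rewrite cardsDS // ch cr subSnn.
Qed.

Definition pivotal r G := all (fun g => ~~ (r \subset g)) G.

(** The pivot of a face is a facet of it that no later face contains. *)
Fixpoint triangular G : bool :=
  if G is g :: G' then
    [exists r : {set T}, [&& #|r| == d, r \subset g & pivotal r G']] && triangular G'
  else true.

Definition spanned A g := bd g \in <<map bd A>>%VS.

(** The pivots make the boundaries of [G] linearly independent. *)
Lemma size_triangular G A :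
  triangular G -> all (spanned A) G -> size G <= size A.
Proof.
move=> tG sG.
have fG : free (map bd G).
  elim: G tG {sG} => [|g G IH] /=; first by rewrite nil_free.
  case/andP=> /existsP[r /and3P[/eqP cr rg pr]] tG.
  rewrite free_cons IH // andbT; apply/negP => /(coord_span (X := in_tuple (map bd G))) bE.
  have := congr1 (fun F : {ffun {set T} -> ('F_2)^o} => F r) bE.
  rewrite /bd ffunE cr eqxx rg /= sum_ffunE big1 => [/eqP|i _]; first by rewrite oner_eq0.
  rewrite !ffunE [X in (_ *: X)%R](_ : _ = 0%R) ?scaler0 //.
  have iG : i < size G by rewrite -(size_map bd).
  rewrite (nth_map g) // ffunE.
  by move/allP: pr => /(_ _ (mem_nth g iG)) /negPf ->; rewrite andbF.
rewrite -(size_map bd G) -(size_map bd A) -(eqP fG).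
apply: leq_trans (dim_span _); apply: dimvS; apply/span_subvP => b /mapP[g gG ->].
exact: (allP sG).
Qed.

Lemma spanned_mem A g : g \in A -> spanned A g.
Proof. by move=> gA; apply: memv_span; apply: map_f. Qed.

(** A derivation step is one linear relation between boundaries. *)
Lemma spanned_step A x h : x \notin h -> #|h| = d.+1 ->
  all (spanned A) (children x h) -> spanned A h.
Proof.
move=> xh ch /allP sA; rewrite /spanned (bd_children xh ch) big_seq_cond.
by apply: rpred_sum => g; rewrite andbT => /sA.
Qed.

Lemma spanned_sub A B g : {subset A <= B} -> spanned A g -> spanned B g.
Proof.
move=> AB; rewrite /spanned; apply/subvP; apply/sub_span => b /mapP[h hA ->].
by apply: map_f; apply: AB.
Qed.

End Faces.

(** * The rank of a family of faces built vertex by vertex *)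

Section Rank.
Variables (T : finType) (d : nat).
Hypothesis d2 : 2 <= d.
Implicit Types (f g h r s U V H S : {set T}) (x y u v w : T) (A B G Q : seq {set T}).
Implicit Types (X : seq ({set T} * T)) (nw : seq (T * {set T})).

Definition is_face g := #|g| == d.+1.

(** The vertices [p.2] are private to their faces [p.1], which is what gives these
    faces their pivots. *)
Fixpoint extras H X : bool :=
  if X is p :: X' then
    [&& p.2 \in p.1, p.2 \notin H, all (fun q : {set T} * T => p.2 \notin q.1) X' & extras H X']
  else true.

(** A face is picked whenever it leaves the region covered so far; since it
    contains [x], it enlarges this region by at most [d] vertices. *)
Lemma greedy_extras x H (gs : seq {set T}) :
  x \in H -> all (fun g : {set T} => is_face g && (x \in g)) gs ->
  exists X S, [/\ extras H X, {subset unzip1 X <= gs},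
    H \subset S, all (fun g : {set T} => g \subset S) gs & #|S| <= #|H| + d * size X].
Proof.
move=> xH; elim: gs => [_|g gs IH /= /andP[/andP[/eqP cg xg] /IH [X [S [eX sX HS gS cS]]]]].
  by exists [::], H; rewrite /= muln0 addn0.
have [gsub|] := boolP (g \subset S).
  exists X, S; split; rewrite /= ?gsub //.
  by move=> z /sX zgs; rewrite inE zgs orbT.
case/subsetPn => w wg wS; exists ((g, w) :: X), (g :|: S); split => /=.
- rewrite wg eX andbT /=; apply/andP; split; first by apply: contra wS; exact: (subsetP HS).
  apply/allP => q qX; apply: contra wS.
  have /(allP gS) : q.1 \in gs by apply: sX; apply: map_f.
  by move/subsetP; apply.
- move=> z; rewrite !inE => /orP[->//|/sX ->]; by rewrite orbT.
- by apply: subset_trans HS _; apply: subsetUr.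
- rewrite subsetUl /=; apply: sub_all gS => z zS; apply: subset_trans zS _; exact: subsetUr.
- have : #|g :|: S| <= #|S| + d.
    rewrite setUC cardsU -addnBA ?subset_leq_card ?subsetIr // leq_add2l -cardsDS ?subsetIr //.
    rewrite -[X in _ <= X]/(d.+1.-1) -cg (cardsD1 x g) xg /= add0n.
    apply: subset_leq_card; apply/subsetP => z; rewrite !inE => /andP[nzS zg].
    rewrite zg andbT; apply: contraNneq nzS => ->.
    by rewrite (subsetP HS) // xg.
  by move: cS; rewrite mulnS; clia.
Qed.

Lemma count_through x S Q : uniq Q -> x \in S ->
  all (fun g : {set T} => [&& is_face g, x \in g & g \subset S]) Q -> size Q <= 'C(#|S|.-1, d).
Proof.
move=> uQ xS aQ.
have -> : #|S|.-1 = #|S :\ x| by rewrite (cardsD1 x S) xS.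
rewrite -cards_draws -(size_map (fun g : {set T} => g :\ x)) -(card_uniqP _).
  apply: subset_leq_card; apply/subsetP => z /mapP[g gQ ->].
  have /and3P[/eqP cg xg gS] := allP aQ _ gQ.
  by rewrite !inE setSD //= -eqSS -cg (cardsD1 x g) xg.
rewrite map_inj_in_uniq // => g g' gQ gQ' e.
have /and3P[_ xg _] := allP aQ _ gQ; have /and3P[_ xg' _] := allP aQ _ gQ'.
by rewrite -(setD1K xg) e setD1K.
Qed.

(** Pivots through the new vertex [x], which no face of [G] contains: for an extra
    face, a facet through [x] and the private vertex; for [swap x h u], the facet
    that misses [y], which contains all the vertices removed by the other swaps. *)
Lemma triangular_extras x U h G X :
  x \notin U -> h \subset U -> all (fun g : {set T} => g \subset U) G ->
  extras (x |: h) X -> all (fun p : {set T} * T => is_face p.1 && (x \in p.1)) X ->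
  triangular d G ->
  forall y, y \in h -> is_face h ->
  triangular d (unzip1 X ++ [seq swap x h u | u <- enum (h :\ y)] ++ G).
Proof.
move=> xU hU GU eX fX tG y yh /eqP ch.
have xh : x \notin h by apply: contra xU; apply: (subsetP hU).
elim: X eX fX => [_ _|[g w] X IH] /=; last first.
  case/and4P => wg wH wX eX /andP[/andP[/eqP cg xg] fX]; rewrite IH // andbT.
  have wx : w != x by apply: contraNneq wH => ->; rewrite setU11.
  have [z zg] : exists z, z \in (g :\ x) :\ w.
    apply/set0Pn; rewrite -card_gt0.
    have := cardsD1 w (g :\ x); have := cardsD1 x g.
    rewrite !inE wx wg xg cg !add1n => -[<-] e; by rewrite -ltnS -e.
  move: zg; rewrite !inE => /and3P[zw zx zg].
  apply/existsP; exists (g :\ z); apply/and3P; split.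
  - by rewrite -eqSS -cg (cardsD1 z g) zg.
  - exact: subD1set.
  have wgz : w \in g :\ z by rewrite !inE eq_sym zw.
  rewrite /pivotal !all_cat; apply/and3P; split.
  - rewrite all_map; apply: sub_all wX => q /=; apply: contra => /subsetP; exact.
  - apply/allP => _ /mapP[u uh ->]; apply: contra wH => /subsetP /(_ _ wgz).
    by rewrite !inE => /orP[->//|/andP[_ ->]]; rewrite orbT.
  - apply/allP => q qG; apply: contra xU => /subsetP /(_ x).
    rewrite !inE eq_sym zx xg => /(_ isT); exact: (subsetP (allP GU _ qG)).
have : {subset enum (h :\ y) <= h :\ y} by move=> u; rewrite mem_enum.
have := enum_uniq (mem (h :\ y)).
elim: (enum (h :\ y)) => [//|u us IH] /= /andP[uus uu] su.
have suu : {subset us <= h :\ y} by move=> v vus; apply: su; rewrite inE vus orbT.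
rewrite IH // andbT.
have := su u (mem_head _ _); rewrite !inE => /andP[uy uh].
apply/existsP; exists (swap x (h :\ u) y); apply/and3P; split.
- have -> : #|swap x (h :\ u) y| = #|h :\ u|.
    by apply: card_swap; rewrite !inE ?(negPf xh) ?andbF // eq_sym uy yh.
  by rewrite -eqSS -ch (cardsD1 u h) uh.
- by rewrite setUS // subD1set.
rewrite /pivotal all_cat; apply/andP; split.
- apply/allP => _ /mapP[v vus ->].
  have := suu _ vus; rewrite !inE => /andP[vy vh].
  have vu : v != u by apply: contraNneq uus => <-.
  apply/negP => /subsetP /(_ v); rewrite !inE vh vy vu eqxx orbT /= => /(_ isT).
  by rewrite orbF => /eqP e; move: xh; rewrite -e vh.
- apply/allP => q qG; apply: contra xU => /subsetP /(_ x).
  rewrite !inE eqxx => /(_ isT); exact: (subsetP (allP GU _ qG)).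
Qed.

Definition used U0 nw : {set T} := U0 :|: [set:: unzip1 nw].

Lemma used_cons U0 p nw : used U0 (p :: nw) = p.1 |: used U0 nw.
Proof. by apply/setP => z; rewrite !inE; case: (z == p.1); rewrite ?orbT. Qed.

(** The vertices enter from the end of the list to its head, each as the apex of a
    cone over a face on the vertices present at that time. *)
Fixpoint chain U0 nw Q : bool :=
  if nw is p :: nw' then
    [&& p.1 \notin used U0 nw', p.2 \subset used U0 nw', is_face p.2,
        all (mem Q) (children p.1 p.2) & chain U0 nw' Q]
  else true.

Lemma chain_restrict U0 nw Q V : used U0 nw \subset V -> chain U0 nw Q ->
  chain U0 nw [seq g : {set T} <- Q | g \subset V].
Proof.
elim: nw => [//|[x h] nw IH]; rewrite used_cons subUset => /andP[xV nV] /=.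
case/and5P => -> hU -> ch /(IH nV) ->; rewrite hU andbT /=.
apply/allP => g gc; rewrite /= mem_filter (_ : g \in Q) ?andbT; last exact: (allP ch).
have [v vh ->] := mem_children _ _ _ gc.
rewrite subUset xV; apply: subset_trans nV; apply: subset_trans hU; exact: subD1set.
Qed.

(** The two terms count the surplus faces on the starting vertices and those through
    a later vertex; [through_bound] is the reason for the power of [d]. *)
Definition excess_bound c0 E := E * (c0 + (d.+1 + d * E) ^ d).

Lemma excess_bound_add c0 a b :
  excess_bound c0 a + excess_bound c0 b <= excess_bound c0 (a + b).
Proof.
rewrite /excess_bound mulnDl; apply: leq_add; rewrite leq_mul2l leq_add2l; apply/orP; right;
  by rewrite leq_exp2r ?(leq_trans _ d2) // leq_add2l leq_mul2l ?leq_addr ?leq_addl orbT.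
Qed.

Lemma bin_le_exp a b : 'C(a, b) <= a ^ b.
Proof.
have H : a ^_ b <= a ^ b.
  elim: b => [|b IH]; first by rewrite ffactn0.
  by rewrite ffactnSr expnS mulnC leq_mul // leq_subr.
apply: leq_trans H; rewrite -bin_ffact leq_pmulr // fact_gt0 //.
Qed.

Lemma through_bound c0 e : 'C(d.+1 + d * e, d) <= d.+1 + excess_bound c0 e.
Proof.
case: e => [|e]; first by rewrite /excess_bound mul0n muln0 !addn0 binSn.
apply: leq_trans (bin_le_exp _ _) _; apply: leq_trans (leq_addl _ _).
by apply: leq_trans (leq_addl c0 _) _; rewrite leq_pmull.
Qed.

(** Each family of faces on the starting vertices has at most [c0] more faces than
    [F0] for every independent face that it has in addition to [F0]. *)
Definition base_ok U0 (F0 : seq {set T}) c0 :=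
  forall Q, uniq Q -> all is_face Q -> all (fun g : {set T} => g \subset U0) Q ->
    {subset F0 <= Q} ->
    exists G E, [/\ triangular d G, {subset G <= Q}, size G = size F0 + E
      & size Q <= size F0 + E * c0].

(** Induction over the vertices, the newest one [x] first.  Beside the faces that
    avoid [x], an independent family contains [d] of the swaps of the base [h], and
    one further face for each greedy extra.  If there are [e] extras then all the
    faces through [x] lie on [d.+1 + d * e] vertices and [x], which bounds their
    number; for [e = 0] only the [d.+1] swaps are left. *)
Lemma chain_rank U0 F0 c0 nw Q : base_ok U0 F0 c0 ->
  uniq Q -> all is_face Q -> all (fun g : {set T} => g \subset used U0 nw) Q ->
  {subset F0 <= Q} -> all (fun g : {set T} => g \subset U0) F0 -> chain U0 nw Q ->
  exists G E, [/\ triangular d G, {subset G <= Q},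
    size G = size F0 + d * size nw + E
    & size Q <= size F0 + d.+1 * size nw + excess_bound c0 E].
Proof.
move=> bok; elim: nw Q => [|[x h] nw IH] Q uQ fQ QU FQ FU /=.
  move=> _.
  have QU0 : all (fun g : {set T} => g \subset U0) Q.
    by apply: sub_all QU => g; rewrite /used set_nil setU0.
  have [G [E [tG sG cG cQ]]] := bok Q uQ fQ QU0 FQ.
  exists G, E; split; rewrite ?muln0 ?addn0 //.
  apply: leq_trans cQ _; rewrite leq_add2l /excess_bound leq_mul2l leq_addr orbT //.
rewrite used_cons /= in QU.
case/and5P=> xU hU fh chQ chn.
pose Q1 := [seq g : {set T} <- Q | g \subset used U0 nw].
pose Q2 := [seq g : {set T} <- Q | ~~ (g \subset used U0 nw)].
have chQ1 : chain U0 nw Q1.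
  exact: chain_restrict.
have [G1 [E1 [tG1 sG1 cG1 cQ1]]] : exists G E, [/\ triangular d G, {subset G <= Q1},
    size G = size F0 + d * size nw + E
    & size Q1 <= size F0 + d.+1 * size nw + excess_bound c0 E].
  apply: IH => //; rewrite ?filter_uniq //.
  - by apply/allP => g; rewrite mem_filter => /andP[_ /(allP fQ)].
  - by apply/allP => g; rewrite mem_filter => /andP[].
  - move=> g gF; rewrite mem_filter (FQ _ gF) andbT.
    by apply: subset_trans (allP FU _ gF) _; apply: subsetUl.
have xQ2 g : g \in Q2 -> x \in g.
  rewrite mem_filter => /andP[gU /(allP QU) gxU].
  apply: contraNT gU => xg; apply/subsetP => z zg; have := subsetP gxU _ zg.
  by rewrite in_setU1 => /orP[/eqP e|//]; move: xg; rewrite -e zg.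
have aQ2 : all (fun g : {set T} => is_face g && (x \in g)) Q2.
  by apply/allP => g gQ2; rewrite xQ2 // andbT; move: gQ2; rewrite mem_filter => /andP[_ /(allP fQ)].
have [X [S [eX sX HS gS cS]]] := greedy_extras (setU11 x h) aQ2.
have [y yh] : exists y, y \in h by apply/set0Pn; rewrite -card_gt0 (eqP fh).
have xh : x \notin h by apply: contra xU; apply: (subsetP hU).
exists (unzip1 X ++ [seq swap x h u | u <- enum (h :\ y)] ++ G1), (E1 + size X); split.
- apply: (@triangular_extras x (used U0 nw)) => //.
    by apply/allP => g /sG1; rewrite mem_filter => /andP[].
  by apply/allP => p pX; apply: (allP aQ2); apply: sX; apply: map_f.
- move=> g; rewrite !mem_cat => /or3P[/sX|/mapP[u uh ->]|/sG1].
  + by rewrite mem_filter => /andP[].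
  + apply: (allP chQ); apply: map_f; move: uh; rewrite !mem_enum; exact: (subsetP (subD1set _ _)).
  + by rewrite mem_filter => /andP[].
- rewrite !size_cat cG1 !size_map -cardE.
  have : #|h :\ y| = d by apply/eqP; rewrite -eqSS -(eqP fh) (cardsD1 y h) yh.
  by move=> ->; rewrite mulnS; clia.
- have sQ : size Q = size Q1 + size Q2 by rewrite !size_filter -[LHS](count_predC (fun g : {set T} => g \subset used U0 nw)).
  have sQ2 : size Q2 <= d.+1 + excess_bound c0 (size X).
    apply: leq_trans (through_bound c0 (size X)).
    apply: leq_trans (_ : 'C(#|S|.-1, d) <= _).
      apply: (@count_through x); rewrite ?filter_uniq ?(subsetP HS) ?setU11 //.
      by apply/allP => g gQ2; have /andP[-> ->] := allP aQ2 _ gQ2; rewrite (allP gS).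
    apply: leq_bin2l; move: cS; rewrite cardsU1 xh (eqP fh); clia.
  have := excess_bound_add c0 E1 (size X); rewrite mulnS sQ; move: sQ2 cQ1.
  by move: (excess_bound _ _) (excess_bound _ _) (excess_bound _ _) => ? ? ?; clia.
Qed.

End Rank.

(** * Exploring a derivation from its conclusion *)

(** The faces still to be justified, all faces met, the faces claimed as present, the
    expansions by a vertex met for the first time with the expanded face, the
    vertices met, and the number of the other expansions. *)
Record state (T : finType) := State {
  stk : seq {set T};
  seen : seq {set T};
  lvs : seq {set T};
  nws : seq (T * {set T});
  usd : {set T};
  old : nat }.

Section StateEq.
Variable T : finType.

Definition state_code (st : state T) :=
  (stk st, seen st, lvs st, nws st, usd st, old st).

Definition state_decode c : state T :=
  let: (a, b, l, w, u, o) := c in State a b l w u o.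

Lemma state_codeK : cancel state_code state_decode.
Proof. by case. Qed.

HB.instance Definition _ := Equality.copy (state T) (can_type state_codeK).

End StateEq.

Section Runs.
Variables (T : finType) (d : nat).
Hypothesis d2 : 2 <= d.
Implicit Types (f g h U : {set T}) (x y u v w : T) (B D Q : seq {set T}).
Implicit Types (F : {set {set T}}).
Implicit Types (st r : state T).

Definition start B U : state T := State B B [::] [::] U 0.

Definition leaf st : state T :=
  if stk st is h :: s then
    State s (seen st) (h :: lvs st) (nws st) (usd st) (old st)
  else st.

Definition expand st x : state T :=
  if stk st is h :: s then
    let c := [seq g : {set T} <- children x h | g \notin seen st] in
    State (c ++ s) (c ++ seen st) (lvs st)
      (if x \in usd st then nws st else (x, h) :: nws st) (x |: usd st)
      (old st + (x \in usd st))
  else st.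

(** The list does not depend on the random complex, so that sums over it are union
    bounds over all conceivable derivations. *)
Fixpoint runs N st : seq (state T) :=
  if stk st is h :: _ then
    if N is N'.+1 then
      runs N' (leaf st) ++ flatten [seq runs N' (expand st x) | x <- enum (~: h)]
    else [::]
  else [:: st].

Lemma runs_done N st : stk st = [::] -> runs N st = [:: st].
Proof. by case: N => [|N] /= ->. Qed.

Lemma mem_runsS N st h s : stk st = h :: s -> forall r,
  reflect (r \in runs N (leaf st) \/ exists2 x, x \notin h & r \in runs N (expand st x))
    (r \in runs N.+1 st).
Proof.
move=> e r; rewrite /= e mem_cat; apply: (iffP orP).
  case=> [|/flatten_mapP[x]]; first by left.
  by rewrite mem_enum inE => xh ?; right; exists x.
case=> [|[x xh rr]]; [by left|right; apply/flatten_mapP; exists x => //].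
by rewrite mem_enum inE.
Qed.

Lemma runs_ind (P : nat -> state T -> state T -> Prop) :
  (forall N st, stk st = [::] -> P N st st) ->
  (forall N st r h s, stk st = h :: s -> r \in runs N (leaf st) ->
     P N (leaf st) r -> P N.+1 st r) ->
  (forall N st r h s x, stk st = h :: s -> x \notin h -> r \in runs N (expand st x) ->
     P N (expand st x) r -> P N.+1 st r) ->
  forall N st r, r \in runs N st -> P N st r.
Proof.
move=> P0 Pl Pe; elim=> [|N IH] st r.
  rewrite /=; case e: (stk st) => [|h s]; rewrite ?inE // => /eqP ->; exact: P0.
case e: (stk st) => [|h s]; first by rewrite runs_done // inE => /eqP ->; exact: P0.
case/(mem_runsS N e) => [rl|[x xh rx]]; first by apply: (Pl _ _ _ _ _ e) => //; exact: IH.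
by apply: (Pe _ _ _ _ _ _ e xh) => //; exact: IH.
Qed.

Record inv U B st : Prop := Inv {
  inv_uniq : uniq (seen st);
  inv_face : all (is_face d) (seen st);
  inv_used : all (fun g : {set T} => g \subset usd st) (seen st);
  inv_size : size (seen st) = size (stk st) + size (lvs st) + size (nws st) + old st;
  inv_open : uniq (stk st ++ lvs st);
  inv_sub : {subset stk st ++ lvs st <= seen st};
  inv_usd : usd st = used U (nws st);
  inv_chain : chain d U (nws st) (seen st);
  inv_base : {subset B <= seen st} }.

Lemma inv_start U B : uniq B -> all (is_face d) B ->
  all (fun g : {set T} => g \subset U) B -> inv U B (start B U).
Proof.
move=> uB fB BU; split; rewrite //= ?cats0 ?addn0 //.
by rewrite /used set_nil setU0.
Qed.

Lemma chain_sub U nw Q Q' : {subset Q <= Q'} -> chain d U nw Q -> chain d U nw Q'.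
Proof.
move=> QQ; elim: nw => [//|[x h] nw IH] /= /and5P[-> -> -> ch /IH ->].
by rewrite andbT /=; apply: sub_all ch.
Qed.

Lemma inv_leaf U B st : inv U B st -> inv U B (leaf st).
Proof.
rewrite /leaf; case e: (stk st) => [//|h s] [uS fS US sS oS subS uU cS bS]; split => //=.
- by rewrite sS e /=; clia.
- have : perm_eq (stk st ++ lvs st) (s ++ h :: lvs st).
    by rewrite e perm_sym (perm_catCA s [:: h]).
  by move/perm_uniq => <-.
- move=> g gs; apply: subS; rewrite e; move: gs; rewrite !mem_cat !inE.
  by rewrite orbCA orbA.
Qed.

Lemma inv_expand U B st x h s : stk st = h :: s -> x \notin h ->
  inv U B st -> inv U B (expand st x).
Proof.
rewrite /expand => e xh [uS fS US sS oS subS uU cS bS]; rewrite e.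
set c := [seq g <- _ | _].
have hS : h \in seen st by apply: subS; rewrite e mem_head.
have fh : is_face d h by exact: (allP fS).
have hU : h \subset usd st by exact: (allP US).
have cP g : g \in c -> exists2 v, v \in h & g = swap x h v.
  by rewrite mem_filter => /andP[_ /mem_children].
have uc : uniq c by rewrite filter_uniq // uniq_children.
have dis : ~~ has (mem (seen st)) c.
  by apply/hasPn => g; rewrite mem_filter => /andP[].
have dis' (s' : seq {set T}) : {subset s' <= seen st} -> ~~ has (mem s') c.
  by move=> ss; apply: contra dis; apply: sub_has => z /ss.
split => /=.
- by rewrite cat_uniq uc uS andbT; apply: contra dis => /hasP[g g1 g2]; apply/hasP; exists g.
- rewrite all_cat fS andbT; apply/allP => g /cP[v vh ->].
  by rewrite /is_face card_swap.
- rewrite all_cat; apply/andP; split; last first.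
    by apply: sub_all US => g gU; apply: subset_trans gU _; exact: subsetUr.
  apply/allP => g /cP[v vh ->]; rewrite setUS //.
  by apply: subset_trans hU; exact: subD1set.
- rewrite !size_cat sS e /=; case: (x \in usd st) => /=; clia.
- rewrite -catA cat_uniq uc /=.
  have := oS; rewrite e /= => /andP[_ ->]; rewrite andbT.
  rewrite has_sym; apply: dis' => z zs; apply: subS; by rewrite e inE zs orbT.
- move=> g; rewrite -catA !mem_cat => /or3P[->//|gs|gl]; apply/orP; right; apply: subS;
    by rewrite e mem_cat inE ?gs ?gl ?orbT.
- case: ifP => xU; last by rewrite used_cons uU.
  by rewrite -uU; apply/setUidPr; rewrite sub1set.
- have cS' : chain d U (nws st) (c ++ seen st).
    by apply: chain_sub cS => g gS; rewrite mem_cat gS orbT.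
  case: ifP => xU //=; rewrite -uU xU hU fh cS' andbT /=.
  apply/allP => g gc; rewrite /= mem_cat mem_filter gc andbT.
  by case: (g \in seen st); rewrite ?orbT.
- by move=> g /bS gS; rewrite mem_cat gS orbT.
Qed.

Lemma inv_runs U B N st r : r \in runs N st -> inv U B st ->
  inv U B r /\ stk r = [::].
Proof.
elim/runs_ind: r / => [{}N {}st e|{}N {}st r h s e _ IH|{}N {}st r h s x e xh _ IH] i.
- by [].
- by apply: IH; exact: inv_leaf.
- by apply: IH; exact: inv_expand e xh i.
Qed.

(** The leaves span all faces seen, so there are at least as many leaves as
    independent faces seen; the surplus of leaves then bounds the number of faces
    seen, and hence that of the old expansions, by [chain_rank]. *)
Lemma run_counts U B c0 r : inv U B r -> stk r = [::] ->
  all (fun g : {set T} => g \subset U) B -> base_ok d U B c0 ->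
  all (spanned d (lvs r)) (seen r) ->
  exists e, [/\ size (lvs r) = size B + d * size (nws r) + e,
    old r <= excess_bound d c0 e & e = 0 -> old r = 0].
Proof.
move=> [uS fS US sS oS subS uU cS bS] e0 BU bok sp.
rewrite uU in US.
have [G [E [tG sG cG cQ]]] := chain_rank d2 bok uS fS US bS BU cS.
have := size_triangular tG (A := lvs r) _; rewrite cG => /(_ _)/wrap[|leG].
  by apply/allP => g /sG; exact: (allP sp).
move: cQ; rewrite sS e0 /= add0n => cQ.
exists (size (lvs r) - (size B + d * size (nws r))).
have E_le : E <= size (lvs r) - (size B + d * size (nws r)) by move: leG; clia.
have mono : excess_bound d c0 E <= excess_bound d c0 (size (lvs r) - (size B + d * size (nws r))).
  rewrite -(subnKC E_le); apply: leq_trans (excess_bound_add d2 _ _ _); exact: leq_addr.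
split.
- by move: leG; clia.
- apply: leq_trans mono; move: cQ leG; move: (excess_bound _ _ _) => b; rewrite mulSn; clia.
- move=> e1; move: E_le; rewrite e1 leqn0 => /eqP E0.
  move: cQ leG e1; rewrite E0 /excess_bound mul0n mulSn; clia.
Qed.

Lemma base_ok_single f c0 : is_face d f -> base_ok d f [:: f] c0.
Proof.
move=> ff Q uQ fQ QU sQ.
have Qf : {subset Q <= [:: f]}.
  move=> g gQ; rewrite inE eqEcard (allP QU) //=.
  by rewrite (eqP ff) (eqP (allP fQ _ gQ)).
exists [:: f], 0; split => //=.
- rewrite andbT; have [y yf] : exists y, y \in f by apply/set0Pn; rewrite -card_gt0 (eqP ff).
  apply/existsP; exists (f :\ y); rewrite subD1set /= andbT.
  by rewrite -eqSS -(eqP ff) (cardsD1 y f) yf.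
- by rewrite (uniq_leq_size uQ Qf).
Qed.

Lemma facet_through g a b : is_face d g -> a \in g -> b \in g ->
  exists r : {set T}, [/\ #|r| == d, r \subset g, a \in r & b \in r].
Proof.
move=> /eqP cg ag bg.
have [z] : exists z, z \in g :\: [set a; b].
  apply/set0Pn; rewrite -card_gt0.
  have : #|g| <= #|[set a; b]| + #|g :\: [set a; b]|.
    apply: leq_trans (leq_card_setU _ _); apply: subset_leq_card.
    by apply/subsetP => z zg; rewrite in_setU in_setD zg andbT; case: (z \in _).
  rewrite cg cards2; move: d2; case: (a != b) => /=; clia.
rewrite !inE negb_or -andbA => /and3P[za zb zg]; exists (g :\ z); split.
- by rewrite -eqSS -cg (cardsD1 z g) zg.
- exact: subD1set.
- by rewrite !inE ag eq_sym za.
- by rewrite !inE bg eq_sym zb.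
Qed.

(** A face inside [f :|: g] other than these two leaves both of them, so it has a
    facet that neither contains, and this facet is its pivot. *)
Lemma base_ok_pair f g : is_face d f -> is_face d g -> [disjoint f & g] ->
  base_ok d (f :|: g) [:: f; g] (2 ^ (d.+1 + d.+1)).
Proof.
move=> ff fg dis Q uQ fQ QU sQ.
have t2 : triangular d [:: f; g].
  rewrite /= andbT; apply/andP; split.
    have [y yf] : exists y, y \in f by apply/set0Pn; rewrite -card_gt0 (eqP ff).
    have [r [cr rf yr _]] := facet_through ff yf yf.
    apply/existsP; exists r; rewrite cr rf /= andbT.
    by apply: contraL yf => /subsetP /(_ _ yr) yg; rewrite (disjointFl dis).
  have [y yg] : exists y, y \in g by apply/set0Pn; rewrite -card_gt0 (eqP fg).
  by have [r [cr rg _ _]] := facet_through fg yg yg; apply/existsP; exists r; rewrite cr rg.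
have [Qs|] := boolP (all (mem [:: f; g]) Q).
  exists [:: f; g], 0; split => //=.
  by rewrite (uniq_leq_size uQ (allP Qs)).
case/allPn => h hQ; rewrite !inE negb_or => /andP[hf hg].
have [/eqP ch hU] := (allP fQ _ hQ, allP QU _ hQ).
have [a ah af] : exists2 a, a \in h & a \notin f.
  by apply/subsetPn; apply/negP => s; move/negP: hf; apply; rewrite eqEcard s (eqP ff) ch /=.
have [b bh bg] : exists2 b, b \in h & b \notin g.
  by apply/subsetPn; apply/negP => s; move/negP: hg; apply; rewrite eqEcard s (eqP fg) ch /=.
have [r [cr rh ar br]] := facet_through (allP fQ _ hQ) ah bh.
exists [:: h; f; g], 1; split.
- apply/andP; split => //; apply/existsP; exists r; rewrite cr rh /= andbT.
  by apply/andP; split; [apply: contra af|apply: contra bg] => /subsetP; apply.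
- by move=> z; rewrite inE => /orP[/eqP ->//|]; apply: sQ.
- by [].
- rewrite mul1n; apply: leq_trans (leq_addl _ _).
  have -> : d.+1 + d.+1 = #|f :|: g|.
    by rewrite cardsU (disjoint_setI0 dis) cards0 subn0 (eqP ff) (eqP fg).
  rewrite -card_powerset -(card_uniqP uQ); apply: subset_leq_card.
  by apply/subsetP => z zQ; rewrite powersetE (allP QU).
Qed.

(** Derivations are listed from the conclusion backwards. *)
Fixpoint deriv F D : bool :=
  if D is g :: D' then
    ((g \in F) || [exists x, (x \notin g) && all (mem D') (children x g)]) && deriv F D'
  else true.

Lemma deriv_cat F D D' : deriv F D -> deriv F D' -> deriv F (D ++ D').
Proof.
move=> + dD'; elim: D => [//|g D IH] /= /andP[gP /IH ->]; rewrite andbT.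
case/orP: gP => [->//|/existsP[x /andP[xg al]]]; apply/orP; right; apply/existsP; exists x.
by rewrite xg; apply: sub_all al => z /= zD; rewrite mem_cat zD.
Qed.

Lemma deriv_undup F D : deriv F D -> deriv F (undup D).
Proof.
elim: D => [//|g D IH] /= /andP[gP /IH dD]; case: ifP => // gD; rewrite /= dD andbT.
case/orP: gP => [->//|/existsP[x /andP[xg al]]]; apply/orP; right; apply/existsP; exists x.
by rewrite xg; apply: sub_all al => z /=; rewrite mem_undup.
Qed.

(** One justification is fixed for each face, and it only refers to faces further
    down the list: this makes the exploration below deterministic. *)
Lemma deriv_decision F D : uniq D -> deriv F D ->
  exists dec : {set T} -> option T, forall g, g \in D ->
    if dec g is Some x then
      x \notin g /\ forall c, c \in children x g -> c \in D /\ index g D < index c D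
    else g \in F.
Proof.
elim: D => [_ _|g D IH /= /andP[gD uD] /andP[gP dD]]; first by exists (fun=> None).
have [dec decP] := IH uD dD.
pose o := if g \in F then None else [pick x | (x \notin g) && all (mem D) (children x g)].
exists (fun k => if k == g then o else dec k) => k.
rewrite inE; have [->{k} _|kg /= kD] := eqVneq k g.
  rewrite /o; case: ifP gP => [//|_ /= /existsP ex]; case: pickP => [x /andP[xg al]|no].
    split=> // c cc; have cD : c \in D := allP al _ cc.
    by rewrite inE cD orbT; case: (eqVneq g c) => // e; move: gD; rewrite e cD.
  by have [x] := ex; rewrite no.
have := decP k kD; case: (dec k) => // x [xk cP]; split=> // c cc.
have [cD ind] := cP c cc; rewrite inE cD orbT; split=> //.
by case: eqVneq => // e; move: gD; rewrite e cD.
Qed.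

Lemma deriv_filter F D Q : uniq D ->
  (forall g, g \in Q -> g \in D -> (g \in F) \/ exists2 x, x \notin g &
     forall c, c \in children x g -> [/\ c \in Q, c \in D & index g D < index c D]) ->
  deriv F [seq g : {set T} <- D | g \in Q].
Proof.
elim: D => [//|k D IH /= /andP[kD uD] H].
have dD : deriv F [seq g <- D | g \in Q].
  apply: IH => // g gQ gD; have kg : k != g by apply: contraNneq kD => ->.
  have gD' : g \in k :: D by rewrite inE gD orbT.
  case: (H g gQ gD') => [|[x xg cP]]; [by left|right; exists x => // c cc].
  have [cQ cD] := cP c cc; rewrite (negPf kg).
  case: eqVneq => [//|kc]; rewrite ltnS => ind; split=> //.
  by move: cD; rewrite inE eq_sym (negPf kc).
case: ifP => //= kQ; rewrite dD andbT.
case: (H k kQ (mem_head _ _)) => [->//|[x xk cP]]; apply/orP; right.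
apply/existsP; exists x; rewrite xk; apply/allP => c cc.
have [cQ cD] := cP c cc; rewrite eqxx /= mem_filter cQ.
by case: eqVneq => // kc _; move: cD; rewrite inE eq_sym (negPf kc).
Qed.

(** Each step takes one face off the stack, and the faces that it pushes are exactly
    those seen for the first time; all faces seen are in [D], so [size D] steps are
    enough. *)
Lemma follow F D (dec : {set T} -> option T) U B : uniq D ->
  (forall g, g \in D -> if dec g is Some x then
      x \notin g /\ forall c, c \in children x g -> c \in D /\ index g D < index c D
    else g \in F) ->
  forall N st, inv U B st -> {subset seen st <= D} -> {subset lvs st <= F} ->
  (forall g, g \in seen st -> g \notin stk st ->
     if dec g is Some x then all (mem (seen st)) (children x g) else g \in lvs st) ->
  size D + size (stk st) <= N + size (seen st) ->
  exists r, [/\ r \in runs N st, {subset seen r <= D}, {subset lvs r <= F} &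
    forall g, g \in seen r ->
     if dec g is Some x then all (mem (seen r)) (children x g) else g \in lvs r].
Proof.
move=> uD decP; elim=> [|N IH] st i sD lF cl le.
  have e : stk st = [::].
    have le2 : size (seen st) <= size D := uniq_leq_size (inv_uniq i) sD.
    have : size (stk st) <= 0 by move: le le2; clia.
    by case: (stk st).
  exists st; split=> //; first by rewrite runs_done // inE.
  by move=> g gs; apply: cl => //; rewrite e.
case e: (stk st) => [|h s].
  exists st; split=> //; first by rewrite runs_done // inE.
  by move=> g gs; apply: cl => //; rewrite e.
have hS : h \in seen st by apply: (inv_sub i); rewrite e mem_head.
have hD := sD _ hS; have := decP h hD.
case dh: (dec h) => [x|].
  case=> xh cP.
  have [||||r [rr ? ? ?]] := IH (expand st x) (inv_expand e xh i).
  - rewrite /expand e /= => g; rewrite mem_cat => /orP[|/sD//].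
    by rewrite mem_filter => /andP[_ /cP[]].
  - by rewrite /expand e.
  - rewrite /expand e /= => g.
    set c := [seq g <- _ | _].
    have chS : all (mem (c ++ seen st)) (children x h).
      apply/allP => k kc; rewrite /= mem_cat mem_filter kc andbT; exact: orNb.
    rewrite !mem_cat negb_or => /orP[->//|gS] /andP[gc gs].
    have [->|gh] := eqVneq g h; first by rewrite dh.
    have := cl g gS; rewrite e inE (negPf gh) (negPf gs) => /(_ isT).
    by case: (dec g) => // y; apply: sub_all => k /= kS; rewrite mem_cat kS orbT.
  - by move: le; rewrite /expand e /= !size_cat; clia.
  by exists r; split=> //; apply/(mem_runsS N e); right; exists x.
move=> hF.
have [||||r [rr ? ? ?]] := IH (leaf st) (inv_leaf i).
- by rewrite /leaf e.
- by rewrite /leaf e /= => g; rewrite inE => /orP[/eqP ->|/lF].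
- rewrite /leaf e /= => g gS gs; have [->|gh] := eqVneq g h; first by rewrite dh mem_head.
  have := cl g gS; rewrite e inE (negPf gh) (negPf gs) => /(_ isT).
  by case: (dec g) => // gl; rewrite inE gl orbT.
- by move: le; rewrite /leaf e /=; clia.
by exists r; split=> //; apply/(mem_runsS N e); left.
Qed.

(** The part of the derivation that the exploration visits is itself a derivation,
    hence a run that sees few faces comes with a short derivation. *)
Lemma explore F D U B N : deriv F D -> uniq D -> uniq B -> all (is_face d) B ->
  all (fun g : {set T} => g \subset U) B -> {subset B <= D} -> size D <= N ->
  exists r, [/\ r \in runs N (start B U), {subset lvs r <= F},
    all (spanned d (lvs r)) (seen r) &
    exists D', [/\ deriv F D', {subset B <= D'} & size D' <= size (seen r)]].
Proof.
move=> dD uD uB fB BU BD leN.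
have [dec decP] := deriv_decision uD dD.
have i0 := inv_start uB fB BU.
have [||||r [rr sD lF cl]] := follow uD decP (N := N) i0; rewrite //=.
- by move=> g ->.
- by rewrite leq_add2r.
have [i _] := inv_runs rr i0.
exists r; split=> //.
  apply/allP => g; have [k] := ubnP (size D - index g D).
  elim: k g => [//|k IH] g lek gS.
  have := cl g gS; have := decP g (sD _ gS); case: (dec g) => [x [xg cP] al|_]; last first.
    exact: spanned_mem.
  apply: (spanned_step xg); first exact: (eqP (allP (inv_face i) _ gS)).
  apply/allP => c cc; have cS := allP al _ cc; apply: IH => //.
  have [cD ind] := cP c cc; have ic : index c D < size D by rewrite index_mem.
  by apply: leq_trans (ltn_sub2l (ltn_trans ind ic) ind) _; rewrite -ltnS.
exists [seq g : {set T} <- D | g \in seen r]; split.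
- apply: deriv_filter => // g gS gD; have := cl g gS; have := decP g gD.
  case: (dec g) => [x [xg cP] al|gF _]; last by left.
  right; exists x => // c cc; have [cD ind] := cP c cc; split=> //; exact: (allP al).
- by move=> g gB; rewrite mem_filter BD // (inv_base i).
- apply: uniq_leq_size; first by rewrite filter_uniq.
  by move=> g; rewrite mem_filter => /andP[].
Qed.

End Runs.

(** * Clean runs *)

Section Clean.
Variables (T : finType) (d : nat).
Hypothesis d2 : 2 <= d.
Implicit Types (f g h U : {set T}) (x y u v w : T) (B D Q : seq {set T}).
Implicit Types (F : {set {set T}}).
Implicit Types (st r : state T).

Lemma runs_mono N st r : r \in runs N st ->
  [/\ old st <= old r, {subset lvs st <= lvs r} & {subset seen st <= seen r}].
Proof.
elim/runs_ind: r / => [{}N {}st e|{}N {}st r h s e _ [o l n]|{}N {}st r h s x e xh _ [o l n]].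
- by split.
- move: o l n; rewrite /leaf e /= => o l n; split=> // g gl; apply: l.
  by rewrite inE gl orbT.
- move: o l n; rewrite /expand e /= => o l n; split=> //.
    by apply: leq_trans o; apply: leq_addr.
  by move=> g gs; apply: n; rewrite mem_cat gs orbT.
Qed.

(** A face that has left the stack is never treated again. *)
Lemma runs_frozen N st r g : r \in runs N st -> uniq (stk st) -> {subset stk st <= seen st} ->
  g \in seen st -> g \notin stk st ->
  (g \in lvs r -> g \in lvs st) /\ (forall y, (y, g) \in nws r -> (y, g) \in nws st).
Proof.
move=> rr; elim/runs_ind: r / rr => [{}N {}st e|{}N {}st r h s e _ IH|{}N {}st r h s x e xh _ IH] us ss gs gk.
- by [].
- move: us ss gk; rewrite e /= inE negb_or => /andP[hs us] ss /andP[gh gn].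
  move: IH; rewrite /leaf e /= => /(_ us); case=> //.
    by move=> z zs; apply: ss; rewrite inE zs orbT.
  by move=> l n; split=> // /l; rewrite inE (negPf gh).
- move: us ss gk; rewrite e /= inE negb_or => /andP[hs us] ss /andP[gh gn].
  move: IH; rewrite /expand e /=; set c := [seq g <- _ | _].
  have subs : {subset s <= seen st} by move=> z zs; apply: ss; rewrite inE zs orbT.
  case.
  + rewrite cat_uniq us filter_uniq ?uniq_children // andbT /=.
    by apply/hasPn => z /subs zs; rewrite /= mem_filter zs.
  + by move=> z; rewrite !mem_cat => /orP[->//|/subs ->]; rewrite orbT.
  + by rewrite mem_cat gs orbT.
  + by rewrite mem_cat mem_filter gs /=.
  + move=> l n; split=> // y /n; case: ifP => // xU.
    by rewrite inE xpair_eqE (negPf gh) andbF.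
Qed.

Lemma fresh_children U B st x h s : inv d U B st -> x \notin usd st ->
  stk st = h :: s -> [seq g : {set T} <- children x h | g \notin seen st] = children x h.
Proof.
move=> i xU e; apply/all_filterP/allP => g /mem_children[v vh ->].
apply: contra xU => /(allP (inv_used i))/subsetP; apply; exact: setU11.
Qed.

(** In a clean run each expansion is by a vertex not met before, so that all the
    faces that it creates are pushed. *)
Lemma clean_ind U B (P : nat -> state T -> state T -> Prop) :
  (forall N st, inv d U B st -> stk st = [::] -> P N st st) ->
  (forall N st r h s, inv d U B st -> stk st = h :: s -> r \in runs N (leaf st) ->
     P N (leaf st) r -> P N.+1 st r) ->
  (forall N st r h s x, inv d U B st -> stk st = h :: s -> x \notin h -> x \notin usd st ->
     expand st x = State (children x h ++ s) (children x h ++ seen st) (lvs st)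
       ((x, h) :: nws st) (x |: usd st) (old st) ->
     r \in runs N (expand st x) ->
     P N (expand st x) r -> P N.+1 st r) ->
  forall N st r, inv d U B st -> r \in runs N st -> old r = 0 -> P N st r.
Proof.
move=> P0 Pl Pe N st r i rr; elim/runs_ind: r / rr i =>
  [{}N {}st e|{}N {}st r h s e rr IH|{}N {}st r h s x e xh rr IH] i o.
- exact: P0.
- by apply: (Pl _ _ _ _ _ i e) => //; apply: IH => //; exact: inv_leaf.
- have [ole _ _] := runs_mono rr.
  have xU : x \notin usd st.
    move: ole; rewrite o leqn0 /expand e /= addn_eq0 => /andP[_].
    by case: (x \in usd st).
  apply: (Pe N st r h s x i e xh xU _ rr); last by apply: IH => //; exact: inv_expand e xh i.
  by rewrite /expand e (fresh_children i xU e) (negPf xU) addn0.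
Qed.

Lemma clean_deriv U B F N st r : inv d U B st -> r \in runs N st -> old r = 0 ->
  {subset lvs r <= F} ->
  exists D, [/\ deriv F D, {subset stk st <= D} & size D <= size (stk st) + d.+1 * N].
Proof.
move=> i rr o; move: i rr o; move: N st r; apply: clean_ind.
- by move=> N st i e _; exists [::]; rewrite e.
- move=> N st r h s i e rr IH lF; have [D [dD sD cD]] := IH lF.
  have hF : h \in F.
    by have [_ ls _] := runs_mono rr; apply: lF; apply: ls; rewrite /leaf e mem_head.
  exists (h :: D); split=> /=; first by rewrite hF.
    move=> z; rewrite e !inE => /orP[->//|zs]; rewrite sD ?orbT // /leaf e //.
  by move: cD; rewrite /leaf e /= mulnS; clia.
- move=> N st r h s x i e xh xU eE rr IH lF; have [D [dD sD cD]] := IH lF.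
  exists (h :: D); split=> /=.
  + rewrite dD andbT; apply/orP; right; apply/existsP; exists x; rewrite xh.
    by apply/allP => c cc; apply: sD; rewrite eE mem_cat cc.
  + by move=> z; rewrite e !inE => /orP[->//|zs]; rewrite sD ?orbT // eE mem_cat zs orbT.
  + have hf : is_face d h by apply: (allP (inv_face i)); apply: (inv_sub i); rewrite e mem_head.
    move: cD; rewrite eE e /= size_cat size_children (eqP hf) mulnS; clia.
Qed.

(** An expansion replaces the boundary of a face by the sum of those of the new
    faces; in the end the boundaries of the leaves sum up to that of the target. *)
Lemma clean_run U B N st r : inv d U B st -> r \in runs N st -> old r = 0 ->
  [/\ size (seen r) + d.+1 * size (nws st) = size (seen st) + d.+1 * size (nws r),
    all (spanned d (lvs r)) (stk st),
    forall g, g \in seen r -> g \in seen st \/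
      spanned d (lvs r) g /\ exists2 p, p \in nws r & p.1 \notin usd st /\ g \in children p.1 p.2,
    (\sum_(g <- stk st ++ lvs st) bd d g = \sum_(g <- lvs r) bd d g)%R
    & usd st \subset usd r /\ {subset nws st <= nws r}].
Proof.
move: N st r; apply: clean_ind.
- by move=> N st i e; rewrite e; split=> // [g gs|]; [left|split].
- move=> N st r h s i e rr [c s' t b [u n]]; move: c s' t b u n; rewrite /leaf e /= => c s' t b u n.
  split=> //.
  + rewrite s' andbT; apply: spanned_mem.
    by have [_ ls _] := runs_mono rr; apply: ls; rewrite /leaf e mem_head.
  + by rewrite -b !big_cons !big_cat /= big_cons addrCA.
- move=> N st r h s x i e xh xU eE rr; rewrite eE /= => -[c s' t b [u n]].
  have hf : is_face d h by apply: (allP (inv_face i)); apply: (inv_sub i); rewrite e mem_head.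
  rewrite all_cat in s'; have /andP[sc ss] := s'.
  have hn : (x, h) \in nws r by apply: n; rewrite mem_head.
  split.
  + by move: c; rewrite size_cat size_children (eqP hf) mulnS; clia.
  + by rewrite e /= ss andbT; apply: (spanned_step xh (eqP hf)).
  + move=> g /t [|[sp [p pn [pu gp]]]].
      rewrite mem_cat => /orP[gc|]; last by left.
      right; split; first exact: (allP sc).
      by exists (x, h).
    right; split=> //; exists p => //; split=> //.
    by apply: contra pu => pu; rewrite inE pu orbT.
  + by rewrite -b e /= big_cons -catA [RHS]big_cat /= -(bd_children xh (eqP hf)).
  + split; first by apply: subset_trans u; exact: subsetUr.
    by move=> p pn; apply: n; rewrite inE pn orbT.
Qed.

Lemma card_used U nw Q : chain d U nw Q -> #|used U nw| = #|U| + size nw.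
Proof.
elim: nw => [_|p nw IH /=]; first by rewrite /used set_nil setU0 addn0.
by case/and5P => pU _ _ _ /IH e; rewrite used_cons cardsU1 pU e; clia.
Qed.

Lemma chain_uniq U nw Q y k k' : chain d U nw Q -> (y, k) \in nw -> (y, k') \in nw -> k = k'.
Proof.
elim: nw => [//|p nw IH /=]; case/and5P => pU _ _ _ /IH{}IH; rewrite !inE.
have no z : (p.1, z) \notin nw.
  apply: contra pU => pn; rewrite /used inE; apply/orP; right.
  by rewrite inE; apply/mapP; exists (p.1, z).
case/orP => [/eqP e1|yk] /orP[/eqP e2|yk'].
- by move: e1; rewrite -e2 => -[].
- by move: (no k'); rewrite -e1 yk'.
- by move: (no k); rewrite -e2 yk.
- exact: IH.
Qed.

(** A vertex of both chains keeps its place in the first one. *)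
Lemma chain_merge U n1 n2 Q : chain d U n1 Q -> chain d U n2 Q ->
  let n := [seq p : T * {set T} <- n2 | p.1 \notin used U n1] ++ n1 in
  chain d U n Q /\ used U n = used U n1 :|: used U n2.
Proof.
move=> c1; elim: n2 => [_|p n2 IH /=].
  by split=> //=; apply/esym/setUidPl; rewrite /used set_nil setU0 subsetUl.
case/and5P => pU hU ff ch /IH [c u]; rewrite used_cons; case: ifP => [pn|/negbFE pn] /=; split=> //.
- by rewrite ff ch c u inE negb_or pn pU /= andbT; apply: subset_trans hU _; exact: subsetUr.
- by rewrite used_cons u setUCA.
- by rewrite u [RHS]setUCA; apply/esym/setUidPr; rewrite sub1set in_setU pn.
Qed.

Lemma clean_start f N r : is_face d f -> r \in runs N (start [:: f] f) -> old r = 0 ->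
  [/\ inv d f [:: f] r, size (lvs r) = 1 + d * size (nws r),
    all (spanned d (lvs r)) (seen r) & (\sum_(g <- lvs r) bd d g = bd d f)%R].
Proof.
move=> ff rr o.
have i0 : inv d f [:: f] (start [:: f] f) by apply: inv_start; rewrite //= ?ff ?subxx.
have [i e] := inv_runs rr i0.
have [c s t b _] := clean_run i0 rr o.
split=> //.
- by move: c; rewrite (inv_size i) e o /= mulSn; clia.
- by apply/allP => g /t[/(allP s)//|[]].
- by rewrite -b /= big_seq1.
Qed.

(** The leaves determine a clean run.  Two runs with the same leaves that treat the
    top face [h] differently must expand it by distinct vertices [x] and [x'],
    because [h] is never treated again and so cannot be a leaf of just one of them.
    The swaps of [h] with [x'] are spanned by the common leaves.  If [r] never meets
    [x'], then adding [x'] to the chain of [r] produces more independent faces than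
    leaves.  Otherwise the count is tight and [r] has seen all the swaps of [h] with
    [x'].  These can only have appeared when [r] introduced [x'], over a face that
    must then be [h] itself; but [r] expands [h] by [x]. *)
Lemma clean_eq f N M st r r' : is_face d f -> inv d f [:: f] st ->
  r \in runs M (start [:: f] f) -> r' \in runs M (start [:: f] f) ->
  r \in runs N st -> r' \in runs N st -> old r = 0 -> old r' = 0 -> lvs r =i lvs r' -> r = r'.
Proof.
move=> ff i0 rM rM' + + o o' ll.
have [ir cr sr _] := clean_start ff rM o; have [ir' cr' sr' _] := clean_start ff rM' o'.
have U1 : all (fun g : {set T} => g \subset f) [:: f] by rewrite /= subxx.
have bok := base_ok_single 0 ff.
have frozen n s0 q k s : inv d f [:: f] s0 -> stk s0 = k :: s -> forall x, x \notin k ->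
    q \in runs n (expand s0 x) -> (k \in lvs q -> k \in lvs s0) /\
    forall y, (y, k) \in nws q -> (y, k) \in nws (expand s0 x).
  move=> i e x xk qr; have i' := inv_expand e xk i.
  have uk : uniq (stk s0) by have := inv_open i; rewrite cat_uniq => /andP[].
  have kS : k \in seen s0 by apply: (inv_sub i); rewrite e mem_head.
  have [||||l nn] := runs_frozen (g := k) qr.
  - by have := inv_open i'; rewrite cat_uniq => /andP[].
  - by move=> z zs; apply: (inv_sub i'); rewrite mem_cat zs.
  - by rewrite /expand e /= mem_cat kS orbT.
  - rewrite /expand e /= mem_cat mem_filter kS /=.
    by move: uk; rewrite e /= => /andP[].
  - by split=> // kl; have := l kl; rewrite /expand e.
elim: N st i0 => [|N IH] st i; first by rewrite /=; case: (stk st); rewrite ?inE // => /eqP -> /eqP ->.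
case e: (stk st) => [|h s]; first by rewrite !(runs_done _ e) !inE => /eqP -> /eqP ->.
have hl : h \notin lvs st.
  by have := inv_open i; rewrite e /= mem_cat negb_or => /andP[/andP[]].
have hS : h \in seen st by apply: (inv_sub i); rewrite e mem_head.
have hf := allP (inv_face i) _ hS.
have leafh q : q \in runs N (leaf st) -> h \in lvs q.
  by case/runs_mono => _ ls _; apply: ls; rewrite /leaf e mem_head.
have noleaf q x : x \notin h -> q \in runs N (expand st x) -> h \notin lvs q.
  move=> xh qr; have [l _] := frozen _ _ _ _ _ i e x xh qr; exact: contra l hl.
have newx q x : old q = 0 -> q \in runs N (expand st x) -> x \notin usd st.
  by move=> oq /runs_mono[]; rewrite oq leqn0 /expand e /= addn_eq0; case: (x \in _) => // /andP[].
case/(mem_runsS _ e) => [rl|[x xh rx]] /(mem_runsS _ e) [rl'|[x' xh' rx']].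
- by apply: (IH (leaf st)) => //; exact: inv_leaf.
- by move: (noleaf _ _ xh' rx'); rewrite -ll leafh.
- by move: (noleaf _ _ xh rx); rewrite ll leafh.
have [exx|nxx] := eqVneq x x'.
  by rewrite -exx in rx'; apply: IH rx rx'; exact: inv_expand e xh i.
exfalso.
have xU := newx _ _ o rx; have xU' := newx _ _ o' rx'.
have ix := inv_expand e xh i.
have spr g : spanned d (lvs r') g -> spanned d (lvs r) g by apply: spanned_sub => z; rewrite ll.
have chS : all (spanned d (lvs r)) (children x' h).
  apply/allP => g gc; apply: spr; apply: (allP sr').
  have [_ _ sub] := runs_mono rx'; apply: sub.
  by rewrite /expand e (fresh_children i xU' e) mem_cat gc.
pose Q := undup (seen r ++ children x' h).
have hUr : h \subset usd r.
  by apply: (allP (inv_used ir)); have [_ _ sub] := runs_mono rx; apply: sub; rewrite /expand e /= mem_cat hS orbT.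
have sQ : all (spanned d (lvs r)) Q.
  by apply/allP => g; rewrite mem_undup mem_cat => /orP[/(allP sr)|/(allP chS)].
have fQ : all (is_face d) Q.
  apply/allP => g; rewrite mem_undup mem_cat => /orP[/(allP (inv_face ir))//|/mem_children[v vh ->]].
  by rewrite /is_face card_swap.
have Qr : {subset seen r <= Q} by move=> g gs; rewrite mem_undup mem_cat gs.
have Qc : {subset children x' h <= Q} by move=> g gs; rewrite mem_undup mem_cat gs orbT.
have QU' : all (fun g : {set T} => g \subset x' |: usd r) Q.
  apply/allP => g; rewrite mem_undup mem_cat => /orP[/(allP (inv_used ir)) gU|/mem_children[v vh ->]].
    by apply: subset_trans gU _; exact: subsetUr.
  by rewrite setUS //; apply: subset_trans hUr; exact: subD1set.
have bQ : {subset [:: f] <= Q} by move=> g /(inv_base ir) /Qr.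
have cQ := chain_sub Qr (inv_chain ir).
(* A vertex [x'] that [r] does not meet would add [d] independent faces to the count. *)
have [xr|xr] := boolP (x' \in usd r); last first.
  have [||G [E [tG sG cG _]]] := chain_rank d2 bok (nw := (x', h) :: nws r) (undup_uniq _) fQ _ bQ U1.
  - by rewrite used_cons -(inv_usd ir).
  - rewrite /= -(inv_usd ir) xr hUr hf cQ andbT /=; apply/allP => g; exact: Qc.
  have := size_triangular tG (A := lvs r) _; rewrite cG cr => /(_ _)/wrap[|].
    by apply/allP => g /sG; exact: (allP sQ).
  by move: d2; rewrite /= mulnS; clia.
have QU : all (fun g : {set T} => g \subset used f (nws r)) Q.
  by move: QU'; rewrite (setUidPr _) ?sub1set // (inv_usd ir).
have [G [E [tG sG cG leQ]]] := chain_rank d2 bok (undup_uniq _) fQ QU bQ U1 cQ.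
have := size_triangular tG (A := lvs r) _; rewrite cG cr => /(_ _)/wrap[|leE].
  by apply/allP => g /sG; exact: (allP sQ).
have E0 : E = 0 by move: leE; rewrite /=; clia.
have cS : size (seen r) = 1 + d.+1 * size (nws r).
  by have := inv_size ir; rewrite o (proj2 (inv_runs rx ix)) cr /= mulSn; clia.
have seenQ : {subset children x' h <= seen r}.
  have le : size Q <= size (seen r).
    by apply: leq_trans leQ _; rewrite E0 cS /excess_bound mul0n addn0.
  have [_ eq] := uniq_min_size (inv_uniq ir) Qr le.
  by move=> g /Qc; rewrite eq.
have [_ _ tr _ _] := clean_run ix rx o.
have xx : x' \notin usd (expand st x).
  by rewrite /expand e /= in_setU1 negb_or eq_sym nxx xU'.
have key u : u \in h -> exists2 k, (x', k) \in nws r & h :\ u \subset k.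
  move=> uh; have gc : swap x' h u \in children x' h by apply: map_f; rewrite mem_enum.
  case: (tr _ (seenQ _ gc)) => [|[_ [[y k] pn [pu /mem_children[v vk E']]]]].
    by move/(allP (inv_used ix))/subsetP/(_ x' (setU11 _ _)) => xx2; move: xx; rewrite xx2.
  have yx : y = x'.
    have : y \in swap x' h u by rewrite E' setU11.
    rewrite in_setU1 => /orP[/eqP//|]; rewrite in_setD1 => /andP[_ yh].
    case/negP: pu; rewrite /expand e /= in_setU1; apply/orP; right.
    exact: (subsetP (allP (inv_used i) _ hS)).
  exists k; first by rewrite -yx.
  apply/subsetP => z zh; have : z \in swap x' h u by rewrite in_setU1 zh orbT.
  rewrite E' /= yx in_setU1 in_setD1 => /orP[/eqP zx|/andP[]//].
  by move: zh; rewrite zx in_setD1 (negPf xh') andbF.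
have [u uh] : exists u, u \in h by apply/set0Pn; rewrite -card_gt0 (eqP hf).
have [v] : exists v, v \in h :\ u.
  by apply/set0Pn; rewrite -card_gt0; have := eqP hf; rewrite (cardsD1 u) uh; move: d2; clia.
rewrite in_setD1 => /andP[vu vh].
have [k kn hk] := key u uh; have [k2 kn2 hk2] := key v vh.
have k22 := chain_uniq (inv_chain ir) kn2 kn; rewrite {}k22 in hk2.
(* [k] contains [h] without [u] and [h] without [v], hence [h]. *)
have hk3 : h = k.
  have kf : is_face d k.
    have := inv_chain ir; elim: (nws r) kn => [//|p n IHn] /=; rewrite inE => /orP[/eqP<-|kn] /and5P[] //.
    by move=> *; exact: IHn.
  apply/eqP; rewrite eqEcard (eqP hf) (eqP kf) leqnn andbT; apply/subsetP => z zh.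
  have [->|zu] := eqVneq z u; first by apply: (subsetP hk2); rewrite in_setD1 eq_sym vu uh.
  by apply: (subsetP hk); rewrite in_setD1 zu zh.
have [_ fr] := frozen _ _ _ _ _ i e x xh rx.
have := fr x'; rewrite {1}hk3 kn => /(_ isT); rewrite /expand e /= (negPf xU) inE xpair_eqE eq_sym (negPf nxx) /=.
move=> xn; move/negP: xU'; apply; rewrite (inv_usd i) /used in_setU; apply/orP; right.
by rewrite inE; apply/mapP; exists (x', h).
Qed.

(** The boundary of [f] is the sum of the boundaries of the leaves of either run.
    Therefore a leaf [a] of only one of them is spanned by the other leaves of both,
    and the rank bound for the merged chain applies to the leaves without [a]. *)
Lemma clean_pair f N r r' : is_face d f ->
  r \in runs N (start [:: f] f) -> r' \in runs N (start [:: f] f) ->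
  old r = 0 -> old r' = 0 -> r != r' ->
  d * (#|usd r :|: usd r'| - d.+1) + 2 <= size (undup (lvs r ++ lvs r')).
Proof.
move=> ff; wlog [a al al'] : r r' / exists2 a, a \in lvs r & a \notin lvs r'.
  move=> W rr rr' o o' ne.
  have [/allP s1|/allPn[a]] := boolP (all (mem (lvs r')) (lvs r)); last by move=> *; apply: W => //; exists a.
  have [/allP s2|/allPn[a]] := boolP (all (mem (lvs r)) (lvs r')); last first.
    move=> a1 a2; rewrite setUC; apply: leq_trans (W r' r _ _ _ _ _ _) _ => //; [by exists a|by rewrite eq_sym|].
    by apply: uniq_leq_size; rewrite ?undup_uniq // => z; rewrite !mem_undup !mem_cat orbC.
  case/eqP: ne; apply: (@clean_eq f N N (start [:: f] f)) => //.
    by apply: inv_start; rewrite //= ?ff ?subxx.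
  by move=> z; apply/idP/idP => [/s1|/s2].
move=> rr rr' o o' ne.
have [ir cr sr br] := clean_start ff rr o; have [ir' cr' sr' br'] := clean_start ff rr' o'.
have U1 : all (fun g : {set T} => g \subset f) [:: f] by rewrite /= subxx.
pose M := undup (lvs r ++ lvs r'); pose M' := rem a M.
have aM : a \in M by rewrite mem_undup mem_cat al.
have ulr : uniq (lvs r) by have := inv_open ir; rewrite cat_uniq => /and3P[].
have memM' z : z \in M -> z != a -> z \in M' by move=> zM za; rewrite mem_rem_uniq ?undup_uniq // inE za.
have spa : spanned d M' a.
  rewrite /spanned; have := br; rewrite (big_rem a) //= => /eqP; rewrite eq_sym -subr_eq => /eqP <-.
  rewrite -br'; apply: rpredB; rewrite big_seq; apply: rpred_sum => z zl.
    apply: memv_span; apply: map_f; apply: memM'; first by rewrite mem_undup mem_cat zl orbT.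
    by apply: contraNneq al' => <-.
  move: zl; rewrite mem_rem_uniq // inE => /andP[za zl].
  by apply: memv_span; apply: map_f; apply: memM' => //; rewrite mem_undup mem_cat zl.
have spM l g : {subset l <= M} -> spanned d l g -> spanned d M' g.
  move=> lM; apply/subvP; apply/span_subvP => b /mapP[z /lM zM ->].
  have [->|za] := eqVneq z a; first exact: spa.
  by apply: spanned_mem; exact: memM'.
pose Q := undup (seen r ++ seen r').
have Q1 : {subset seen r <= Q} by move=> g gs; rewrite mem_undup mem_cat gs.
have Q2 : {subset seen r' <= Q} by move=> g gs; rewrite mem_undup mem_cat gs orbT.
have [cn un] := chain_merge (chain_sub Q1 (inv_chain ir)) (chain_sub Q2 (inv_chain ir')).
set nn := (_ ++ _) in cn un.
have [|||G [E [tG sG cG _]]] := chain_rank d2 (base_ok_single 0 ff) (undup_uniq (seen r ++ seen r')) _ _ _ U1 cn.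
- by apply/allP => g; rewrite mem_undup mem_cat => /orP[/(allP (inv_face ir))|/(allP (inv_face ir'))].
- apply/allP => g; rewrite un -(inv_usd ir) -(inv_usd ir') mem_undup mem_cat.
  case/orP => [/(allP (inv_used ir))|/(allP (inv_used ir'))] gU; apply: subset_trans gU _;
    [exact: subsetUl|exact: subsetUr].
- by move=> g /(inv_base ir) /Q1.
have := size_triangular tG (A := M') _ => /(_ _)/wrap[|].
  apply/allP => g /sG; rewrite mem_undup mem_cat => /orP[/(allP sr)|/(allP sr')]; apply: spM => z zl;
    by rewrite mem_undup mem_cat zl ?orbT.
have M0 : 0 < size M by rewrite lt0n size_eq0; apply: contraTneq aM => ->.
rewrite cG size_rem // (inv_usd ir) (inv_usd ir') -un (card_used cn) (eqP ff) -/M addKn.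
case: (size M) M0 => [//|k] _ /= le; rewrite addn2 ltnS; apply: leq_trans le.
by rewrite -addnA add1n ltnS leq_addr.
Qed.

Lemma card_usd_runs N st r : r \in runs N st -> (#|usd r| <= #|usd st| + N)%N.
Proof.
elim/runs_ind: r / => [{}N {}st e|{}N {}st r h s e _ le|{}N {}st r h s x e xh _ le].
- exact: leq_addr.
- by move: le; rewrite /leaf e /=; clia.
- apply: leq_trans le _; rewrite /expand e /= cardsU1.
  by case: (x \in usd st) => /=; clia.
Qed.

End Clean.

(** * Stacked contractions and derivations *)

Section Stacked.
Variables (n d : nat).
Hypothesis d2 : 2 <= d.
Implicit Types (F : {set {set 'I_n}}) (f g : {set 'I_n}) (D : seq {set 'I_n}).

Lemma dfaces_lm_complex F : F \subset simplices n d -> dfaces d (lm_complex d F) = F.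
Proof.
move=> Fs; apply/setP => s; rewrite /dfaces /lm_complex !inE.
have [sF|sF] := boolP (s \in F).
  by have := subsetP Fs _ sF; rewrite inE orbT => ->.
by apply/negbTE/negP => /andP[+ /eqP cs]; rewrite cs ltnn.
Qed.

Definition derivable F f := exists2 D, deriv F D & f \in D.

Lemma derivable_step F f x : x \notin f -> (forall v, v \in f -> derivable F (swap x f v)) ->
  derivable F f.
Proof.
move=> xf H.
have [D dD cD] : exists2 D, deriv F D & {subset children x f <= D}.
  have : {subset children x f <= children x f} by [].
  elim: {1 3}(children x f) => [|c cs IH] sub; first by exists [::].
  have [D dD cD] : exists2 D, deriv F D & {subset cs <= D}.
    by apply: IH => z zc; apply: sub; rewrite inE zc orbT.
  have /mem_children[v vf cE] := sub _ (mem_head _ _); have [D' dD' fD'] := H v vf.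
  exists (D' ++ D); first exact: deriv_cat.
  by move=> z; rewrite inE mem_cat => /orP[/eqP ->|/cD ->]; rewrite ?orbT // cE fD'.
exists (f :: D); last exact: mem_head.
rewrite /= dD andbT; apply/orP; right; apply/existsP; exists x; rewrite xf.
by apply/allP => c /cD.
Qed.

(** Undoing the last 0-move is a derivation step with [x] the label of [u].  The labels
    are distinct on [s] because any two vertices of [s] lie in a common face around
    [u]; this uses [d2]. *)
Lemma stacked_triangulation_derivable (V : finType) (b : {set V}) (T : {set {set V}})
    (lab : V -> 'I_n) F :
  #|b| = d.+1 -> stacked_triangulation b T ->
  (forall s, s \in T -> #|s| = d.+1) /\
  ((forall s, s \in T -> {in s &, injective lab} /\ derivable F (lab @: s)) ->
    {in b &, injective lab} /\ derivable F (lab @: b)).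
Proof.
move=> cb; elim=> [|{}T s u _ [cT IH] sT uT].
  by split=> [s|H]; [rewrite inE => /eqP ->|apply: H; rewrite inE].
have us : u \notin s.
  by apply: contra uT => us; apply/bigcupP; exists s.
split=> [t|H].
  rewrite !inE => /orP[/andP[_ /cT//]|/imsetP[v vs ->]].
  by rewrite -(cT _ sT); apply: card_swap.
have pair a a' : a \in s -> a' \in s -> exists2 v, v \in s & (v != a) && (v != a').
  move=> as_ bs; have [r [cr rs ar br]] : exists r : {set V}, [/\ #|r| == d, r \subset s, a \in r & a' \in r].
    by apply: facet_through => //; rewrite /is_face (cT _ sT).
  have [v vs vr] : exists2 v, v \in s & v \notin r.
    by apply/subsetPn; apply/negP => /subset_leq_card; rewrite (cT _ sT) (eqP cr) ltnn.
  by exists v => //; apply/andP; split; apply: contraNneq vr => ->.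
have new v : v \in s -> {in u |: (s :\ v) &, injective lab} /\ derivable F (lab @: (u |: (s :\ v))).
  by move=> vs; apply: H; rewrite !inE; apply/orP; right; apply/imsetP; exists v.
have mem a v : a \in s -> v != a -> a \in u |: (s :\ v).
  by move=> as_ va; rewrite in_setU1 in_setD1 as_ (eq_sym a v) va orbT.
have inj : {in s &, injective lab}.
  move=> a a' as_ as' e; have [v vs /andP[va va']] := pair _ _ as_ as'.
  have [i _] := new v vs; by apply: i => //; apply: mem.
have xf : lab u \notin lab @: s.
  apply/imsetP => -[a as_ e]; have [v vs /andP[va _]] := pair _ _ as_ as_.
  have [i _] := new v vs; have : u = a by apply: i; [exact: setU11|exact: mem|].
  by move=> ua; move: us; rewrite ua as_.
apply: IH => t tT; have [->|ts] := eqVneq t s; last by apply: H; rewrite !inE ts tT.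
split=> //; apply: (derivable_step xf) => y /imsetP[v vs ->{y}].
have [_] := new v vs; congr derivable; rewrite /swap imsetU1; congr (_ |: _).
apply/setP => y; rewrite in_setD1; apply/imsetP/andP => [[a]|[yv /imsetP[a as_ e]]].
  rewrite in_setD1 => /andP[av as_] ->; split; last exact: imset_f.
  by apply: contra av => /eqP /inj ->.
by exists a => //; rewrite in_setD1 as_ andbT; apply: contraNneq yv => <-; rewrite e.
Qed.

Lemma stacked_contraction_derivable F f : F \subset simplices n d ->
  stacked_contraction d (lm_complex d F) f -> derivable F f.
Proof.
move=> Fs [V [b [T [lab [cb st <- H]]]]].
have [_ []//] := stacked_triangulation_derivable lab F cb st.
move=> s /H[i]; rewrite dfaces_lm_complex // => sF; split=> //.
by exists [:: lab @: s]; rewrite ?mem_head //= sF.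
Qed.

(** Used with [Some], to make room for one more vertex. *)
Lemma stacked_triangulation_imset (V W : finType) (phi : V -> W) (b : {set V}) T :
  injective phi -> stacked_triangulation b T ->
  stacked_triangulation (phi @: b) [set phi @: s | s : {set V} in T].
Proof.
move=> ip; elim=> [|{}T s u _ IH sT uT]; first by rewrite imset_set1; constructor.
have ii : injective (fun s : {set V} => phi @: s) by apply: imset_inj.
have -> : [set phi @: t | t : {set V} in bistellar0 T s u] =
    bistellar0 [set phi @: t | t : {set V} in T] (phi @: s) (phi u).
  rewrite /bistellar0 imsetU; congr (_ :|: _).
    apply/setP => y; rewrite in_setD1; apply/imsetP/andP => [[t]|[ys /imsetP[t tT e]]].
      rewrite in_setD1 => /andP[ts tT] ->; split; last exact: imset_f.
      by apply: contra ts => /eqP /ii ->.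
    by exists t => //; rewrite in_setD1 tT andbT; apply: contraNneq ys => <-; rewrite e.
  have sE v : phi @: (u |: (s :\ v)) = phi u |: (phi @: s :\ phi v).
    rewrite imsetU1; congr (_ |: _); apply/setP => y; rewrite in_setD1.
    apply/imsetP/andP => [[a]|[yv /imsetP[a as_ e]]].
      rewrite in_setD1 => /andP[av as_] ->; split; last exact: imset_f.
      by apply: contra av => /eqP /ip ->.
    by exists a => //; rewrite in_setD1 as_ andbT; apply: contraNneq yv => <-; rewrite e.
  apply/setP => y; apply/imsetP/imsetP => [[_ /imsetP[v vs ->] ->]|[_ /imsetP[v vs ->] ->]].
    by exists (phi v); [exact: imset_f|exact: sE].
  by exists (u |: (s :\ v)); [exact: imset_f|rewrite sE].
constructor=> //; first exact: imset_f.
apply: contra uT => /bigcupP[_ /imsetP[t tT ->] /imsetP[a at_ /ip ->]].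
by apply/bigcupP; exists t.
Qed.

(** The simplices labelled by the first face [g] of the derivation are subdivided one
    after the other, the new vertex having as label the vertex of the derivation
    step.  This creates no simplex labelled by [g], because [g] does not occur again
    in [D], so the subdivisions come to an end. *)
Lemma refine_triangulation F D : deriv F D ->
  forall (V : finType) (b : {set V}) (T : {set {set V}}) (lab : V -> 'I_n),
  stacked_triangulation b T ->
  (forall s, s \in T -> {in s &, injective lab} /\ (lab @: s \in F) || (lab @: s \in D)) ->
  exists (V' : finType) (b' : {set V'}) (T' : {set {set V'}}) (lab' : V' -> 'I_n),
    [/\ #|b'| = #|b|, stacked_triangulation b' T', lab' @: b' = lab @: b &
        forall s, s \in T' -> {in s &, injective lab'} /\ lab' @: s \in F].
Proof.
elim: D => [_|g D IH /= /andP[gP /IH{}IH]] V b T lab st H.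
  by exists V, b, T, lab; split=> // s /H[i]; rewrite orbF.
have easy (V0 : finType) (T0 : {set {set V0}}) (lab0 : V0 -> 'I_n) :
   (forall s, s \in T0 -> {in s &, injective lab0} /\ (lab0 @: s \in F) || (lab0 @: s \in g :: D)) ->
   (g \in F) || (g \in D) || (#|[set s in T0 | lab0 @: s == g]| == 0) ->
   (forall s, s \in T0 -> {in s &, injective lab0} /\ (lab0 @: s \in F) || (lab0 @: s \in D)).
  move=> H0 gE s sT; have [i b1] := H0 s sT; split=> //; move: b1.
  rewrite inE => /or3P[->//|/eqP e|->]; rewrite ?orbT // e.
  case/orP: gE => [->//|]; rewrite cards_eq0 => /eqP/setP/(_ s).
  by rewrite !inE sT e eqxx.
case/orP: gP => [gF|/existsP[x /andP[xg chD]]].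
  by apply: IH st _; apply: easy H _ => //; rewrite gF.
have [gD|gD] := boolP (g \in D); first by apply: IH st _; apply: easy H _ => //; rewrite gD orbT.
have [k] := ubnP #|[set s in T | lab @: s == g]|.
elim: k => [//|k IHk] in V b T lab st H *; rewrite ltnS => lek.
have [c0|] := posnP #|[set s in T | lab @: s == g]|.
  by apply: IH st _; apply: easy H _ => //; rewrite c0 eqxx orbT.
rewrite card_gt0 => /set0Pn[s]; rewrite inE => /andP[sT /eqP sg].
pose T1 := [set Some @: t | t : {set V} in T].
pose lab' (o : option V) := if o is Some v then lab v else x.
have iS : injective (fun t : {set V} => Some @: t) by apply: imset_inj => ? ? [].
have labS (t : {set V}) : lab' @: (Some @: t) = lab @: t by rewrite -imset_comp.
have [i _] := H s sT.
have st1 : stacked_triangulation (Some @: b) (bistellar0 T1 (Some @: s) None).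
  constructor; first by apply: stacked_triangulation_imset st => ? ? [].
    exact: imset_f.
  by apply/negP => /bigcupP[_ /imsetP[t _ ->] /imsetP[]].
have newlab v : v \in s -> lab' @: (None |: (Some @: s :\ Some v)) = swap x g (lab v).
  move=> vs; rewrite imsetU1 /swap; congr (_ |: _).
  apply/setP => y; rewrite in_setD1 -sg; apply/imsetP/andP => [[o]|[yv /imsetP[a as_ e]]].
    rewrite in_setD1 => /andP[ov /imsetP[a as_ oE]] ->; rewrite oE /=; split; last exact: imset_f.
    by apply: contra ov => /eqP /i e; rewrite oE e.
  exists (Some a) => //; rewrite in_setD1 imset_f // andbT.
  by apply: contraNneq yv => -[<-]; rewrite e.
have chg v : v \in s -> swap x g (lab v) \in D.
  by move=> vs; apply: (allP chD); apply: map_f; rewrite mem_enum -sg imset_f.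
have H1 t : t \in bistellar0 T1 (Some @: s) None ->
    {in t &, injective lab'} /\ (lab' @: t \in F) || (lab' @: t \in g :: D).
  rewrite in_setU => /orP[|/imsetP[_ /imsetP[v vs ->] ->]].
    rewrite in_setD1 => /andP[_ /imsetP[t0 t0T ->]]; have [i0] := H t0 t0T.
    rewrite labS; split=> // _ _ /imsetP[a a0 ->] /imsetP[a' a0' ->] /= e; congr Some; exact: i0.
  split; last by rewrite newlab // inE chg ?orbT.
  move=> o o'; rewrite !in_setU1 !in_setD1 => /orP[/eqP ->|/andP[_ /imsetP[a as_ ->]]];
    case/orP => [/eqP ->|/andP[_ /imsetP[a' as' ->]]] //= e.
  - by move: xg; rewrite e -sg imset_f.
  - by move: xg; rewrite -e -sg imset_f.
  - by congr Some; exact: i.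
have lek1 : #|[set t in bistellar0 T1 (Some @: s) None | lab' @: t == g]| < k.
  apply: leq_trans lek; rewrite (cardsD1 s) inE sT sg eqxx add1n ltnS.
  rewrite -(card_imset _ iS); apply: subset_leq_card; apply/subsetP => t.
  rewrite inE in_setU => /andP[/orP[tt|/imsetP[_ /imsetP[v vs ->] ->]] /eqP tg]; last first.
    by move: gD; rewrite -tg newlab // chg.
  move: tt; rewrite in_setD1 => /andP[ts /imsetP[t0 t0T tE]]; rewrite tE labS in tg; rewrite tE.
  apply/imsetP; exists t0 => //; rewrite in_setD1 inE t0T tg eqxx !andbT.
  by apply: contra ts => /eqP e0; rewrite tE e0.
have [V' [b' [T' [lab2 [cb' st' lb' H']]]]] := IHk _ _ _ _ st1 H1 lek1.
exists V', b', T', lab2; split=> //; last by rewrite lb' labS.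
by rewrite cb' card_imset // => ? ? [].
Qed.

Lemma derivable_stacked_contraction F f : F \subset simplices n d -> #|f| = d.+1 ->
  derivable F f -> stacked_contraction d (lm_complex d F) f.
Proof.
move=> Fs cf [D dD fD].
have [|V [b [T [lab [cb st lb H]]]]] := refine_triangulation dD (lab := id) (stacked_simplex f).
  by move=> s; rewrite inE => /eqP ->; split=> //; rewrite imset_id fD orbT.
exists V, b, T, lab; split=> //; [by rewrite cb cf|by rewrite lb imset_id|].
by move=> s /H[i sF]; rewrite dfaces_lm_complex.
Qed.

End Stacked.

(** * Polynomials in log log n against log n *)

Section PolyBound.
Implicit Types (f g : nat -> nat).

Definition poly_bounded f := exists C k, forall b, f b <= C * b.+1 ^ k.

Lemma poly_bounded_cst c : poly_bounded (fun=> c).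
Proof. by exists c, 0 => b; rewrite expn0 muln1. Qed.

Lemma poly_bounded_id : poly_bounded id.
Proof. by exists 1, 1 => b; rewrite mul1n expn1 leqnSn. Qed.

Lemma poly_bounded_add f g : poly_bounded f -> poly_bounded g ->
  poly_bounded (fun b => f b + g b).
Proof.
move=> [C [k fk]] [C' [k' gk]]; exists (C + C'), (k + k') => b; rewrite mulnDl.
by apply: leq_add; [apply: leq_trans (fk b) _|apply: leq_trans (gk b) _];
  rewrite leq_mul2l leq_pexp2l ?leq_addr ?leq_addl ?orbT.
Qed.

Lemma poly_bounded_mul f g : poly_bounded f -> poly_bounded g ->
  poly_bounded (fun b => f b * g b).
Proof.
move=> [C [k fk]] [C' [k' gk]]; exists (C * C'), (k + k') => b.
by rewrite expnD mulnACA leq_mul.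
Qed.

Lemma poly_bounded_exp f j : poly_bounded f -> poly_bounded (fun b => f b ^ j).
Proof.
move=> pf; elim: j => [|j IH]; first exact: poly_bounded_cst.
have [C [k H]] := poly_bounded_mul pf IH.
by exists C, k => b; rewrite expnS.
Qed.

Lemma poly_bounded_excess d c f : poly_bounded f -> poly_bounded (fun b => excess_bound d c (f b)).
Proof.
move=> pf; apply: poly_bounded_mul => //; apply: poly_bounded_add; first exact: poly_bounded_cst.
apply: poly_bounded_exp; apply: poly_bounded_add; first exact: poly_bounded_cst.
by apply: poly_bounded_mul => //; exact: poly_bounded_cst.
Qed.

(** With [q = b %/ k.+1] the right side is at least [(2 ^ q) ^ k.+1], hence at least
    [q ^ k.+1], where one factor [q] is left to absorb the constants. *)
Lemma poly_bounded_lt_exp2 f : poly_bounded f -> exists b0, forall b, b0 <= b -> f b <= 2 ^ b.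
Proof.
case=> C [k fk]; pose q0 := (C * (k.+1.*2) ^ k).+1.
exists (k.+1 * q0) => b leb; apply: leq_trans (fk b) _.
pose q := b %/ k.+1; have q0q : q0 <= q by rewrite leq_divRL // mulnC.
have qb : k.+1 * q <= b by rewrite mulnC leq_trunc_div.
have bq : b.+1 <= k.+1.*2 * q.
  have bl : b < k.+1 + k.+1 * q by rewrite -mulnS mulnC -ltn_divLR.
  have kl : k.+1 <= k.+1 * q by rewrite leq_pmulr // (leq_trans _ q0q).
  by apply: leq_trans bl _; rewrite -mul2n -mulnA mul2n -addnn leq_add2r.
apply: leq_trans (_ : C * (k.+1.*2 * q) ^ k <= _).
  by rewrite leq_mul2l; case: (posnP k) => [->|kp]; rewrite ?expn0 ?leqnn ?orbT // leq_exp2r // bq orbT.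
rewrite expnMn mulnA; apply: leq_trans (_ : q * q ^ k <= _).
  by rewrite leq_mul2r (leq_trans _ q0q) ?orbT // leqnSn.
rewrite -expnS; apply: leq_trans (_ : (2 ^ q) ^ k.+1 <= _).
  by rewrite leq_exp2r // ltnW // ltn_expl.
by rewrite -expnM mulnC leq_pexp2l.
Qed.

End PolyBound.

(** The choice of scales.  Here [lam] and [b] stand for the binary logarithms of [n]
    and of [lam], [L] for the length of short derivations, [M] for the number of
    vertices that they meet, and [d * s] for the number of faces that makes a set
    dense.  The logarithm [beta] of [M], and with it [s] and [Psi], are polynomial in
    [b], hence negligible before [lam].  The choice of [s] is dictated by the last
    inequality, which compares the number of ways to choose the faces of a dense set
    with their probability. *)
Lemma exponents d K c N : 2 <= d -> 0 < K ->
  exists b0, forall b lam, b0 <= b -> 2 ^ b <= lam -> lam < 2 ^ b.+1 ->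
  exists M s beta, let L := 2 * (d.+1 * (K * lam)) in
    let Psi := excess_bound d (2 ^ (d.+1 + d.+1)) (d * (d.+1 + d.+1) + d * s) in
    [/\ [/\ d.+1 + d.+1 + (L + L) <= M, d.+1 + (d.+1 * L).+1 <= M, M <= 2 ^ beta & 0 < s],
        1 + d.+1 * (K * lam) + (d * (d.+1 + d.+1) + d * s) + Psi <= L,
        1 + d.+1 * N <= L /\ d.+1 + N <= lam,
        d * ((beta + c) * Psi + b) <= lam /\
        lam.+1 * d.+1 + (beta + c) * Psi + b <= lam * (d + 3) &
        beta.+1 + beta * (d.+1 * (d * M + d * s)) + b <= lam * s.-1].
Proof.
move=> d2 K0.
pose C := d.+1 + d.+1 + 1 + d.+1 * (2 * (d.+1 * K)).
pose beta b := b + 1 + C.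
pose s b := (d.+1 * (d * (C * beta b))) + 3.
pose Psi b := excess_bound d (2 ^ (d.+1 + d.+1)) (d * (d.+1 + d.+1) + d * s b).
pose f1 b := 1 + (d * (d.+1 + d.+1) + d * s b) + Psi b.
pose f2 b := 1 + (beta b + beta b * (d.+1 * (d * s b))) + b.
pose f3 b := d * ((beta b + c) * Psi b + b).
pose f b := f1 b + f2 b + f3 b + (d.+1 + d.+1 * N + 1).
have pbeta : poly_bounded beta.
  by do 2!apply: poly_bounded_add; try exact: poly_bounded_cst; exact: poly_bounded_id.
have cst k : poly_bounded (fun=> k) by exact: poly_bounded_cst.
have ps : poly_bounded s by apply: poly_bounded_add => //; do 3!apply: poly_bounded_mul => //.
have pPsi : poly_bounded Psi.
  by apply: poly_bounded_excess; apply: poly_bounded_add => //; apply: poly_bounded_mul.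
have pf1 : poly_bounded f1.
  apply: poly_bounded_add => //; apply: poly_bounded_add => //; apply: poly_bounded_add => //.
  exact: poly_bounded_mul.
have pf2 : poly_bounded f2.
  apply: poly_bounded_add; last exact: poly_bounded_id.
  apply: poly_bounded_add => //; apply: poly_bounded_add => //.
  by do 3!apply: poly_bounded_mul => //.
have pf3 : poly_bounded f3.
  apply: poly_bounded_mul => //; apply: poly_bounded_add; last exact: poly_bounded_id.
  by apply: poly_bounded_mul => //; apply: poly_bounded_add.
have pf : poly_bounded f.
  apply: poly_bounded_add => //; apply: poly_bounded_add => //; exact: poly_bounded_add.
have [b0 b0P] := poly_bounded_lt_exp2 pf.
exists b0 => b lam bb bl lb; have fl : f b <= lam by apply: leq_trans (b0P _ bb) bl.
exists (d.+1 + d.+1 + (d.+1 * (2 * (d.+1 * (K * lam)))).+1), (s b), (beta b) => L P.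
have lam0 : 0 < lam by apply: leq_trans bl; rewrite expn_gt0.
rewrite -/L; have -> : P = Psi b by [].
have [[F1 F2] [F3 F4]] : (f1 b <= lam /\ f2 b <= lam) /\ (f3 b <= lam /\ d.+1 + d.+1 * N + 1 <= lam).
  by move: fl; rewrite /f; move: (f1 b) (f2 b) (f3 b) (_ + 1) => *; lia.
have MC : d.+1 + d.+1 + (d.+1 * L).+1 <= C * lam.
  rewrite /C /L; set y := d.+1 * (2 * _).
  have -> : (d.+1 + d.+1 + 1 + d.+1 * (2 * (d.+1 * K))) * lam =
    (d.+1 + d.+1 + 1) * lam + y by rewrite /y mulnDl -!mulnA.
  by rewrite addnS -addSn -[(_ + _).+1]addn1 leq_add2r -[X in X <= _]muln1 leq_mul2l lam0 orbT.
have LK : d.+1 * (K * lam) + lam <= L.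
  rewrite /L mul2n -addnn leq_add2l mulnA leq_pmull // muln_gt0 //.
split.
- split; rewrite ?leq_add2l //.
  + by rewrite addnn -mul2n; apply: leqW; rewrite leq_mul2r (leq_trans d2) ?orbT.
  + by rewrite -addnA leq_add2l leq_addl.
  + apply: leq_trans MC _; apply: leq_trans (_ : 2 ^ C * 2 ^ b.+1 <= _).
      by apply: leq_mul; rewrite ltnW // ltn_expl.
    by rewrite -expnD leq_exp2l // /beta addnC addn1.
  + by rewrite /s addnS.
- apply: leq_trans LK; move: F1; rewrite /f1; move: (d.+1 * (K * lam)) (Psi b) (d * _ + _) => *; lia.
- split; first by apply: leq_trans LK; apply: leq_trans (leq_addl _ _); move: F4; move: (d.+1 * N) => *; lia.
  apply: leq_trans F4; rewrite -addnA leq_add2l; apply: leq_trans (leq_addr _ _); exact: leq_pmull.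
- split => //.
  have h1 : (beta b + c) * Psi b + b <= lam by apply: leq_trans F3; rewrite /f3 leq_pmull // ltnW.
  have -> : lam * (d + 3) = lam * d.+1 + lam + lam by rewrite addnS mulnS addnS mulnS addn1; lia.
  rewrite mulSn; move: F4 h1; move: (lam * d.+1) ((beta b + c) * _) (d.+1 * N) => *; lia.
have -> : lam * (s b).-1 = beta b * (d.+1 * (d * (C * lam))) + lam + lam.
  have -> : (s b).-1 = d.+1 * (d * (C * beta b)) + 2 by rewrite /s !addnS.
  rewrite mulnDr muln2 -addnn addnA; congr (_ + _ + _); lia.
have : beta b * (d.+1 * (d * (d.+1 + d.+1 + (d.+1 * L).+1))) <= beta b * (d.+1 * (d * (C * lam))).
  by rewrite !leq_mul2l MC !orbT.
move: F2; rewrite /f2 !mulnDr.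
move: (beta b * _) (beta b * _) => x y; lia.
Qed.

Local Open Scope ring_scope.

(** * Expectations over the random set of faces *)

Section Expectation.
Variables (R : realFieldType) (n d : nat) (p : R).
Hypotheses (p0 : 0 <= p) (p1 : p <= 1).
Implicit Types (F : {set {set 'I_n}}) (X Y : {set {set 'I_n}} -> R).

Definition mass F : R := \prod_(f in simplices n d) (if f \in F then p else 1 - p).

Definition expect X : R := \sum_(F in powerset (simplices n d)) mass F * X F.

Lemma mass_ge0 F : 0 <= mass F.
Proof. by apply: prodr_ge0 => f _; case: ifP => // _; rewrite subr_ge0. Qed.

Lemma expect_le X Y : (forall F, F \subset simplices n d -> X F <= Y F) ->
  expect X <= expect Y.
Proof.
move=> XY; apply: ler_sum => F; rewrite powersetE => FS.
by rewrite ler_wpM2l ?mass_ge0 // XY.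
Qed.

Lemma expectD X Y : expect (fun F => X F + Y F) = expect X + expect Y.
Proof. by rewrite -big_split /=; apply: eq_bigr => F _; rewrite mulrDr. Qed.

Lemma expectZ c X : expect (fun F => c * X F) = c * expect X.
Proof. by rewrite mulr_sumr; apply: eq_bigr => F _; rewrite mulrCA. Qed.

Lemma expect_sum (I : Type) (r : seq I) (P : pred I) (X : I -> {set {set 'I_n}} -> R) :
  expect (fun F => \sum_(i <- r | P i) X i F) = \sum_(i <- r | P i) expect (X i).
Proof.
rewrite [RHS]exchange_big /=; apply: eq_bigr => F _; by rewrite mulr_sumr.
Qed.

(** With [a] and [b] as in the proof, the expansion of the product of the sums
    [a f + b f] over all faces is the total mass of the sets that contain [l]. *)
Lemma expect_contains (l : seq {set 'I_n}) : uniq l -> {subset l <= simplices n d} ->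
  expect (fun F => (all (mem F) l)%:R) = p ^+ size l.
Proof.
move=> ul lS.
pose a (f : {set 'I_n}) : R := if f \in simplices n d then p else 0.
pose b (f : {set 'I_n}) : R := if f \in simplices n d then (if f \in l then 0 else 1 - p) else 1.
have -> : p ^+ size l = \prod_f (a f + b f).
  rewrite (bigID (mem l)) /= [X in _ * X]big1 => [|f fl]; last first.
    by rewrite /a /b (negPf fl); case: ifP => _; rewrite ?add0r // addrC subrK.
  rewrite mulr1 -big_uniq //= big_seq.
  rewrite (eq_bigr (fun=> p)) => [|f fl]; last by rewrite /a /b lS // fl addr0.
  by rewrite -big_seq big_const_seq count_predT iter_mulr_1.
rewrite bigA_distr /expect [RHS](bigID (fun F => F \subset simplices n d)) /=.
rewrite [X in _ = _ + X]big1 ?addr0 => [|F /subsetPn[f fF fS]]; last first.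
  by rewrite (bigD1 f) //= fF /a (negPf fS) mul0r.
rewrite (eq_bigl (fun F => F \subset simplices n d)) => [|F]; last by rewrite powersetE.
apply: eq_bigr => F FS; rewrite [RHS](bigID (mem (simplices n d))) /=.
rewrite [X in _ = _ * X]big1 ?mulr1 => [|f fS]; last first.
  by rewrite /a /b (negPf fS); case: ifP => // /(subsetP FS) fS'; rewrite fS' in fS.
case: allP => [al|/allP/allPn[f fl fF]]; last first.
  rewrite mulr0 (bigD1 f) ?lS //= (negPf (fF : f \notin F)) /b lS // fl mul0r //.
rewrite mulr1; apply: eq_bigr => f fS; rewrite /a /b fS.
case: ifP => // fF; case: ifP => // /al /=; by rewrite fF.
Qed.

Lemma expect1 : expect (fun=> 1) = 1.
Proof.
rewrite -[RHS](expr0 p) -(@expect_contains [::]) //.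
Qed.

Lemma expect_cst c : expect (fun=> c) = c.
Proof. by rewrite -[RHS]mulr1 -expect1 -expectZ; apply: eq_bigr => F _; rewrite mulr1. Qed.

End Expectation.

Lemma bonferroni (R : realFieldType) (I : eqType) (L : seq I) (a : pred I) : uniq L ->
  \sum_(r <- L) (a r)%:R - \sum_(r <- L) \sum_(r' <- L | r' != r) (a r && a r')%:R
  <= (has a L)%:R :> R.
Proof.
elim: L => [_|r L IH /= /andP[rL /IH{}IH]]; first by rewrite !big_nil subr0.
rewrite !big_cons eqxx /=.
have eL : \sum_(j <- L | j != r) (a r && a j)%:R = \sum_(j <- L) (a r && a j)%:R :> R.
  rewrite big_seq_cond [RHS]big_seq; apply: eq_bigl => j.
  by case jL: (j \in L) => //=; apply: contraNneq rL => <-.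
rewrite eL.
have : \sum_(r0 <- L) \sum_(j <- L | j != r0) (a r0 && a j)%:R <=
   \sum_(r0 <- L) \sum_(j <- r :: L | j != r0) (a r0 && a j)%:R :> R.
  apply: ler_sum => j _; rewrite big_cons; case: ifP => // _; by rewrite lerDr ler0n.
have -> : \sum_(j <- L) (a r && a j)%:R = (a r)%:R * \sum_(j <- L) (a j)%:R :> R.
  by rewrite mulr_sumr; apply: eq_bigr => j _; rewrite -natrM mulnb.
have : 0 <= \sum_(j <- L) \sum_(k <- L | k != j) (a j && a k)%:R :> R.
  by apply: sumr_ge0 => j _; apply: sumr_ge0.
move: IH; move: (\sum_(j <- L) (a j)%:R) (\sum_(j <- L) \sum_(k <- L | k != j) (a j && a k)%:R).
move: (\sum_(j <- L) \sum_(k <- r :: L | k != j) (a j && a k)%:R) => x y z.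
by case: (a r) => /=; case: (has a L) => /=; lra.
Qed.

(** * Weighted sums over runs *)

Section Weights.
Variables (R : realFieldType) (T : finType) (d : nat).
Implicit Types (f g h U V : {set T}) (x y u v w : T) (B : seq {set T}).
Implicit Types (st r : state T).

Notation clean r := (old r == 0%N).

Lemma sum_runsS (P : pred (state T)) (X : state T -> R) N st h s : stk st = h :: s ->
  \sum_(r <- runs N.+1 st | P r) X r = \sum_(r <- runs N (leaf st) | P r) X r +
    \sum_(x | x \notin h) \sum_(r <- runs N (expand st x) | P r) X r.
Proof.
move=> e; rewrite /= e big_cat /=; congr (_ + _).
rewrite big_flatten big_map /= big_enum_cond /=.
by apply: eq_bigl => x; rewrite inE andbT.
Qed.

Lemma sum_runs_done (P : pred (state T)) (X : state T -> R) N st : stk st = [::] ->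
  \sum_(r <- runs N st | P r) X r = if P st then X st else 0.
Proof. by move=> e; rewrite runs_done // big_mkcond big_seq1. Qed.

Lemma sum_runs0 (P : pred (state T)) (X : state T -> R) st h s : stk st = h :: s ->
  \sum_(r <- runs 0 st | P r) X r = 0.
Proof. by move=> e; rewrite /= e big_nil. Qed.

Variables (yl ym yo : R) (M : nat).

(** The choice of a new vertex has weight [ym], shared among all vertices, that of an
    old one [yo], shared among the at most [M] vertices met. *)
Definition wt st : R :=
  yl ^+ size (lvs st) * (ym / #|T|%:R) ^+ size (nws st) * (yo / M%:R) ^+ old st.

Lemma wt_ge0 st : 0 <= yl -> 0 <= ym -> 0 <= yo -> 0 <= wt st.
Proof. by move=> l m o; rewrite !mulr_ge0 // exprn_ge0 // divr_ge0. Qed.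

(** A random exploration that chooses a leaf, a new vertex or an old one with
    probabilities [yl], [ym] and [yo] follows the run [r] with probability at least
    [wt r]. *)
Lemma sum_wt_le N st : 0 <= yl -> 0 <= ym -> 0 <= yo -> yl + ym + yo <= 1 ->
  (#|usd st| + N <= M)%N -> \sum_(r <- runs N st) wt r <= wt st.
Proof.
move=> l0 m0 o0 y1; elim: N st => [|N IH] st leM.
  case e: (stk st) => [|h s]; first by rewrite sum_runs_done.
  by rewrite (sum_runs0 _ _ e) wt_ge0.
case e: (stk st) => [|h s]; first by rewrite sum_runs_done.
rewrite (sum_runsS _ _ _ e).
have wl : wt (leaf st) = wt st * yl.
  by rewrite /wt /leaf e /= exprS; ring.
have we x : wt (expand st x) = wt st * (if x \in usd st then yo / M%:R else ym / #|T|%:R).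
  by rewrite /wt /expand e /=; case: ifP => _ /=; rewrite ?addn1 ?addn0 ?exprS; ring.
apply: le_trans (_ : wt (leaf st) + \sum_(x | x \notin h) wt (expand st x) <= _).
  apply: lerD; first by apply: IH; rewrite /leaf e /=; move: leM; clia.
  apply: ler_sum => x _; apply: IH; rewrite /expand e /=; apply: leq_trans leM.
  by rewrite cardsU1 addnS -addSn leq_add2r; case: (_ \notin _).
have T0 : (usd st == set0) || (0 < #|T|)%N.
  by case: (set_0Vmem (usd st)) => [->|[x _]]; rewrite ?eqxx // (cardD1 x) orbT.
apply: le_trans (_ : wt st * (yl + \sum_x (if x \in usd st then yo / M%:R else ym / #|T|%:R)) <= _).
  rewrite wl mulrDr mulr_sumr lerD2l big_mkcond /=; apply: ler_sum => x _.
  case: ifP => _; first by rewrite we.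
  by apply: mulr_ge0; rewrite ?wt_ge0 //; case: ifP => _; rewrite divr_ge0.
rewrite -[leRHS]mulr1 ler_wpM2l ?wt_ge0 //; apply: le_trans y1; rewrite -addrA lerD2l.
rewrite (bigID (mem (usd st))) /= addrC; apply: lerD.
  rewrite (eq_bigr (fun=> ym / #|T|%:R)) => [|x /negPf ->] //.
  rewrite sumr_const -(mulr_natr (ym / #|T|%:R)); have [->|Tn] := eqVneq #|T|%:R (0 : R).
    by rewrite invr0 mulr0 mul0r.
  rewrite -[leRHS]mulr1 -mulrA ler_wpM2l // ler_pdivrMl ?mulr1 ?ler_nat ?max_card //.
  by rewrite lt0r Tn ler0n.
rewrite (eq_bigr (fun=> yo / M%:R)) => [|x ->] //.
rewrite sumr_const -(mulr_natr (yo / M%:R)); have [->|Mn] := eqVneq M%:R (0 : R).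
  by rewrite invr0 mulr0 mul0r.
rewrite -[leRHS]mulr1 -mulrA ler_wpM2l // ler_pdivrMl ?mulr1 ?ler_nat.
  by apply: leq_trans leM; rewrite leq_addr.
by rewrite lt0r Mn ler0n.
Qed.

Variable p : R.
Hypothesis p0 : 0 <= p.

Lemma sum_dirty_expand N st x h s : stk st = h :: s -> x \in usd st ->
  \sum_(r <- runs N (expand st x) | clean r) p ^+ size (lvs r) = 0.
Proof.
move=> e xU; rewrite big_seq_cond big1 // => r /andP[/runs_mono[+ _ _]].
rewrite /expand e /= xU => le /eqP o; by move: le; rewrite o addn1.
Qed.

(** [W] is a supersolution of the recursion for the weight of clean runs, where a face
    either is a leaf or opens [d.+1] faces. *)
Lemma sum_clean_le W B U N st : inv d U B st -> 0 <= W -> p + #|T|%:R * W ^+ d.+1 <= W ->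
  \sum_(r <- runs N st | clean r) p ^+ size (lvs r) <= p ^+ size (lvs st) * W ^+ size (stk st).
Proof.
move=> i W0 HW; elim: N st i => [|N IH] st i; case e: (stk st) => [|h s].
- by rewrite sum_runs_done // mulr1; case: ifP => // _; rewrite exprn_ge0.
- by rewrite (sum_runs0 _ _ e) mulr_ge0 ?exprn_ge0.
- by rewrite sum_runs_done // mulr1; case: ifP => // _; rewrite exprn_ge0.
rewrite (sum_runsS _ _ _ e).
have hf : is_face d h by apply: (allP (inv_face i)); apply: (inv_sub i); rewrite e mem_head.
apply: le_trans (_ : p ^+ (size (lvs st)).+1 * W ^+ size s +
   \sum_(x : T) p ^+ size (lvs st) * W ^+ (d.+1 + size s) <= _).
  apply: lerD.
    by have := IH _ (inv_leaf i); rewrite /leaf e.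
  rewrite big_mkcond; apply: ler_sum => x _; case: ifP => xh; last first.
    by rewrite mulr_ge0 ?exprn_ge0.
  have [xU|xU] := boolP (x \in usd st).
    by rewrite (sum_dirty_expand N e xU) mulr_ge0 ?exprn_ge0.
  apply: le_trans (IH _ (inv_expand e xh i)) _.
  by rewrite /expand e (fresh_children i xU e) /= size_cat size_children (eqP hf).
rewrite sumr_const -mulr_natl [size (_ :: _)]/= (exprS W (size s)) exprD exprS.
rewrite [leRHS](_ : _ = W * (p ^+ size (lvs st) * W ^+ size s)); last by ring.
rewrite [leLHS](_ : _ = (p + #|T|%:R * W ^+ d.+1) * (p ^+ size (lvs st) * W ^+ size s)); last by ring.
by rewrite ler_wpM2r // mulr_ge0 ?exprn_ge0.
Qed.

(** The total weight of the clean runs of at most [N] steps that start from [k] open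
    faces, when each face has [q] admissible new vertices. *)
Fixpoint clean_weight (q : R) N k : R :=
  if k is k'.+1 then
    if N is N'.+1 then p * clean_weight q N' k' + q * clean_weight q N' (d.+1 + k')%N
    else 0
  else 1.

Lemma clean_weight_ge0 q N k : 0 <= q -> 0 <= clean_weight q N k.
Proof.
move=> q0; elim: N k => [|N IH] [|k] //=; by rewrite addr_ge0 // mulr_ge0.
Qed.

(** At most [M] vertices are ever met, so [q] new ones remain for every expansion. *)
Lemma sum_clean_ge q B U N st : inv d U B st -> 0 <= q ->
  (#|usd st| + N <= M)%N -> clean st -> q <= #|T|%:R - M%:R ->
  p ^+ size (lvs st) * clean_weight q N (size (stk st)) <=
    \sum_(r <- runs N st | clean r) p ^+ size (lvs r).
Proof.
move=> i q0 + + Hq; elim: N st i => [|N IH] st i leM cst; case e: (stk st) => [|h s].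
- by rewrite sum_runs_done // cst mulr1.
- by rewrite (sum_runs0 _ _ e) mulr0.
- by rewrite sum_runs_done // cst mulr1.
rewrite (sum_runsS _ _ _ e) [size (_ :: _)]/= [clean_weight _ _ _]/= mulrDr.
have hf : is_face d h by apply: (allP (inv_face i)); apply: (inv_sub i); rewrite e mem_head.
have hU : h \subset usd st.
  by apply: (allP (inv_used i)); apply: (inv_sub i); rewrite e mem_head.
apply: lerD.
  have := IH _ (inv_leaf i); rewrite /leaf e /= => /(_ _ cst) le.
  apply: le_trans (le _); first by rewrite exprS; lra.
  by apply: leq_trans leM; rewrite leq_add2l.
apply: le_trans (_ : \sum_(x in ~: usd st) p ^+ size (lvs st) * clean_weight q N (d.+1 + size s)%N <= _).
  rewrite sumr_const mulrCA -[leRHS]mulr_natl ler_wpM2r ?mulr_ge0 ?exprn_ge0 ?clean_weight_ge0 //.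
  apply: le_trans Hq _; rewrite lerBlDr -natrD ler_nat cardsCs setCK.
  rewrite addnC -leq_subLR; apply: leq_sub2l; apply: leq_trans leM; exact: leq_addr.
rewrite [leRHS](bigID (fun x => x \in usd st)) /= ler_wpDl //.
  by apply: sumr_ge0 => x _; apply: sumr_ge0 => r _; rewrite exprn_ge0.
rewrite [leRHS](eq_bigl (fun x => x \in ~: usd st)) => [|x]; last first.
  by rewrite inE andb_idl //; apply: contra => /(subsetP hU).
apply: ler_sum => x; rewrite inE => xU; have xh : x \notin h by apply: contra xU => /(subsetP hU).
have := IH _ (inv_expand e xh i).
rewrite /expand e (fresh_children i xU e) /= (negPf xU) addn0 size_cat size_children (eqP hf) => le.
apply: le => //; apply: leq_trans leM; by rewrite cardsU1 xU add1n addSnnS.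
Qed.

(** Vertices of [V] are free of charge, so the bound is the product over the steps of
    [1] for a leaf, [#|V|] for a vertex of [V], and [1] in total for all others.  It
    serves to count the runs that share vertices with a given one. *)
Lemma sum_clean_new V B U N st : inv d U B st -> (0 < #|T|)%N ->
  \sum_(r <- runs N st | clean r) (#|T|%:R^-1 : R) ^+ #|usd r :\: V| <=
  #|T|%:R^-1 ^+ #|usd st :\: V| * (2 + #|V|%:R) ^+ N.
Proof.
move=> i T0; have v0 : 0 <= (#|T|%:R^-1 : R) by rewrite invr_ge0.
have c1 : 1 <= 2 + #|V|%:R :> R by rewrite -(natrD R 2) ler1n.
elim: N st i => [|N IH] st i; case e: (stk st) => [|h s].
- by rewrite sum_runs_done // mulr1; case: ifP => // _; rewrite exprn_ge0.
- by rewrite (sum_runs0 _ _ e) mulr_ge0 ?exprn_ge0 // (le_trans _ c1).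
- rewrite sum_runs_done //; case: ifP => _; last by rewrite mulr_ge0 ?exprn_ge0 // (le_trans _ c1).
  by rewrite -[leLHS]mulr1 ler_wpM2l ?exprn_ge0 // exprn_ege1.
rewrite (sum_runsS _ _ _ e).
set K := (_ : R) ^+ N in IH *; set A := _ ^+ #|usd st :\: V|.
have K0 : 0 <= K by rewrite exprn_ge0 // (le_trans _ c1).
have A0 : 0 <= A by rewrite exprn_ge0.
apply: le_trans (_ : A * K + \sum_x A * K * (if x \in V then 1 else #|T|%:R^-1) <= _).
  apply: lerD; first by have := IH _ (inv_leaf i); rewrite /leaf e.
  rewrite big_mkcond; apply: ler_sum => x _; case: ifP => xh; last first.
    by rewrite mulr_ge0 ?mulr_ge0 //; case: ifP.
  have [xU|xU] := boolP (x \in usd st).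
    rewrite big_seq_cond big1 ?mulr_ge0 ?mulr_ge0 //; first by case: ifP.
    move=> r /andP[/runs_mono[+ _ _]]; rewrite /expand e /= xU => le /eqP o.
    by move: le; rewrite o addn1.
  apply: le_trans (IH _ (inv_expand e xh i)) _.
  rewrite /expand e /= -/K mulrAC ler_wpM2r // setDUl.
  case: ifP => xV.
    rewrite (_ : [set x] :\: V = set0) ?set0U ?mulr1 //.
    by apply/eqP; rewrite setD_eq0 sub1set.
  have -> : [set x] :\: V = [set x] by apply/setDidPl; rewrite disjoints1 xV.
  rewrite cardsU1 inE (negPf xU) andbF /= add1n exprS mulrC //.
rewrite -mulr_sumr -[X in X + _]mulr1 -mulrDr -mulrA ler_wpM2l // exprS mulrC.
rewrite ler_wpM2r // -/K (bigID (mem V)) /= (eq_bigr (fun=> 1)) => [|x ->] //.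
rewrite sumr_const (eq_bigr (fun=> #|T|%:R^-1)) => [|x /negPf ->] //.
rewrite sumr_const -[_^-1 *+ _]mulr_natr.
have : #|T|%:R^-1 * #|[pred x | x \notin V]|%:R <= 1 :> R.
  by rewrite ler_pdivrMl ?mulr1 ?ler_nat ?max_card // ltr0n.
move=> H; rewrite (_ : 2 = 1 + 1) // ; lra.
Qed.

End Weights.

(** * Probabilities of derivations *)

Section Reach.
Variables (n d : nat).
Hypothesis d2 : (2 <= d)%N.
Implicit Types (F : {set {set 'I_n}}) (f g U V : {set 'I_n}) (B D : seq {set 'I_n}).
Implicit Types (st r : state 'I_n).

Definition reach N B F : bool :=
  [exists D : N.-bseq {set 'I_n}, deriv F D && all (mem D) B].

Lemma reachP N B F : reflect
  (exists D, [/\ (size D <= N)%N, deriv F D & {subset B <= D}]) (reach N B F).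
Proof.
apply: (iffP existsP) => [[D /andP[dD /allP BD]]|[D [sD dD BD]]].
  by exists D; split; rewrite ?size_bseq.
by exists (Bseq sD); rewrite dD; apply/allP.
Qed.

Lemma reach_cat N N' B B' F : reach N B F -> reach N' B' F -> reach (N + N') (B ++ B') F.
Proof.
move=> /reachP[D [s1 d1 b1]] /reachP[D' [s2 d2' b2]]; apply/reachP; exists (D ++ D'); split.
- by rewrite size_cat leq_add.
- exact: deriv_cat.
- by move=> z; rewrite !mem_cat => /orP[/b1 ->//|/b2 ->]; rewrite orbT.
Qed.

Lemma reach_uniq N B F : reach N B F ->
  exists D, [/\ (size D <= N)%N, uniq D, deriv F D & {subset B <= D}].
Proof.
case/reachP => D [sD dD BD]; exists (undup D); split.
- exact: leq_trans (size_undup _) sD.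
- exact: undup_uniq.
- exact: deriv_undup.
- by move=> z /BD; rewrite mem_undup.
Qed.

(** A derivation step combines [d.+1] derivations into one, so the least length of a
    derivation cannot pass from at most [L] to more than [d.+1 * L + 1] at once. *)
Lemma no_jump F L : (forall f, f \in simplices n d ->
    reach (d.+1 * L).+1 [:: f] F -> reach L [:: f] F) ->
  forall f, f \in simplices n d -> derivable F f -> reach L [:: f] F.
Proof.
move=> H f fS [D + fD]; elim: D f fS fD => [//|g D IH] f fS fD /= /andP[gP dD].
move: fD; rewrite inE => /orP[/eqP fg|fD]; last exact: IH.
rewrite -{}fg in gP; apply: H => //; case/orP: gP => [fF|/existsP[x /andP[xf al]]].
  apply/reachP; exists [:: f]; split=> //=; by rewrite fF.
have fc : #|f| = d.+1 by move: fS; rewrite inE => /eqP.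
have : reach (size (children x f) * L) (children x f) F.
  have : forall c, c \in children x f -> reach L [:: c] F.
    move=> c cc; apply: IH => //; last exact: (allP al).
    by have [v vf ->] := mem_children _ _ _ cc; rewrite inE card_swap // fc.
  elim: (children x f) => [_|c cs IHc HH]; first by apply/reachP; exists [::].
  rewrite /= mulSn; apply: (@reach_cat _ _ [:: c]); first by apply: HH; rewrite mem_head.
  by apply: IHc => z zc; apply: HH; rewrite inE zc orbT.
rewrite size_children fc => /reachP[E [sE dE cE]]; apply/reachP; exists (f :: E); split=> //=.
  rewrite dE andbT; apply/orP; right; apply/existsP; exists x; rewrite xf.
  by apply/allP => c /cE.
by move=> z; rewrite !inE => ->.
Qed.

(** A clean run has [d] leaves for each new vertex; a surplus of [E] on a small vertex
    set is unlikely. *)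
Definition dense M E F : bool :=
  [exists V : {set 'I_n}, (#|V| <= M)%N &&
    (d * #|V| + E <= #|[set f in F | f \subset V]|)%N].

(** These runs can be recognized without knowledge of [F], as the union bound needs. *)
Definition good E r : bool :=
  all (spanned d (lvs r)) (seen r) && (size (lvs r) < d * #|usd r| + E)%N.

(** The leaves of the run provided by [explore] are present, so too large a surplus of
    them would make the set of its vertices dense. *)
Lemma reach_runs E M L N B U F : F \subset simplices n d -> uniq B -> all (is_face d) B ->
  all (fun g : {set 'I_n} => g \subset U) B -> (#|U| + N <= M)%N -> ~~ dense M E F ->
  reach N B F ->
  exists r, [/\ r \in runs N (start B U), good E r, all (mem F) (lvs r) &
    (L < size (seen r))%N || reach L B F].
Proof.
move=> FS uB fB BU leM nd /reach_uniq[D [sD uD dD BD]].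
have [r [rr lF sp [D' [dD' BD' sD']]]] := explore dD uD uB fB BU BD sD.
have [i _] := inv_runs rr (inv_start uB fB BU).
exists r; split=> //.
- rewrite /good sp ltnNge /=; apply: contra nd => le; apply/existsP; exists (usd r).
  apply/andP; split; first exact: leq_trans (card_usd_runs rr) leM.
  apply: leq_trans le _; have ul : uniq (lvs r) by have := inv_open i; rewrite cat_uniq => /and3P[].
  rewrite -(card_uniqP ul); apply: subset_leq_card; apply/subsetP => z zl.
  rewrite inE lF //=; apply: (allP (inv_used i)); apply: (inv_sub i); by rewrite mem_cat zl orbT.
- by apply/allP.
- case: ltnP => [//|le] /=; apply/reachP; exists D'; split=> //.
  exact: leq_trans le.
Qed.

(** The way in which the top face was treated can be read off at the end: it is a leaf,
    or it stands in [nws] with the vertex that was chosen. *)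
Lemma clean_runs_uniq U B N st : inv d U B st ->
  uniq [seq r <- runs N st | old r == 0%N].
Proof.
have uniq_flat (I S : eqType) (xs : seq I) (G : I -> seq S) : uniq xs ->
    (forall x, x \in xs -> uniq (G x)) ->
    (forall x y z, x \in xs -> y \in xs -> z \in G x -> z \in G y -> x = y) ->
    uniq (flatten [seq G x | x <- xs]).
  elim: xs => [//|x xs IH] /= /andP[xx ux] uG dG; rewrite cat_uniq uG ?mem_head //=.
  rewrite IH ?andbT //; last first.
  - by move=> a b z a1 b1; apply: dG; rewrite inE ?a1 ?b1 orbT.
  - by move=> y yx; apply: uG; rewrite inE yx orbT.
  apply/hasPn => z /flatten_mapP[y yx zy]; apply: contra xx => zx.
  by rewrite (dG x y z) // ?mem_head // inE yx orbT.
elim: N st => [|N IH] st i; case e: (stk st) => [|h s]; rewrite ?(runs_done _ e) /= ?e //;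
  try by case: ifP.
have hS : h \in seen st by apply: (inv_sub i); rewrite e mem_head.
have hl : h \notin lvs st by have := inv_open i; rewrite e /= mem_cat negb_or => /andP[/andP[]].
have frozen x r : x \notin h -> r \in runs N (expand st x) ->
    (h \in lvs r -> h \in lvs st) /\
    forall y, (y, h) \in nws r -> (y, h) \in nws (expand st x).
  move=> xh qr; have i' := inv_expand e xh i.
  have [||||l nn] := runs_frozen (g := h) qr.
  - by have := inv_open i'; rewrite cat_uniq => /andP[].
  - by move=> z zs; apply: (inv_sub i'); rewrite mem_cat zs.
  - by rewrite /expand e /= mem_cat hS orbT.
  - rewrite /expand e /= mem_cat mem_filter hS /=.
    by have := inv_open i; rewrite e /= mem_cat negb_or => /andP[/andP[]].
  - by split=> // kl; have := l kl; rewrite /expand e.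
have newx x r : old r == 0%N -> r \in runs N (expand st x) -> x \notin usd st.
  move=> /eqP oq /runs_mono[]; rewrite oq leqn0 /expand e /= addn_eq0.
  by case: (x \in _) => // /andP[].
rewrite filter_cat cat_uniq (IH _ (inv_leaf i)) /=.
rewrite filter_flatten -map_comp; apply/andP; split.
  apply/hasPn => r /flatten_mapP[x]; rewrite mem_enum inE => xh; rewrite mem_filter => /andP[_ rr].
  have [l _] := frozen x r xh rr; apply/negP; rewrite /= mem_filter => /andP[_ /runs_mono[_ ll _]].
  by move/negP: hl; apply; apply: l; apply: ll; rewrite /leaf e mem_head.
apply: uniq_flat => [|x|x y r]; rewrite ?enum_uniq ?mem_enum ?inE //.
  by move=> xh; apply: IH; exact: inv_expand e xh i.
move=> xh yh; rewrite /= !mem_filter => /andP[o rx] /andP[_ ry].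
have xU := newx x r o rx; have yU := newx y r o ry.
have [_ _ _ _ [_ nn]] := clean_run (inv_expand e xh i) rx (eqP o).
have [_ fr] := frozen y r yh ry.
have : (x, h) \in nws r by apply: nn; rewrite /expand e /= (negPf xU) mem_head.
move/fr; rewrite /expand e /= (negPf yU) inE xpair_eqE eqxx andbT => /orP[/eqP//|xn].
case/negP: xU; rewrite (inv_usd i) /used in_setU; apply/orP; right.
by rewrite inE; apply/mapP; exists (x, h).
Qed.

End Reach.

Section Bounds.
Variables (R : realFieldType) (n d : nat) (p : R).
Hypotheses (d2 : (2 <= d)%N) (p0 : 0 <= p) (p1 : p <= 1).
Implicit Types (F : {set {set 'I_n}}) (f g U V : {set 'I_n}) (B D : seq {set 'I_n}).
Implicit Types (st r : state 'I_n).

Local Notation expect := (@expect R n d p).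

Lemma lvs_simplices N B U r : uniq B -> all (is_face d) B ->
  all (fun g : {set 'I_n} => g \subset U) B -> r \in runs N (start B U) ->
  uniq (lvs r) /\ {subset lvs r <= simplices n d}.
Proof.
move=> uB fB BU rr; have [i _] := inv_runs rr (inv_start uB fB BU); split.
  by have := inv_open i; rewrite cat_uniq => /and3P[].
by move=> g gl; rewrite inE; apply: (allP (inv_face i)); apply: (inv_sub i); rewrite mem_cat gl orbT.
Qed.

Lemma expect_runs (X : {set {set 'I_n}} -> bool) (Q : pred (state 'I_n)) N B U :
  uniq B -> all (is_face d) B -> all (fun g : {set 'I_n} => g \subset U) B ->
  (forall F, F \subset simplices n d -> X F ->
    exists r, [/\ r \in runs N (start B U), Q r & all (mem F) (lvs r)]) ->
  expect (fun F => (X F)%:R) <= \sum_(r <- runs N (start B U) | Q r) p ^+ size (lvs r).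
Proof.
move=> uB fB BU H.
apply: le_trans (_ : expect (fun F => \sum_(r <- runs N (start B U) | Q r) (all (mem F) (lvs r))%:R) <= _).
  apply: expect_le => // F FS; case XF: (X F); last by apply: sumr_ge0.
  have [r [rr Qr al]] := H F FS XF.
  rewrite big_mkcond (big_rem r) //= Qr al lerDl; apply: sumr_ge0 => r' _; by case: ifP.
rewrite expect_sum big_seq_cond [leRHS]big_seq_cond; apply: ler_sum => r /andP[rr _].
have [ul ls] := lvs_simplices uB fB BU rr.
by rewrite expect_contains.
Qed.

Section Dirty.
Variables (yl ym yo : R) (M E c0 N : nat) (B : seq {set 'I_n}) (U : {set 'I_n}).
Hypotheses (l0 : 0 < yl) (m0 : 0 < ym) (o0 : 0 < yo) (y1 : yl + ym + yo <= 1).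
Hypotheses (UM : (#|U| + N <= M)%N) (pl : p <= yl) (oM : yo <= M%:R) (n0 : (0 < n)%N).
Hypotheses (uB : uniq B) (fB : all (is_face d) B).
Hypotheses (BU : all (fun g : {set 'I_n} => g \subset U) B) (bok : base_ok d U B c0).

(* The factor that remains of each new vertex: [n] choices against [d] leaves, relative
   to the weights. *)
Let theta := n%:R * p ^+ d / (yl ^+ d * ym).
Let Psi := excess_bound d c0 (d * #|U| + E).

Hypothesis theta1 : theta <= 1.

Lemma theta_ge0 : 0 <= theta.
Proof. by rewrite divr_ge0 ?mulr_ge0 ?exprn_ge0 // ?ltW. Qed.

(** The cost of a run relative to its weight.  Only the old expansions make this ratio
    large, and they are few. *)
Lemma good_run r : r \in runs N (start B U) -> good d E r ->
  exists e, [/\ size (lvs r) = size B + d * size (nws r) + e, (e <= d * #|U| + E)%N,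
    (old r <= Psi)%N, e = 0 -> old r = 0 &
    size (seen r) = size (lvs r) + size (nws r) + old r]%N /\
    p ^+ size (lvs r) = wt yl ym yo M r *
      ((p / yl) ^+ (size B + e) * theta ^+ size (nws r) * (M%:R / yo) ^+ old r).
Proof.
move=> rr /andP[sp nd].
have [i e0] := inv_runs rr (inv_start uB fB BU).
have [e [le ole eo]] := run_counts d2 i e0 BU bok sp.
have cU : #|usd r| = (#|U| + size (nws r))%N by rewrite (inv_usd i) (card_used (inv_chain i)).
have ee : (e <= d * #|U| + E)%N by move: nd; rewrite le cU mulnDr; move: (d * _)%N (d * _)%N; clia.
have mono a b : (a <= b)%N -> (excess_bound d c0 a <= excess_bound d c0 b)%N.
  by move=> ab; rewrite -(subnKC ab); apply: leq_trans (excess_bound_add d2 _ _ _); exact: leq_addr.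
exists e; split.
  split=> //; first exact: leq_trans ole (mono _ _ ee).
  by have := inv_size i; rewrite e0.
have M0 : 0 < M%:R :> R by apply: lt_le_trans oM.
have n1 : 0 < n%:R :> R by rewrite ltr0n.
rewrite /wt /theta le card_ord !exprMn !exprD !exprVn !exprM !exprMn.
have [? ? ? ? ?] : [/\ yl != 0, ym != 0, yo != 0, M%:R != 0 :> R & n%:R != 0 :> R].
  by split; apply: lt0r_neq0.
rewrite -!exprM -!exprVn !exprM.
set a := p ^+ d; set b := yl ^+ d.
have b0 : b != 0 by rewrite expf_neq0.
clearbody a b.
have K (x : R) k : x != 0 -> x ^+ k * x^-1 ^+ k = 1.
  by move=> x0; rewrite -exprMn mulfV // expr1n.
rewrite invfM -!exprVn.
rewrite [RHS](_ : _ = p ^+ size B * a ^+ size (nws r) * p ^+ e *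
  (yl ^+ size B * yl^-1 ^+ size B) * (yl ^+ e * yl^-1 ^+ e) * (b ^+ size (nws r) * b^-1 ^+ size (nws r)) *
  (ym ^+ size (nws r) * ym^-1 ^+ size (nws r)) * (n%:R ^+ size (nws r) * n%:R^-1 ^+ size (nws r)) *
  (yo ^+ old r * yo^-1 ^+ old r) * (M%:R ^+ old r * M%:R^-1 ^+ old r)).
  by rewrite !K // !mulr1.
ring.
Qed.

Lemma sum_good_le (Q : pred (state 'I_n)) c : 0 <= c ->
  (forall r, r \in runs N (start B U) -> Q r -> p ^+ size (lvs r) <= wt yl ym yo M r * c) ->
  \sum_(r <- runs N (start B U) | Q r) p ^+ size (lvs r) <= c.
Proof.
move=> c0' H; rewrite big_seq_cond.
apply: le_trans (_ : \sum_(r <- runs N (start B U)) wt yl ym yo M r * c <= _); last first.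
  rewrite -mulr_suml -[leRHS]mul1r ler_wpM2r //.
  apply: le_trans (sum_wt_le (M := M) (N := N) (st := start B U) (ltW l0) (ltW m0) (ltW o0) y1 UM) _.
  by rewrite /wt /= !mulr1.
rewrite -big_seq_cond big_mkcond big_seq [leRHS]big_seq; apply: ler_sum => r rr.
case: ifP => [|_]; first exact: H.
by rewrite mulr_ge0 // wt_ge0 // ltW.
Qed.

Lemma ratio_ge1 : 1 <= M%:R / yo.
Proof. by rewrite ler_pdivlMr // mul1r. Qed.

(** A run that is not clean has a surplus leaf, hence the additional factor [p / yl]. *)
Lemma expect_reach_le W : 0 <= W -> p + n%:R * W ^+ d.+1 <= W ->
  expect (fun F => (reach N B F && ~~ dense d M E F)%:R) <=
    W ^+ size B + (p / yl) ^+ (size B).+1 * (M%:R / yo) ^+ Psi.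
Proof.
move=> W0 HW; apply: le_trans (expect_runs (N := N) (Q := good d E) uB fB BU _) _.
  move=> F FS /andP[rF nd].
  by have [r [rr g al _]] := reach_runs 0 FS uB fB BU UM nd rF; exists r.
rewrite (bigID (fun r => old r == 0%N)) /=; apply: lerD.
  have i0 : inv d U B (start B U) by exact: inv_start.
  have := sum_clean_le p0 N i0 W0; rewrite card_ord => /(_ HW); rewrite /= mul1r; apply: le_trans.
  rewrite big_mkcond [leRHS]big_mkcond; apply: ler_sum => r _.
  by case: (good d E r) => //=; case: ifP => // _; rewrite exprn_ge0.
have pl0 : 0 <= p / yl by rewrite divr_ge0 // ltW.
have pl1 : p / yl <= 1 by rewrite ler_pdivrMr // mul1r.
apply: sum_good_le => [|r rr /andP[g o]].
  by rewrite mulr_ge0 // exprn_ge0 // (le_trans _ ratio_ge1).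
have [e [[_ _ oP eo _] ->]] := good_run rr g.
have e1 : (0 < e)%N by rewrite lt0n; apply: contra o => /eqP /eo ->.
apply: ler_wpM2l; first by apply: wt_ge0; exact: ltW.
apply: ler_pM; rewrite ?mulr_ge0 ?exprn_ge0 ?theta_ge0 ?(le_trans _ ratio_ge1) //.
- apply: le_trans (_ : (p / yl) ^+ (size B + e) <= _).
    by apply: ler_piMr; [exact: exprn_ge0|apply: exprn_ile1 => //; exact: theta_ge0].
  by apply: ler_wiXn2l => //; rewrite -addn1 leq_add2l.
- by rewrite ler_weXn2l // ratio_ge1.
Qed.

(** With few leaves in surplus and few old expansions, a run that sees more than [L]
    faces has at least [m] new vertices. *)
Lemma expect_jump_le L m : (size B + d.+1 * m + (d * #|U| + E) + Psi <= L)%N ->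
  expect (fun F => [&& reach N B F, ~~ reach L B F & ~~ dense d M E F]%:R) <=
    theta ^+ m * (M%:R / yo) ^+ Psi.
Proof.
move=> leL; apply: le_trans (expect_runs (N := N) (Q := fun r => good d E r && (L < size (seen r))%N) uB fB BU _) _.
  move=> F FS /and3P[rF nL nd].
  have [r [rr g al]] := reach_runs L FS uB fB BU UM nd rF.
  by rewrite (negPf nL) orbF => lt; exists r; rewrite g lt.
have pl0 : 0 <= p / yl by rewrite divr_ge0 // ltW.
have pl1 : p / yl <= 1 by rewrite ler_pdivrMr // mul1r.
apply: sum_good_le => [|r rr /andP[g lt]].
  by rewrite mulr_ge0 // exprn_ge0 ?theta_ge0 // (le_trans _ ratio_ge1).
have [e [[el ee oP eo sE] ->]] := good_run rr g.
have mm : (m <= size (nws r))%N.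
  rewrite leqNgt; apply/negP => mlt; move: lt; rewrite sE el ltnNge => /negP; apply.
  apply: leq_trans leL; apply: leq_add; last exact: oP.
  have : (d.+1 * size (nws r) <= d.+1 * m)%N by rewrite leq_mul2l (ltnW mlt) orbT.
  move: ee; rewrite !mulSn; move: (d * size (nws r))%N (d * m)%N (d * _ + E)%N; clia.
apply: ler_wpM2l; first by apply: wt_ge0; exact: ltW.
apply: ler_pM; rewrite ?mulr_ge0 ?exprn_ge0 ?theta_ge0 ?(le_trans _ ratio_ge1) //.
- apply: le_trans (_ : theta ^+ size (nws r) <= _).
    by rewrite ler_piMl ?exprn_ge0 ?theta_ge0 // exprn_ile1.
  by apply: ler_wiXn2l => //; exact: theta_ge0.
- by rewrite ler_weXn2l // ratio_ge1.
Qed.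

End Dirty.

End Bounds.

(** * Rarity of dense sets, and the mean from below *)

Section DenseLower.
Variables (R : realFieldType) (n d : nat) (p : R).
Hypotheses (d2 : (2 <= d)%N) (p0 : 0 <= p) (p1 : p <= 1) (n0 : (0 < n)%N).
Hypothesis pd : p ^+ d <= n%:R^-1.
Implicit Types (F : {set {set 'I_n}}) (f g U V : {set 'I_n}) (B D : seq {set 'I_n}).
Implicit Types (st r : state 'I_n).

Local Notation expect := (@expect R n d p).

Lemma subset_of_card (T : finType) (S : {set T}) k : (k <= #|S|)%N ->
  exists2 A : {set T}, A \subset S & #|A| = k.
Proof.
rewrite -bin_gt0 -cards_draws card_gt0 => /set0Pn[A]; rewrite inE => /andP[AS /eqP cA].
by exists A.
Qed.

Lemma sum_sets_le M : \sum_(V : {set 'I_n} | (#|V| <= M)%N) (n%:R^-1 : R) ^+ #|V| <= M.+1%:R.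
Proof.
have -> : \sum_(V : {set 'I_n} | (#|V| <= M)%N) (n%:R^-1 : R) ^+ #|V| =
    \sum_(u < M.+1) \sum_(V : {set 'I_n} | #|V| == u) n%:R^-1 ^+ u.
  rewrite (partition_big (fun V : {set 'I_n} => inord #|V|) (fun _ : 'I_M.+1 => true)) //=.
  apply: eq_bigr => u _; apply: eq_big => [V|V /andP[VM /eqP <-]]; last by rewrite inordK.
  apply/andP/eqP => [[VM /eqP <-]|cV]; first by rewrite inordK.
  have uM : (#|V| < M.+1)%N by rewrite cV.
  by split=> //; apply/eqP/val_inj; rewrite /= inordK.
have -> : M.+1%:R = \sum_(u < M.+1) 1 :> R by rewrite sumr_const card_ord.
apply: ler_sum => u _; rewrite sumr_const -[_ *+ _]mulr_natr exprVn ler_pdivrMl ?exprn_gt0 ?ltr0n //.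
rewrite mulr1 -natrX ler_nat; apply: leq_trans (bin_le_exp n u).
rewrite -[X in 'C(X, _)]card_ord -cardsT -cards_draws; apply: subset_leq_card.
by apply/subsetP => V; rewrite !inE subsetT.
Qed.

(** Union bound over the vertex set and over the faces on it.  By [pd] the choice of each
    vertex is paid by [d] of the faces; the surplus [E] beats the choice of the faces. *)
Lemma expect_dense_le M E : (0 < M)%N ->
  expect (fun F => (dense d M E F)%:R) <=
    M.+1%:R * ((M ^ d.+1) ^ (d * M + E))%:R * p ^+ E.
Proof.
move=> M0.
apply: le_trans (_ : expect (fun F => \sum_(V : {set 'I_n} | (#|V| <= M)%N)
   \sum_(A : {set {set 'I_n}} | (A \subset simplices n d) && (A \subset powerset V) && (#|A| == d * #|V| + E)%N)
     (all (mem F) (enum A))%:R) <= _).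
  apply: expect_le => // F FS; case dF: (dense d M E F); last first.
    by apply: sumr_ge0 => V _; apply: sumr_ge0.
  have /existsP[V /andP[VM le]] := dF; have [A AS cA] := subset_of_card le.
  rewrite (bigD1 V) //= (bigD1 A) /=; last first.
    rewrite cA eqxx andbT; apply/andP; split; apply/subsetP => f /(subsetP AS); rewrite !inE => /andP[fF fV] //.
    by have := subsetP FS _ fF; rewrite inE.
  have -> : all (mem F) (enum A).
    by apply/allP => f; rewrite mem_enum => /(subsetP AS); rewrite inE => /andP[].
  rewrite -addrA lerDl addr_ge0 ?sumr_ge0 // => W _; exact: sumr_ge0.
rewrite expect_sum; apply: le_trans (_ : \sum_(V : {set 'I_n} | (#|V| <= M)%N)
    (n%:R^-1) ^+ #|V| * (((M ^ d.+1) ^ (d * M + E))%:R * p ^+ E) <= _); last first.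
  rewrite -mulr_suml -mulrA ler_wpM2r ?mulr_ge0 ?exprn_ge0 //.
  exact: sum_sets_le.
apply: ler_sum => V VM; rewrite expect_sum.
rewrite (eq_bigr (fun=> p ^+ (d * #|V| + E))) => [|A /andP[/andP[AS _] /eqP cA]]; last first.
  rewrite expect_contains ?enum_uniq //; first by rewrite -cardE cA.
  by move=> z; rewrite mem_enum; exact: (subsetP AS).
rewrite sumr_const -[_ *+ _]mulr_natr exprD exprM mulrC.
rewrite [leRHS]mulrCA; apply: ler_pM => //.
- by rewrite mulr_ge0 ?exprn_ge0.
- rewrite ler_nat; apply: leq_trans (_ : 'C('C(#|V|, d.+1), d * #|V| + E) <= _)%N.
    rewrite -cards_draws -cards_draws; apply: subset_leq_card; apply/subsetP => A.
    rewrite !inE => /andP[/andP[AS AV] ->]; rewrite andbT; apply/subsetP => f fA.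
    have := subsetP AS _ fA; have := subsetP AV _ fA; rewrite !inE => -> /eqP ->.
    by rewrite eqxx.
  apply: leq_trans (bin_le_exp _ _) _.
  apply: leq_trans (_ : (M ^ d.+1) ^ (d * #|V| + E) <= _)%N.
    case: (posnP (d * #|V| + E)) => [->//|pos]; rewrite leq_exp2r //.
    by apply: leq_trans (bin_le_exp _ _) _; rewrite leq_exp2r.
  by rewrite leq_pexp2l ?expn_gt0 ?M0 // leq_add2r leq_mul2l VM orbT.
- by rewrite ler_wpM2r ?exprn_ge0 // lerXn2r // ?nnegrE ?exprn_ge0 // invr_ge0.
Qed.

(** Bonferroni's inequality over the clean runs of [N] steps.  For a pair of different
    runs, [clean_pair] saves a factor [p ^+ 2] after all new vertices of both are paid,
    and the number of such pairs is bounded in terms of [N]. *)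
Lemma expect_reach_ge N L f (q : R) : is_face d f -> (1 + d.+1 * N <= L)%N -> 0 <= q ->
  q <= n%:R - (d.+1 + N)%:R ->
  clean_weight d p q N 1 - p ^+ 2 * (d.+1 + N + 2)%:R ^+ (N + N) <=
    expect (fun F => (reach L [:: f] F)%:R).
Proof.
move=> ff leL q0 Hq.
have i0 : inv d f [:: f] (start [:: f] f) by apply: inv_start; rewrite //= ?ff ?subxx.
have T0 : (0 < #|'I_n|)%N by rewrite card_ord.
pose LL := [seq r <- runs N (start [:: f] f) | old r == 0%N].
have uLL : uniq LL by exact: clean_runs_uniq i0.
have LLP r : r \in LL -> r \in runs N (start [:: f] f) /\ old r = 0%N.
  by rewrite mem_filter => /andP[/eqP -> ->].
have lP r : r \in LL -> uniq (lvs r) /\ {subset lvs r <= simplices n d}.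
  by move=> /LLP[rr _]; apply: (lvs_simplices _ _ _ rr); rewrite //= ?ff ?subxx.
apply: le_trans (_ : expect (fun F => (has (fun r => all (mem F) (lvs r)) LL)%:R) <= _); last first.
  apply: expect_le => // F FS; case: hasP => // -[r /LLP[rr o] al].
  have [D [dD sD cD]] := clean_deriv (F := F) i0 rr o (allP al).
  have -> // : reach L [:: f] F.
  by apply/reachP; exists D; split=> //; apply: leq_trans cD leL.
apply: le_trans (_ : expect (fun F => \sum_(r <- LL) (all (mem F) (lvs r))%:R +
   (-1) * \sum_(r <- LL) \sum_(r' <- LL | r' != r) (all (mem F) (lvs r) && all (mem F) (lvs r'))%:R) <= _); last first.
  apply: expect_le => // F FS; rewrite mulN1r; exact: bonferroni.
rewrite expectD expectZ mulN1r; apply: lerB.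
  rewrite expect_sum big_seq (eq_bigr (fun r => p ^+ size (lvs r))) => [|r /lP[ul ls]]; last first.
    by rewrite expect_contains.
  rewrite -big_seq big_filter.
  have := sum_clean_ge (M := (d.+1 + N)%N) p0 (N := N) i0 q0 _ (eqxx _); rewrite card_ord /= mul1r.
  by apply=> //; rewrite (eqP ff).
rewrite expect_sum.
apply: le_trans (_ : \sum_(r <- LL) \sum_(r' <- LL) p ^+ 2 * ((n%:R^-1) ^+ #|usd r :\: f| * (n%:R^-1) ^+ #|usd r' :\: usd r|) <= _).
  rewrite big_seq [leRHS]big_seq; apply: ler_sum => r rL.
  rewrite expect_sum big_seq_cond big_mkcond [leRHS]big_seq big_mkcond [leRHS]big_mkcond /=.
  apply: ler_sum => r' _; case: (boolP (r' \in LL)) => //= r'L.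
  have [rr o] := LLP _ rL; have [rr' o'] := LLP _ r'L.
  case: ifP => ne; last by rewrite !mulr_ge0 ?exprn_ge0 ?invr_ge0.
  have [ul ls] := lP _ rL; have [ul' ls'] := lP _ r'L.
  have -> : expect (fun F => (all (mem F) (lvs r) && all (mem F) (lvs r'))%:R) =
      p ^+ size (undup (lvs r ++ lvs r')).
    rewrite -(@expect_contains R n d p) ?undup_uniq //; last first.
      by move=> z; rewrite mem_undup mem_cat => /orP[/ls|/ls'].
    apply: eq_bigr => F _; congr (_ * _%:R); rewrite -all_cat; congr nat_of_bool.
    by apply: eq_all_r => z; rewrite mem_undup.
  have rne : r != r' by rewrite eq_sym ne.
  have := clean_pair d2 ff rr rr' o o' rne; set s := size _ => les.
  apply: le_trans (_ : p ^+ (d * (#|usd r :|: usd r'| - d.+1) + 2) <= _).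
    by rewrite ler_wiXn2l.
  have [_ _ _ _ [fr _]] := clean_run i0 rr o; have /= fr' := fr.
  have -> : (#|usd r :|: usd r'| - d.+1 = #|usd r :\: f| + #|usd r' :\: usd r|)%N.
    have -> : usd r :|: usd r' = usd r :|: (usd r' :\: usd r) by rewrite setDE setUIr setUCr setIT.
    rewrite cardsU [_ :&: _](_ : _ = set0) ?cards0 ?subn0; last first.
      by apply/setP => z; rewrite !inE; case: (z \in usd r).
    rewrite -(cardsID f (usd r)) (setIidPr fr') (eqP ff) -addnA addKn //.
  rewrite addnC exprD exprM -exprD ler_wpM2l ?exprn_ge0 //.
  by rewrite lerXn2r // ?nnegrE ?exprn_ge0 // invr_ge0.
rewrite (eq_bigr (fun r => p ^+ 2 * (n%:R^-1 ^+ #|usd r :\: f| * \sum_(r' <- LL) n%:R^-1 ^+ #|usd r' :\: usd r|))) => [|r _]; last first.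
  by rewrite -!mulr_sumr.
rewrite -mulr_sumr ler_wpM2l ?exprn_ge0 //.
set K : R := (d.+1 + N + 2)%:R.
have K0 : 0 <= K by [].
apply: le_trans (_ : \sum_(r <- LL) n%:R^-1 ^+ #|usd r :\: f| * K ^+ N <= _).
  rewrite big_seq [leRHS]big_seq; apply: ler_sum => r /LLP[rr o].
  rewrite ler_wpM2l ?exprn_ge0 ?invr_ge0 // big_filter.
  have := sum_clean_new R (usd r) N i0 T0; rewrite card_ord /= => le; apply: le_trans le _.
  have [_ _ _ _ [fr _]] := clean_run i0 rr o.
  have -> : f :\: usd r = set0 by apply/eqP; rewrite setD_eq0.
  rewrite cards0 mul1r lerXn2r // ?nnegrE // -?(natrD R 2) // ler_nat addnC leq_add2r.
  by have := card_usd_runs rr; rewrite /= (eqP ff).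
rewrite -mulr_suml exprD ler_wpM2r ?exprn_ge0 // big_filter.
have := sum_clean_new R f N i0 T0; rewrite card_ord /= => le; apply: le_trans le _.
rewrite setDv cards0 mul1r lerXn2r // ?nnegrE // -?(natrD R 2) // ler_nat addnC leq_add2r (eqP ff).
exact: leq_addr.
Qed.

End DenseLower.

(** * The second moment of the fraction of short derivations *)

Section SecondMoment.
Variables (R : realFieldType) (n d : nat) (p : R).
Hypotheses (p0 : 0 <= p) (p1 : p <= 1) (n0 : (0 < n)%N).
Implicit Types (F : {set {set 'I_n}}) (f g : {set 'I_n}).

Local Notation expect := (@expect R n d p).
Local Notation S := (simplices n d).

Definition short_fraction L F : R :=
  #|[set f in S | reach L [:: f] F]|%:R / #|S|%:R.

Lemma short_fractionE L F : short_fraction L F = #|S|%:R^-1 * \sum_(f in S) (reach L [:: f] F)%:R.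
Proof.
rewrite /short_fraction mulrC; congr (_ * _).
rewrite -sum1_card natr_sum big_mkcond [RHS]big_mkcond; apply: eq_bigr => f _.
by rewrite !inE; case: (_ == _) => //=; case: (reach _ _ _).
Qed.

Lemma card_simplices : #|S| = 'C(n, d.+1).
Proof. by rewrite -[X in 'C(X, _)](card_ord n) -card_draws. Qed.

(** Pairs of faces that meet are rare enough to forgo any decorrelation for them. *)
Lemma card_touching f : f \in S ->
  (n * #|[set g in S | ~~ [disjoint f & g]]| <= d.+1 ^ 2 * #|S|)%N.
Proof.
move=> fS; have cf : #|f| = d.+1 by move: fS; rewrite inE => /eqP.
have le : (#|[set g in S | ~~ [disjoint f & g]]| <= \sum_(v in f) #|[set g in S | v \in g]|)%N.
  rewrite -sum1_card.
  apply: leq_trans (_ : \sum_(g in S) \sum_(v in f) (v \in g) <= _)%N.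
    rewrite [leqLHS]big_mkcond [leqRHS]big_mkcond; apply: leq_sum => g _; rewrite !inE.
    case: (_ == _) => //=; case: ifP => // /pred0Pn[v /= /andP[vf vg]].
    by rewrite (bigD1 v) //= vg leq_addr.
  rewrite exchange_big /=; apply: leq_sum => v _; rewrite -sum1_card big_mkcond [leqRHS]big_mkcond.
  by apply: leq_sum => g _; rewrite !inE; case: (_ == _) => //=; case: (v \in g).
apply: leq_trans (_ : n * (d.+1 * 'C(n.-1, d)) <= _)%N.
  rewrite leq_mul2l; apply/orP; right; apply: leq_trans le _; rewrite -[X in (X * _)%N]cf.
  rewrite -sum_nat_const; apply: leq_sum => v _.
  have -> : n.-1 = #|~: [set v]| by rewrite cardsC1 card_ord.
  rewrite -cards_draws -(@card_in_imset _ _ (fun g : {set 'I_n} => g :\ v) [set g in S | v \in g]).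
    apply: subset_leq_card; apply/subsetP => _ /imsetP[g + ->]; rewrite !inE => /andP[/eqP cg vg].
    rewrite -eqSS -cg (cardsD1 v g) vg eqxx andbT; apply/subsetP => z; rewrite !inE; by case/andP.
  move=> g g'; rewrite !inE => /andP[_ vg] /andP[_ vg'] e; by rewrite -(setD1K vg) e setD1K.
by rewrite mulnCA mul_bin_diag card_simplices mulnA.
Qed.

Lemma expect_square_le L (a c u1 u2 l : R) : (0 < #|S|)%N -> 0 <= a -> 0 <= c -> 0 <= u2 ->
  (forall f, f \in S -> expect (fun F => (reach L [:: f] F)%:R) <= u1) ->
  (forall f g, f \in S -> g \in S -> [disjoint f & g] ->
    expect (fun F => (reach L [:: f] F && reach L [:: g] F)%:R) <= u2) ->
  (forall f, f \in S -> l <= expect (fun F => (reach L [:: f] F)%:R)) ->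
  expect (fun F => (a * short_fraction L F - c) ^+ 2) <=
    a ^+ 2 * (u2 + u1 * ((d.+1 ^ 2)%:R / n%:R)) - 2 * (c * (a * l)) + c ^+ 2.
Proof.
move=> S0 a0 c0 u20 h1 h2 hl; set N := #|S|.
have N0 : 0 < N%:R :> R by rewrite ltr0n.
have nn0 : 0 < n%:R :> R by rewrite ltr0n.
have u10 : 0 <= u1.
  move: S0; rewrite card_gt0 => /set0Pn[f fS]; apply: le_trans (h1 f fS).
  rewrite -[leLHS](mulr0 (0 : R)) -(@expect_cst R n d p (0 * 0)) //; apply: expect_le => // F _.
  by rewrite mulr0.
have -> : expect (fun F => (a * short_fraction L F - c) ^+ 2) =
   a ^+ 2 * expect (fun F => short_fraction L F ^+ 2) - 2 * (c * (a * expect (short_fraction L))) + c ^+ 2.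
  transitivity (expect (fun F => a ^+ 2 * short_fraction L F ^+ 2 +
      (- (2 * c * a) * short_fraction L F + c ^+ 2))).
    by apply: eq_bigr => F _; congr (_ * _); ring.
  by rewrite expectD expectZ expectD expectZ expect_cst //; ring.
have e1 : l <= expect (short_fraction L).
  rewrite (_ : expect (short_fraction L) = N%:R^-1 * \sum_(f in S) expect (fun F => (reach L [:: f] F)%:R)).
    rewrite ler_pdivlMl // mulr_natl -sumr_const; apply: ler_sum => f fS; exact: hl.
  by rewrite -expect_sum -expectZ; apply: eq_bigr => F _; rewrite short_fractionE.
have e2 : expect (fun F => short_fraction L F ^+ 2) <= u2 + u1 * ((d.+1 ^ 2)%:R / n%:R).
  rewrite (_ : expect _ = N%:R^-1 ^+ 2 * \sum_(f in S) \sum_(g in S)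
      expect (fun F => (reach L [:: f] F && reach L [:: g] F)%:R)); last first.
    under eq_bigr => f _ do rewrite -expect_sum.
    rewrite -expect_sum -expectZ; apply: eq_bigr => F _; rewrite short_fractionE exprMn.
    congr (_ * (_ * _)); rewrite expr2 mulr_suml; apply: eq_bigr => f _.
    by rewrite mulr_sumr; apply: eq_bigr => g _; rewrite -natrM mulnb.
  rewrite exprVn ler_pdivrMl ?exprn_gt0 //.
  apply: le_trans (_ : \sum_(f in S) (N%:R * (u2 + u1 * ((d.+1 ^ 2)%:R / n%:R))) <= _); last first.
    by rewrite sumr_const -[leLHS]mulr_natl mulrA expr2.
  apply: ler_sum => f fS.
  rewrite (bigID (fun g => [disjoint f & g])) /= mulrDr; apply: lerD.
    apply: le_trans (_ : \sum_(g in S) u2 <= _); last by rewrite sumr_const mulr_natl.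
    rewrite big_mkcond [leRHS]big_mkcond; apply: ler_sum => g _; case: (boolP (g \in S)) => //= gS.
    case: ifP => // dis; exact: h2.
  apply: le_trans (_ : \sum_(g in [set g in S | ~~ [disjoint f & g]]) u1 <= _).
    rewrite [leRHS](eq_bigl (fun g => (g \in S) && ~~ [disjoint f & g])) => [|g]; last by rewrite !inE.
    apply: ler_sum => g /andP[gS _]; apply: le_trans (h1 f fS).
    by apply: expect_le => // F _; case: (reach L [:: f] F) => //=; rewrite lern1 leq_b1.
  rewrite sumr_const -(mulr_natl u1) mulrCA [leLHS]mulrC; apply: ler_wpM2l => //.
  rewrite mulrA ler_pdivlMr // -!natrM ler_nat mulnC [leqRHS]mulnC; exact: card_touching.
have : 0 <= c * a by rewrite mulr_ge0.
have : 0 <= a ^+ 2 by rewrite exprn_ge0.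
move: e1 e2; move: (expect _) (expect _) (_ + _ * (_ / _)) => x y z e1 e2 A1 A2.
have : a ^+ 2 * x <= a ^+ 2 * z by rewrite ler_wpM2l.
have : c * a * l <= c * a * y by rewrite ler_wpM2l.
rewrite !mulrA; lra.
Qed.

End SecondMoment.

(** * Deviations for a given number of vertices *)

Section FiniteBound.
Variables (R : realType) (n d : nat) (p : R).
Hypotheses (d2 : (2 <= d)%N) (p0 : 0 <= p) (p1 : p <= 1) (n0 : (0 < n)%N).
Implicit Types (F : {set {set 'I_n}}) (f g : {set 'I_n}).

Local Notation expect := (@expect R n d p).
Local Notation S := (simplices n d).

(** Some face needs a derivation whose length is in the window of [no_jump]. *)
Definition jump L F : bool :=
  [exists f in S, reach (d.+1 * L).+1 [:: f] F && ~~ reach L [:: f] F].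

Lemma contracted_fractionE L F : F \subset S -> ~~ jump L F ->
  contracted_fraction R d (lm_complex d F) = short_fraction R d L F.
Proof.
move=> FS nj; rewrite /contracted_fraction /short_fraction; congr (_%:R / _).
apply: eq_card => f; rewrite !inE; case: (boolP (#|f| == d.+1)) => //= /eqP cf.
have fS : f \in S by rewrite inE cf.
apply/asboolP/idP => [sc|/reachP[D [_ dD fD]]]; last first.
  by apply: (derivable_stacked_contraction FS cf); exists D => //; apply: fD; rewrite mem_head.
have der := stacked_contraction_derivable d2 FS sc.
apply: (@no_jump n d F L _ f fS der) => g gS rg; apply: contraNT nj => nrg; apply/existsP; exists g; by rewrite gS rg.
Qed.

(** Without dense sets and jumps the fraction is [short_fraction], to which Chebyshev's
    inequality is applied. *)
Lemma lm_prob_le L M E (a c eps : R) : 0 < eps ->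
  lm_prob d p [pred Y : {set {set 'I_n}} | eps < `|a * contracted_fraction R d Y - c|] <=
    expect (fun F => (dense d M E F)%:R) +
    \sum_(f in S) expect (fun F =>
      [&& reach (d.+1 * L).+1 [:: f] F, ~~ reach L [:: f] F & ~~ dense d M E F]%:R) +
    eps ^- 2 * expect (fun F => (a * short_fraction R d L F - c) ^+ 2).
Proof.
move=> e0; rewrite -expect_sum -expectZ -!expectD.
rewrite /lm_prob big_mkcondr /=; apply: ler_sum => F; rewrite powersetE => FS.
have -> : (if [pred Y : {set {set 'I_n}} | eps < `|a * contracted_fraction R d Y - c|] (lm_complex d F)
     then \prod_(f in S) (if f \in F then p else 1 - p) else 0) =
    mass d p F * (if eps < `|a * contracted_fraction R d (lm_complex d F) - c| then 1 else 0).
  by rewrite /=; case: ifP; rewrite ?mulr1 ?mulr0.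
rewrite ler_wpM2l ?mass_ge0 //.
have sq : 0 <= eps ^- 2 * (a * short_fraction R d L F - c) ^+ 2.
  by rewrite mulr_ge0 ?sqr_ge0 // invr_ge0 exprn_ge0 // ltW.
have sm : 0 <= \sum_(f in S) ([&& reach (d.+1 * L).+1 [:: f] F, ~~ reach L [:: f] F & ~~ dense d M E F]%:R : R).
  by apply: sumr_ge0.
have b1 (b : bool) : b%:R <= 1 :> R by case: b.
have [dF|dF] := boolP (dense d M E F).
  apply: le_trans (_ : 1 <= _); first by case: ifP.
  by rewrite -addrA lerDl addr_ge0 //; move: sm; rewrite dF.
have [/existsP[f /and3P[fS r1 r2]]|nj] := boolP (jump L F).
  apply: le_trans (_ : 1 <= _); first by case: ifP.
  rewrite add0r -[leLHS]addr0 lerD //.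
  rewrite (bigD1 f) //= r1 r2 lerDl; exact: sumr_ge0.
rewrite (contracted_fractionE FS nj).
rewrite add0r -[leLHS]add0r lerD //; first by move: sm; rewrite (negPf dF).
case: ltP => [lt|_]; last exact: sq.
rewrite mulrC ler_pdivlMr ?exprn_gt0 // mul1r -[leRHS]real_normK ?num_real //.
by apply: lerXn2r; rewrite ?nnegrE ?normr_ge0 //; exact: ltW.
Qed.

(** The summands stand for dense sets, for jumps, and for the second moment around [c],
    where the mean enters through the clean runs of [N] steps. *)
Lemma finite_bound (yl ym yo W q a c eps : R) (L M E m N : nat) :
  let theta := n%:R * p ^+ d / (yl ^+ d * ym) in
  let Psi := excess_bound d (2 ^ (d.+1 + d.+1)) (d * (d.+1 + d.+1) + E) in
  let X := (M%:R / yo) ^+ Psi in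
  let Dn := M.+1%:R * ((M ^ d.+1) ^ (d * M + E))%:R * p ^+ E in
  0 < yl -> 0 < ym -> 0 < yo -> yl + ym + yo <= 1 -> p <= yl -> yo <= M%:R -> theta <= 1 ->
  p ^+ d <= n%:R^-1 -> 0 <= W -> p + n%:R * W ^+ d.+1 <= W ->
  (d.+1 + d.+1 + (L + L) <= M)%N -> (d.+1 + (d.+1 * L).+1 <= M)%N ->
  (1 + d.+1 * m + (d * (d.+1 + d.+1) + E) + Psi <= L)%N ->
  (1 + d.+1 * N <= L)%N -> 0 <= q -> q <= n%:R - (d.+1 + N)%:R ->
  (d < n)%N -> 0 < eps -> 0 <= a -> 0 <= c ->
  lm_prob d p [pred Y : {set {set 'I_n}} | eps < `|a * contracted_fraction R d Y - c|] <=
    Dn + ('C(n, d.+1))%:R * (theta ^+ m * X) +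
    eps ^- 2 * (a ^+ 2 * (W ^+ 2 + (p / yl) ^+ 3 * X + Dn +
        (W + (p / yl) ^+ 2 * X + Dn) * ((d.+1 ^ 2)%:R / n%:R)) -
      2 * (c * (a * (clean_weight d p q N 1 - p ^+ 2 * (d.+1 + N + 2)%:R ^+ (N + N)))) + c ^+ 2).
Proof.
move=> theta Psi X Dn l0 m0 o0 y1 pl oM th1 pd W0 HW M1 M2 Lm LN q0 Hq dn e0 a0 c0.
have M0 : (0 < M)%N by apply: leq_trans M2.
have r1 : 1 <= M%:R / yo by rewrite ler_pdivlMr // mul1r.
have pl0 : 0 <= p / yl by rewrite divr_ge0 // ltW.
have th0 : 0 <= theta by apply: divr_ge0; apply: mulr_ge0; rewrite ?exprn_ge0 // ltW.
have X0 : 0 <= X by rewrite exprn_ge0 // (le_trans _ r1).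
have Dn0 : 0 <= Dn by rewrite !mulr_ge0 ?exprn_ge0.
have Dle := expect_dense_le p0 p1 n0 pd E M0; rewrite -/Dn in Dle.
have S0 : (0 < #|S|)%N by rewrite card_simplices // bin_gt0.
have mono1 f : is_face d f -> (excess_bound d (2 ^ (d.+1 + d.+1)) (d * #|f| + E) <= Psi)%N.
  move=> /eqP ->; have ab : (d * d.+1 + E <= d * (d.+1 + d.+1) + E)%N.
    by rewrite leq_add2r leq_mul2l leq_addr orbT.
  rewrite /Psi -(subnKC ab); apply: leq_trans (excess_bound_add d2 _ _ _); exact: leq_addr.
have faceS f : f \in S -> is_face d f by rewrite inE.
have split_dense (P : {set {set 'I_n}} -> bool) u :
    expect (fun F => (P F && ~~ dense d M E F)%:R) <= u -> expect (fun F => (P F)%:R) <= u + Dn.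
  move=> le; apply: le_trans (_ : expect (fun F => (P F && ~~ dense d M E F)%:R + (dense d M E F)%:R) <= _).
    by apply: expect_le => // F _; case: (P F) => //=; case: (dense _ _ _ _); rewrite ?add0r ?addr0.
  by rewrite expectD lerD.
apply: le_trans (lm_prob_le L M E a c e0) _; apply: lerD; first apply: lerD => //.
  apply: le_trans (_ : \sum_(f in S) theta ^+ m * X <= _); last first.
    by rewrite sumr_const card_simplices // mulr_natl.
  apply: ler_sum => f fS; have ff := faceS f fS.
  have := @expect_jump_le R n d p d2 p0 p1 yl ym yo M E (2 ^ (d.+1 + d.+1)) (d.+1 * L).+1 [:: f] f
    l0 m0 o0 y1 _ pl oM n0 _ _ _ (base_ok_single _ ff) th1 L m.
  rewrite (eqP ff) => H; apply: le_trans (H _ _ _ _ _) _ => //=; rewrite ?ff ?subxx //.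
    apply: leq_trans Lm; apply: leq_add; last by have := mono1 f ff; rewrite (eqP ff).
    by rewrite leq_add2l leq_add2r leq_mul2l leq_addr orbT.
  rewrite ler_wpM2l ?exprn_ge0 // ler_weXn2l //; by have := mono1 f ff; rewrite (eqP ff).
apply: ler_wpM2l; first by rewrite invr_ge0 exprn_ge0 // ltW.
have Psi_le k : (k <= Psi)%N -> (M%:R / yo) ^+ k <= X by move=> kk; rewrite ler_weXn2l.
apply: expect_square_le => //.
- by apply: addr_ge0 => //; apply: addr_ge0; [exact: exprn_ge0|apply: mulr_ge0 => //; exact: exprn_ge0].
- move=> f fS; have ff := faceS f fS; apply: split_dense.
  have := @expect_reach_le R n d p d2 p0 p1 yl ym yo M E (2 ^ (d.+1 + d.+1)) L [:: f] f
    l0 m0 o0 y1 _ pl oM n0 _ _ _ (base_ok_single _ ff) th1 W W0 HW.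
  rewrite (eqP ff) => H; apply: le_trans (H _ _ _ _) _ => //=; rewrite ?ff ?subxx //.
    apply: leq_trans M2; rewrite leq_add2l; apply: leq_trans (leqnSn _); exact: leq_pmull.
  rewrite lerD2l ler_wpM2l ?exprn_ge0 // Psi_le //; by have := mono1 f ff; rewrite (eqP ff).
- move=> f g fS gS dis; have ff := faceS f fS; have fg := faceS g gS; apply: split_dense.
  have cU : #|f :|: g| = (d.+1 + d.+1)%N.
    by rewrite cardsU (disjoint_setI0 dis) cards0 subn0 (eqP ff) (eqP fg).
  have := @expect_reach_le R n d p d2 p0 p1 yl ym yo M E (2 ^ (d.+1 + d.+1)) (L + L) [:: f; g] (f :|: g)
    l0 m0 o0 y1 _ pl oM n0 _ _ _ (base_ok_pair d2 ff fg dis) th1 W W0 HW.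
  rewrite cU -/Psi -/X => H; apply: le_trans (H _ _ _ _); rewrite //= ?ff ?fg ?subsetUl ?subsetUr //.
    apply: expect_le => // F _; rewrite ler_nat; case: andP => //= -[/andP[r1' r2'] nd].
    by rewrite nd andbT lt0b; exact: reach_cat r1' r2'.
  rewrite inE andbT; apply: contraTneq dis => ->; rewrite -setI_eq0 setIid -card_gt0 (eqP fg) //.
- move=> f fS; have ff := faceS f fS; exact: expect_reach_ge.
Qed.

End FiniteBound.

From mathcomp Require Import all_classical all_reals all_analysis.
Import numFieldNormedType.Exports.

(** * The error terms after rescaling *)

Section RealBounds.
Variable R : realFieldType.

Lemma half_expn_cvg (e : R) : 0 < e -> (exists k : nat, e^-1 <= k%:R) -> exists b0, forall b, (b0 <= b)%N -> 2 ^- b <= e.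
Proof.
move=> e0 [k kP]; exists k => b kb; rewrite -[e]invrK lef_pV2 ?posrE ?invr_gt0 ?exprn_gt0 //.
apply: le_trans kP _; rewrite -natrX ler_nat; apply: leq_trans kb _; exact: ltnW (ltn_expl _ _).
Qed.

(** The three terms of order one, [gh ^+ 2] from the second moment, [gh ^+ 2] from the
    constant and [- 2 * gh * cwN] from the mean, cancel up to [2 * gh * delta]; all the
    others are of order [z]. *)
Lemma scaled_terms (d N0 M0 : nat) (gamma gh nu yl X Dn z KK cw cwN delta ninv : R) :
  (2 <= d)%N -> 0 < nu -> nu <= 1 -> nu ^+ d = ninv -> 0 <= ninv ->
  0 <= gamma -> 0 <= gh -> 0 < yl -> 0 <= X -> 0 <= Dn -> 0 <= z -> 0 <= KK ->
  nu * X <= z -> nu <= z -> ninv <= z -> Dn <= z * ninv ->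
  0 <= cwN -> gh - delta <= cwN -> cwN <= gh ->
  (1 - (N0 * M0)%:R * ninv) * cwN <= cw ->
  nu^-1 ^+ 2 * ((gh * nu) ^+ 2 + (gamma * nu / yl) ^+ 3 * X + Dn +
      (gh * nu + (gamma * nu / yl) ^+ 2 * X + Dn) * ((d.+1 ^ 2)%:R * ninv)) -
    2 * (gh * (nu^-1 * (nu * cw - (gamma * nu) ^+ 2 * KK))) + gh ^+ 2 <=
  2 * gh * delta + z * ((gamma / yl) ^+ 3 + 1 +
     (gh + (gamma / yl) ^+ 2 + 1) * (d.+1 ^ 2)%:R +
     2 * gh * (gh * (N0 * M0)%:R + gamma ^+ 2 * KK)).
Proof.
move=> d2 nu0 nu1 nud ni0 g0 gh0 l0 X0 D0 z0 K0 nX nz nz' Dz c0 cN cN' cwP.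
have nn : nu != 0 by rewrite gt_eqF.
have ln : yl != 0 by rewrite gt_eqF.
set G := gamma / yl; have G0 : 0 <= G by rewrite divr_ge0 // ltW.
have GE : gamma * nu / yl = G * nu by rewrite /G; ring.
rewrite GE.
have n2 : ninv <= nu ^+ 2.
  by rewrite -nud -(subnKC d2) exprD ler_piMr ?exprn_ge0 ?exprn_ile1 // ltW.
have t1 : nu^-1 ^+ 2 * (gh * nu) ^+ 2 = gh ^+ 2 by field.
have t2 : nu^-1 ^+ 2 * ((G * nu) ^+ 3 * X) = G ^+ 3 * (nu * X) by field.
have a2 : nu^-1 ^+ 2 * ninv <= 1.
  by rewrite exprVn ler_pdivrMl ?exprn_gt0 // mulr1.
have a20 : 0 <= nu^-1 ^+ 2 by rewrite exprn_ge0 // invr_ge0 ltW.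
have t3 : nu^-1 ^+ 2 * Dn <= z.
  apply: le_trans (_ : nu^-1 ^+ 2 * (z * ninv) <= _); first by rewrite ler_wpM2l.
  by rewrite mulrCA -[leRHS]mulr1 ler_wpM2l.
have t4 : nu^-1 ^+ 2 * ((gh * nu + (G * nu) ^+ 2 * X + Dn) * ((d.+1 ^ 2)%:R * ninv)) <=
    z * ((gh + G ^+ 2 + 1) * (d.+1 ^ 2)%:R).
  apply: le_trans (_ : (gh * nu + (G * nu) ^+ 2 * X + Dn) * (d.+1 ^ 2)%:R <= _).
    rewrite (_ : nu^-1 ^+ 2 * _ = (nu^-1 ^+ 2 * ninv) * ((gh * nu + (G * nu) ^+ 2 * X + Dn) * (d.+1 ^ 2)%:R)); last by ring.
    by rewrite ler_piMl // mulr_ge0 // addr_ge0 // addr_ge0 // mulr_ge0 ?exprn_ge0 ?(mulr_ge0 G0) //; exact: ltW.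
  rewrite mulrA; apply: ler_wpM2r => //; rewrite 2!mulrDr mulr1; apply: lerD; first apply: lerD.
  - by rewrite mulrC ler_wpM2r.
  - rewrite exprMn -mulrA [leRHS]mulrC; apply: ler_wpM2l; first exact: exprn_ge0.
    by apply: le_trans nX; rewrite expr2 -mulrA ler_piMl // mulr_ge0 //; exact: ltW.
  - apply: le_trans Dz _; rewrite -[leRHS]mulr1 ler_wpM2l // (le_trans n2) // exprn_ile1 //; exact: ltW.
have t5 : nu^-1 * (nu * cw - (gamma * nu) ^+ 2 * KK) = cw - gamma ^+ 2 * KK * nu by field.
have t6 : gh - delta - gh * (N0 * M0)%:R * z <= cw.
  apply: le_trans cwP; rewrite mulrBl mul1r; apply: lerB => //.
  rewrite [leLHS]mulrC mulrA; apply: ler_pM => //; first by rewrite mulr_ge0.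
  by rewrite ler_wpM2r.
have t7 : gamma ^+ 2 * KK * nu <= gamma ^+ 2 * KK * z by rewrite ler_wpM2l // mulr_ge0 ?exprn_ge0.
have t8 : gh * (gh - delta - gh * (N0 * M0)%:R * z - gamma ^+ 2 * KK * z) <= gh * (cw - gamma ^+ 2 * KK * nu).
  by rewrite ler_wpM2l //; lra.
have t9 : G ^+ 3 * (nu * X) <= G ^+ 3 * z by rewrite ler_wpM2l ?exprn_ge0.
rewrite t5 !mulrDr t1 t2; move: t3 t4 t8 t9; rewrite !mulrDr; lra.
Qed.

End RealBounds.

(** * The smallest root as a limit of depth-bounded densities *)

Section Root.
Variables (R : realType) (d : nat) (gamma : R).
Hypotheses (d1 : (0 < d)%N) (g0 : 0 <= gamma).

Fixpoint depth_density t : R :=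
  if t is t'.+1 then gamma + depth_density t' ^+ d.+1 else 0.

Lemma depth_density_ge0 t : 0 <= depth_density t.
Proof. by case: t => [|t] //=; elim: t => [|t IH]; rewrite addr_ge0 ?exprn_ge0. Qed.

Lemma depth_density_le y t : 0 <= y -> gamma + y ^+ d.+1 <= y -> depth_density t <= y.
Proof.
move=> y0 yy; elim: t => [//|t IH] /=; apply: le_trans yy; rewrite lerD2l.
by apply: lerXn2r; rewrite ?nnegrE ?depth_density_ge0.
Qed.

Lemma depth_densityS t : depth_density t <= depth_density t.+1.
Proof.
elim: t => [|t IH]; first exact: depth_density_ge0.
rewrite -[leLHS]/(gamma + depth_density t ^+ d.+1) -[leRHS]/(gamma + depth_density t.+1 ^+ d.+1).
by rewrite lerD2l; apply: lerXn2r; rewrite ?nnegrE ?depth_density_ge0.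
Qed.

(** The witness is the double root at the threshold, where [y ^+ d = d.+1%:R^-1]. *)
Lemma super_root : gamma ^+ d * alpha R d <= 1 ->
  exists2 y : R, 0 <= y & gamma + y ^+ d.+1 <= y.
Proof.
move=> h; have dn : d%:R != 0 :> R by rewrite pnatr_eq0 -lt0n.
have dp : 0 < d%:R :> R by rewrite ltr0n.
exists (gamma * d.+1%:R / d%:R); first by rewrite divr_ge0 ?mulr_ge0.
have -> : (gamma * d.+1%:R / d%:R) ^+ d.+1 = gamma / d%:R * (gamma ^+ d * alpha R d).
  rewrite /alpha !exprMn exprVn ![_ ^+ d.+1]exprS invfM; field.
  by rewrite dn expf_neq0.
apply: le_trans (_ : gamma + gamma / d%:R * 1 <= _).
  by rewrite lerD2l ler_wpM2l // divr_ge0.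
rewrite mulr1 -(natr1 d) mulrDr mulr1 mulrDl mulfK // lexx.
Qed.

(** The densities increase and stay below every nonnegative root, so their limit, which
    is a root by continuity, is the smallest one. *)
Lemma smallest_root : gamma ^+ d * alpha R d <= 1 ->
  exists gh : R, [/\ smallest_nonneg_root (Qpoly d gamma) gh, gamma + gh ^+ d.+1 = gh &
    forall delta : R, 0 < delta -> exists t, gh - delta <= depth_density t].
Proof.
move=> h; have [y y0 yy] := super_root h.
have nd : nondecreasing_seq depth_density by apply/nondecreasing_seqP => t; exact: depth_densityS.
have cv : cvgn depth_density.
  apply: nondecreasing_is_cvgn => //; exists y => _ [t _ <-]; exact: depth_density_le.
pose gh := limn depth_density.
have cgh : (depth_density @ \oo --> gh)%classic by exact: cv.
have ub t : depth_density t <= gh by exact: nondecreasing_cvgn_le.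
have e : gamma + gh ^+ d.+1 = gh.
  have c1 : ((fun t => depth_density t.+1) @ \oo --> gh)%classic by have := cgh; rewrite -(cvg_shiftS depth_density).
  have c2 : ((fun t => depth_density t.+1) @ \oo --> gamma + gh ^+ d.+1)%classic.
    apply: cvgD; first exact: cvg_cst.
    exact: (cvg_comp _ _ cgh (@exprn_continuous R d.+1 gh)).
  exact: (cvg_unique _ c2 c1).
have rootE z : root (Qpoly d gamma) z = (z ^+ d.+1 - z + gamma == 0).
  by rewrite /root /Qpoly !hornerE.
exists gh; split=> //.
  split.
  - exact: (le_trans (depth_density_ge0 0)).
  - by rewrite rootE -{2}e; apply/eqP; ring.
  - move=> z z0; rewrite rootE => /eqP rz.
    have zz : gamma + z ^+ d.+1 <= z by lra.
    apply: limr_le => //; apply: nearW => t; exact: depth_density_le.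
move=> delta d0; have [t] : exists t, gh - delta < depth_density t.
  move/cvgrPdist_lt: cgh => /(_ _ d0) [t _ /(_ t (leqnn t)) /=].
  by rewrite ger0_norm ?subr_ge0 // => lt; exists t; lra.
by move=> /ltW; exists t.
Qed.

(** [gh ^+ k] solves the recursion of [clean_weight], because [gh] is a root. *)
Lemma clean_weight_le gh q N k : 0 <= q -> q <= 1 -> gamma + gh ^+ d.+1 = gh -> 0 <= gh ->
  clean_weight d gamma q N k <= gh ^+ k.
Proof.
move=> q0 q1 e gh0; elim: N k => [|N IH] [|k] //=; first by rewrite exprn_ge0.
rewrite exprS -{1}e mulrDl -exprD; apply: lerD; first by rewrite ler_wpM2l.
apply: le_trans (_ : 1 * clean_weight d gamma q N (d.+1 + k) <= _); last by rewrite mul1r.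
by rewrite ler_wpM2r // clean_weight_ge0.
Qed.

Lemma clean_weightE q N k : clean_weight d gamma q N.+1 k.+1 =
  gamma * clean_weight d gamma q N k + q * clean_weight d gamma q N (d.+1 + k).
Proof. by []. Qed.

Lemma clean_weightS N k : clean_weight d gamma 1 N k <= clean_weight d gamma 1 N.+1 k.
Proof.
elim: N k => [|N IH] [|k] //.
  by rewrite [leLHS]/=; apply: clean_weight_ge0.
rewrite !(clean_weightE 1 _ k); apply: lerD; first by rewrite ler_wpM2l.
rewrite !mul1r; exact: IH.
Qed.

Lemma clean_weight_mono N N' k : (N <= N')%N ->
  clean_weight d gamma 1 N k <= clean_weight d gamma 1 N' k.
Proof.
move=> le; rewrite -(subnKC le); elim: (N' - N)%N => [|j IH]; first by rewrite addn0.
by rewrite addnS; apply: le_trans IH _; exact: clean_weightS.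
Qed.

(** Runs from [k] and from [k'] open faces can be carried out one after the other. *)
Lemma clean_weight_mul N N' k k' :
  clean_weight d gamma 1 N k * clean_weight d gamma 1 N' k' <=
    clean_weight d gamma 1 (N + N') (k + k').
Proof.
elim: N k => [|N IH] [|k].
- by rewrite mul1r.
- by rewrite mul0r clean_weight_ge0.
- by rewrite mul1r; apply: clean_weight_mono; exact: leq_addl.
rewrite !addSn !clean_weightE mulrDl; apply: lerD.
  by rewrite -mulrA ler_wpM2l.
by rewrite !mul1r addnA; exact: IH.
Qed.

Lemma clean_weight_pow N k :
  clean_weight d gamma 1 N 1 ^+ k <= clean_weight d gamma 1 (N * k) k.
Proof.
elim: k => [|k IH]; first by rewrite muln0.
rewrite exprS mulnS; apply: le_trans (clean_weight_mul _ _ 1 k).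
by rewrite ler_wpM2l // clean_weight_ge0.
Qed.

(** A derivation tree of depth [t] has boundedly many steps. *)
Lemma clean_weight_depth t : exists N, depth_density t <= clean_weight d gamma 1 N 1.
Proof.
elim: t => [|t [N IH]]; first by exists 0%N.
exists (N * d.+1).+1; rewrite clean_weightE addn0 mul1r [clean_weight _ _ _ _ 0](_ : _ = 1); last by case: (N * _)%N.
rewrite mulr1 -[leLHS]/(gamma + depth_density t ^+ d.+1) lerD2l.
apply: le_trans (clean_weight_pow N d.+1); apply: lerXn2r => //; rewrite nnegrE ?depth_density_ge0 //.
exact: clean_weight_ge0.
Qed.

Lemma clean_weight_scale (nu q : R) N k :
  clean_weight d (gamma * nu) q N k = nu ^+ k * clean_weight d gamma (q * nu ^+ d) N k.
Proof.
elim: N k => [|N IH] [|k] /=; rewrite ?mulr0 ?mulr1 //.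
rewrite !IH exprD !exprS; ring.
Qed.

(** A run of [N] steps has at most [N] expansions, each of which loses a factor [q]. *)
Lemma clean_weight_lower q N k : 0 <= q -> q <= 1 ->
  q ^+ N * clean_weight d gamma 1 N k <= clean_weight d gamma q N k.
Proof.
move=> q0 q1; elim: N k => [|N IH] [|k] /=; rewrite ?mulr0 ?mulr1 ?expr0 ?exprn_ile1 //.
rewrite mul1r mulrDr; apply: lerD.
  rewrite mulrCA ler_wpM2l //; apply: le_trans (IH k).
  by rewrite exprS -mulrA ler_piMl ?mulr_ge0 ?exprn_ge0 ?clean_weight_ge0.
by rewrite exprS -mulrA ler_wpM2l.
Qed.

End Root.

(** * Subcritical weights and the scale *)

Lemma bernoulli (R : realDomainType) (x : R) k : 0 <= x -> x <= 1 -> 1 - k%:R * x <= (1 - x) ^+ k.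
Proof.
move=> x0 x1; elim: k => [|k IH]; first by rewrite mul0r subr0.
have y0 : 0 <= 1 - x by rewrite subr_ge0.
rewrite exprS; apply: le_trans (ler_wpM2l y0 IH).
rewrite -(natr1 k) -subr_ge0 (_ : _ - _ = k%:R * x ^+ 2); last by ring.
by rewrite mulr_ge0 ?exprn_ge0.
Qed.

(** On [yl + ym = 1] the maximum of [yl ^+ d * ym] is [(alpha R d)^-1], reached for the
    ratio [d] to [1]; below the threshold there is room for some [yo] as well. *)
Lemma stable_weights (R : realType) d (gamma : R) : (0 < d)%N -> 0 <= gamma ->
  gamma ^+ d * alpha R d < 1 ->
  exists yl ym yo : R, [/\ 0 < yl, 0 < ym, 0 < yo /\ yo <= 1, yl + ym + yo = 1 &
    gamma ^+ d < yl ^+ d * ym].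
Proof.
move=> d0 g0; set A := _ * _ => A1.
have dp : 0 < d%:R :> R by rewrite ltr0n.
have sp : 0 < d.+1%:R :> R by rewrite ltr0n.
have al0 : 0 < alpha R d by rewrite divr_gt0 ?exprn_gt0.
have A0 : 0 <= A by rewrite mulr_ge0 ?exprn_ge0 // ltW.
(* Chosen so that [bernoulli] gives [(1 - yo) ^+ d.+1 >= (1 + A) / 2 > A]. *)
pose yo : R := (1 - A) / (2 * d.+1%:R).
have dyo : d.+1%:R * yo = (1 - A) / 2 by rewrite /yo; field; lra.
have yo0 : 0 < yo by rewrite divr_gt0 ?mulr_gt0 // subr_gt0.
have yo1 : yo < 1.
  apply: le_lt_trans (_ : d.+1%:R * yo < _); last by rewrite dyo; lra.
  by rewrite ler_peMl ?ler1n // ltW.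
have o1 : 0 < 1 - yo by rewrite subr_gt0.
exists ((1 - yo) * d%:R / d.+1%:R), ((1 - yo) / d.+1%:R), yo; split.
- by rewrite divr_gt0 ?mulr_gt0.
- by rewrite divr_gt0.
- by split=> //; exact: ltW.
- by rewrite -(natr1 d); field; rewrite natr1 gt_eqF.
have -> : ((1 - yo) * d%:R / d.+1%:R) ^+ d * ((1 - yo) / d.+1%:R) = (1 - yo) ^+ d.+1 / alpha R d.
  rewrite /alpha !exprMn exprVn !exprS; field; rewrite !expf_neq0 ?gt_eqF //.
rewrite ltr_pdivlMr // -/A; apply: lt_le_trans (bernoulli d.+1 (ltW yo0) (ltW yo1)).
by rewrite dyo; lra.
Qed.

Lemma expn_small (R : realType) (t : R) k : 0 <= t -> t < 1 -> exists2 K, (0 < K)%N & t ^+ K <= 2 ^- k.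
Proof.
move=> t0 t1; have e0 : 0 < (2 : R) ^- k by rewrite invr_gt0 exprn_gt0.
have := @cvg_expr R t; rewrite ger0_norm // => /(_ t1) /cvgrPdist_lt /(_ _ e0) [K _ KP].
exists K.+1 => //; have := KP K.+1 (leqnSn K); rewrite /= sub0r normrN ger0_norm ?exprn_ge0 //.
exact: ltW.
Qed.

Lemma real_le_pow2 (R : realType) (x : R) : exists k : nat, x <= 2 ^+ k.
Proof.
exists (Num.truncn x).+1; apply: le_trans (ltW (truncnS_gt x)) _.
by rewrite -natrX ler_nat ltnW // ltn_expl.
Qed.

Section Scale.
Variables (R : realType) (d n : nat).
Hypotheses (d0 : (0 < d)%N) (n0 : (0 < n)%N).

Definition scale : R := n%:R `^ (- (d%:R)^-1).

Lemma scale_gt0 : 0 < scale.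
Proof. by apply: powR_gt0; rewrite ltr0n. Qed.

Lemma scale_exp : scale ^+ d = n%:R^-1.
Proof.
rewrite /scale -powR_mulrn ?powR_ge0 // -powRrM mulNr mulVf ?pnatr_eq0 -?lt0n //.
by rewrite powR_inv1.
Qed.

Lemma scale_inv : n%:R `^ ((d%:R)^-1) = scale^-1 :> R.
Proof. by rewrite /scale powRN invrK. Qed.

End Scale.

Lemma threshold_exp (R : realType) d (gamma : R) : (0 < d)%N -> 0 <= gamma ->
  gamma < alpha R d `^ (- (d%:R)^-1) -> gamma ^+ d * alpha R d < 1.
Proof.
move=> d0 g0 lt; have al0 : 0 < alpha R d by rewrite divr_gt0 ?exprn_gt0 ?ltr0n.
rewrite -ltr_pdivlMr // mul1r -[ltRHS](_ : (alpha R d `^ (- (d%:R)^-1)) ^+ d = _).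
  by rewrite ltrXn2r ?nnegrE // -?lt0n // powR_ge0.
rewrite -powR_mulrn ?powR_ge0 // -powRrM mulNr mulVf ?pnatr_eq0 -?lt0n //.
by rewrite powR_inv1 // ltW.
Qed.

(** * Convergence in probability *)

(** As [n] lies between consecutive powers of two, every estimate becomes a comparison
    of exponents of [2]. *)
Lemma error_terms (R : realFieldType) d n b lam K c M s beta Psi (nu th yo : R) :
  (2 <= d)%N -> (2 ^ lam <= n)%N -> (n < 2 ^ lam.+1)%N ->
  0 < nu -> nu ^+ d = n%:R^-1 -> 0 <= th -> th ^+ K <= 2 ^- (d + 3) ->
  0 < yo -> yo^-1 <= 2 ^+ c -> 1 <= M%:R / yo -> (M <= 2 ^ beta)%N -> (0 < s)%N ->
  (d * ((beta + c) * Psi + b) <= lam)%N ->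
  (lam.+1 * d.+1 + (beta + c) * Psi + b <= lam * (d + 3))%N ->
  (beta.+1 + beta * (d.+1 * (d * M + d * s)) + b <= lam * s.-1)%N ->
  let X := (M%:R / yo) ^+ Psi in
  [/\ nu * X <= 2 ^- b,
      'C(n, d.+1)%:R * (th ^+ (K * lam) * X) <= 2 ^- b &
      forall p, 0 <= p -> p <= nu ->
        M.+1%:R * ((M ^ d.+1) ^ (d * M + d * s))%:R * p ^+ (d * s) <= 2 ^- b * n%:R^-1].
Proof.
move=> d2 ln nl nu0 nud th0 thK yo0 yc r1 Mb s0 h1 h2 h3 X.
have two k : 0 < 2 ^+ k :> R by rewrite exprn_gt0.
have n0 : (0 < n)%N by apply: leq_trans ln; rewrite expn_gt0.
have nn0 : 0 < n%:R :> R by rewrite ltr0n.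
have X0 : 0 <= X by rewrite exprn_ge0 // (le_trans _ r1).
have XT : X <= 2 ^+ ((beta + c) * Psi).
  rewrite exprM; apply: lerXn2r; rewrite ?nnegrE ?(le_trans _ r1) ?exprn_ge0 //.
  rewrite exprD; apply: ler_pM => //; rewrite ?invr_ge0 ?(ltW yo0) // -natrX ler_nat //.
have Mb' : M%:R <= 2 ^+ beta :> R by rewrite -natrX ler_nat.
split.
- rewrite -[leRHS]mul1r ler_pdivlMr // -mulrA; apply: le_trans (_ : nu * 2 ^+ ((beta + c) * Psi + b) <= _).
    by rewrite ler_wpM2l ?(ltW nu0) // exprD ler_wpM2r // ltW.
  rewrite -(@expr_le1 _ d) //; [|exact: ltnW|by rewrite mulr_ge0 ?exprn_ge0 // ltW].
  rewrite exprMn nud -exprM mulrC ler_pdivrMr // mul1r -natrX ler_nat; apply: leq_trans ln.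
  by rewrite leq_exp2l // mulnC.
- rewrite -[leRHS]mul1r ler_pdivlMr //.
  apply: le_trans (_ : (2 ^+ lam.+1) ^+ d.+1 * ((2 ^- (d + 3)) ^+ lam * 2 ^+ ((beta + c) * Psi)) * 2 ^+ b <= _).
    apply: ler_wpM2r; first exact: ltW.
    apply: ler_pM => //; first exact: mulr_ge0 (exprn_ge0 _ th0) X0.
      apply: le_trans (_ : (n ^ d.+1)%:R <= _); first by rewrite ler_nat bin_le_exp.
      by rewrite natrX lerXn2r // ?nnegrE ?exprn_ge0 // -natrX ler_nat ltnW.
    apply: ler_pM => //; first exact: exprn_ge0.
    by rewrite exprM lerXn2r // ?nnegrE ?exprn_ge0 // invr_ge0 exprn_ge0.
  rewrite exprVn -!exprM mulrCA -mulrA ler_pdivrMl // mulr1 -!exprD.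
  by rewrite ler_eXn2l ?ltr1n // [leqRHS]mulnC.
move=> p p0 pn.
apply: le_trans (_ : 2 ^+ beta.+1 * 2 ^+ (beta * (d.+1 * (d * M + d * s))) * (n%:R^-1 * (2 ^- lam) ^+ s.-1) <= _).
  apply: ler_pM; rewrite ?mulr_ge0 ?exprn_ge0 //.
    apply: ler_pM => //.
      rewrite -natrX ler_nat; apply: leq_trans (_ : (2 ^ beta).+1 <= _)%N; first by rewrite ltnS.
      by rewrite expnS mul2n -addnn -addn1 leq_add2l expn_gt0.
    rewrite -natrX ler_nat [X in (_ <= X)%N]expnM -[((M ^ _) ^ _)%N]expnM.
    by case: (posnP (d.+1 * (d * M + d * s))%N) => [->//|pos]; rewrite leq_exp2r.
  apply: le_trans (_ : (nu ^+ d) ^+ s <= _).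
    by rewrite -exprM lerXn2r // nnegrE // ltW.
  rewrite nud -{1}(prednK s0) exprS ler_wpM2l ?invr_ge0 ?(ltW nn0) //.
  rewrite lerXn2r // ?nnegrE ?invr_ge0 ?exprn_ge0 ?(ltW nn0) //.
  by rewrite lef_pV2 ?posrE // -natrX ler_nat.
rewrite mulrCA [leRHS]mulrC ler_wpM2l ?invr_ge0 ?(ltW nn0) //.
rewrite -[leRHS]mul1r ler_pdivlMr // exprVn -exprM -mulrA mulrC -mulrA ler_pdivrMl // mulr1 -!exprD.
by rewrite ler_eXn2l ?ltr1n // addnC.
Qed.

Lemma lm_prob_ge0 (R : realType) n d (p : R) (E : pred {set {set 'I_n}}) :
  0 <= p -> p <= 1 -> 0 <= lm_prob d p E.
Proof.
move=> p0 p1; apply: sumr_ge0 => F _; apply: prodr_ge0 => f _.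
by case: ifP; rewrite ?subr_ge0.
Qed.

Section Limit.
Variables (R : realType) (d : nat) (gamma gh : R).
Hypotheses (d2 : (2 <= d)%N) (g0 : 0 <= gamma) (ga : gamma ^+ d * alpha R d < 1).
Hypotheses (gh0 : 0 <= gh) (ghE : gamma + gh ^+ d.+1 = gh).
Hypothesis ghL : forall delta : R, 0 < delta -> exists t, gh - delta <= depth_density d gamma t.

(** The number [b], the binary logarithm of that of [n], tends to infinity, and [delta]
    is the loss due to counting only clean runs of bounded length in the mean. *)
Lemma deviation_bound (eps delta : R) : 0 < eps -> 0 < delta ->
  exists2 C : R, 0 <= C & exists b0, forall n, (b0 <= n)%N -> exists2 b,
    (forall b1, (2 ^ 2 ^ b1 <= n)%N -> (b1 <= b)%N) &
    0 <= lm_prob d (gamma * scale R d n) [pred Y : {set {set 'I_n}} |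
        eps < `|(scale R d n)^-1 * contracted_fraction R d Y - gh|] <=
      2 ^- b * C + eps ^- 2 * (2 * gh * delta).
Proof.
move=> e0 de0.
have d0 : (0 < d)%N by rewrite ltnW.
have [yl [ym [yo [l0 m0 [yo0 yo1] y1 gl]]]] := stable_weights d0 g0 ga.
have yl1 : yl <= 1 by lra.
have ym1 : ym <= 1 by lra.
set th := gamma ^+ d / (yl ^+ d * ym).
have lm0 : 0 < yl ^+ d * ym by rewrite mulr_gt0 ?exprn_gt0.
have th0 : 0 <= th by rewrite divr_ge0 ?exprn_ge0 // ltW.
have th1 : th < 1 by rewrite ltr_pdivrMr // mul1r.
have gd1 : gamma ^+ d <= 1.
  apply: le_trans (ltW gl) _; rewrite mulr_ile1 ?exprn_ge0 ?exprn_ile1 //; exact: ltW.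
have g1 : gamma <= 1.
  by rewrite -(@ler_pXn2r _ d) ?nnegrE // ?expr1n //.
have [K K0 thK] := expn_small (d + 3) th0 th1.
have [c yc] := real_le_pow2 yo^-1.
have [t tL] := ghL de0; have [N NL] := clean_weight_depth d g0 t.
have [b0 bP] := @exponents d K c N d2 K0.
have [b1 b1P] : exists b1, forall b, (b1 <= b)%N -> 2 ^- b <= yl.
  apply: half_expn_cvg l0 _; exists (Num.truncn yl^-1).+1; exact: ltW (truncnS_gt _).
set G := gamma / yl; have G0 : 0 <= G by rewrite divr_ge0 // ltW.
set KK : R := (d.+1 + N + 2)%:R ^+ (N + N).
pose C2 := G ^+ 3 + 1 + (gh + G ^+ 2 + 1) * (d.+1 ^ 2)%:R +
     2 * gh * (gh * (N * (d.+1 + N))%:R + gamma ^+ 2 * KK).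
have K2 : 0 <= KK by rewrite exprn_ge0.
have C20 : 0 <= C2.
  have x3 k : 0 <= G ^+ k by exact: exprn_ge0.
  apply: addr_ge0; first apply: addr_ge0; first exact: addr_ge0.
    by apply: mulr_ge0 => //; apply: addr_ge0 => //; exact: addr_ge0.
  apply: mulr_ge0; first exact: mulr_ge0.
  by apply: addr_ge0; apply: mulr_ge0 => //; exact: exprn_ge0.
have ie0 : 0 <= eps ^- 2 by rewrite invr_ge0 exprn_ge0 // ltW.
exists (2 + eps ^- 2 * C2); first by rewrite addr_ge0 ?mulr_ge0.
exists (2 ^ 2 ^ maxn b0 b1)%N => n nb.
have n0 : (0 < n)%N by apply: leq_trans nb; rewrite expn_gt0.
pose lam := trunc_log 2 n; pose b := trunc_log 2 lam.
have ln : (2 ^ lam <= n)%N by exact: trunc_logP.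
have nl : (n < 2 ^ lam.+1)%N by exact: trunc_log_ltn.
have lamP k : (2 ^ k <= n)%N -> (k <= lam)%N by move=> h; exact: trunc_log_max.
have lam0 : (0 < lam)%N by apply: leq_trans (lamP _ nb); rewrite expn_gt0.
have bl : (2 ^ b <= lam)%N by exact: trunc_logP.
have lb : (lam < 2 ^ b.+1)%N by exact: trunc_log_ltn.
have blow b' : (2 ^ 2 ^ b' <= n)%N -> (b' <= b)%N by move=> /lamP h; exact: trunc_log_max.
exists b => //.
have := blow _ nb; rewrite geq_max => /andP[b0b b1b].
have [M [s [beta]]] := bP b lam b0b bl lb.
set L := (2 * _)%N; set Psi := excess_bound _ _ _ => /= -[[M1 M2 Mb s0] Lm [LN dN] [h1 h2] h3].
pose nu := scale R d n; rewrite -/nu.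
have nu0 : 0 < nu by exact: scale_gt0.
have nud : nu ^+ d = n%:R^-1 by exact: scale_exp.
have nn0 : 0 < n%:R :> R by rewrite ltr0n.
have M0 : (0 < M)%N by apply: leq_trans M2.
have oM : yo <= M%:R by apply: le_trans yo1 _; rewrite ler1n.
have r1 : 1 <= M%:R / yo by rewrite ler_pdivlMr // mul1r.
have [] := error_terms d2 ln nl nu0 nud th0 thK yo0 yc r1 Mb s0 h1 h2 h3.
set X := _ ^+ Psi; set z : R := 2 ^- b => nX CX Dle.
have X1 : 1 <= X by rewrite exprn_ege1.
have nz : nu <= z by apply: le_trans nX; rewrite ler_peMr // ltW.
have z0 : 0 <= z by rewrite invr_ge0 exprn_ge0.
have z1 : z <= 1 by rewrite invf_le1 ?exprn_gt0 // exprn_ege1 // ler1n.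
have nu1 : nu <= 1 by apply: le_trans z1.
have ni0 : 0 <= n%:R^-1 :> R by rewrite invr_ge0 ltW.
have niz : n%:R^-1 <= z.
  by apply: le_trans nz; rewrite -nud -{2}[nu]expr1 ler_wiXn2l // ltW.
set p := gamma * nu; have p0 : 0 <= p by rewrite mulr_ge0 // ltW.
have pnu : p <= nu by rewrite ler_piMl // ltW.
have pyl : p <= yl by apply: le_trans (b1P b b1b); exact: le_trans nz.
have lamn : (lam < n)%N by apply: leq_trans ln; exact: ltn_expl.
have dNn : (d.+1 + N <= n)%N by apply: leq_trans (ltnW lamn).
have dn : (d < n)%N by apply: leq_trans dNn; exact: leq_addr.
pose q : R := n%:R - (d.+1 + N)%:R.
have q0 : 0 <= q by rewrite subr_ge0 ler_nat.
have thE : n%:R * p ^+ d / (yl ^+ d * ym) = th.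
  by rewrite /p exprMn nud mulrCA divff ?mulr1 // gt_eqF.
have ghW : p + n%:R * (gh * nu) ^+ d.+1 <= gh * nu.
  rewrite -{2}ghE mulrDl exprMn [nu ^+ d.+1]exprSr nud lerD2l mulrCA mulrA mulrA mulfK ?gt_eqF //.
have p1 : p <= 1 by exact: le_trans yl1.
have nui : 0 <= nu^-1 by rewrite invr_ge0 ltW.
have := @finite_bound R n d p d2 p0 p1 n0 yl ym yo (gh * nu) q nu^-1 gh eps L M (d * s) (K * lam) N.
rewrite /= thE -/Psi -/X -/KK.
move=> /(_ l0 m0 yo0 _ pyl oM (ltW th1)) H.
apply/andP; split; first exact: lm_prob_ge0.
apply: le_trans (H _ _ _ ghW M1 M2 Lm LN q0 (lexx _) dn e0 nui gh0) _.
- by rewrite y1.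
- by rewrite /p exprMn nud ler_piMl.
- by rewrite mulr_ge0 // ltW.
have {}Dle := Dle p p0 pnu.
set Dn := _ * p ^+ (d * s) in Dle *.
have Dn0 : 0 <= Dn by rewrite !mulr_ge0 ?exprn_ge0.
have DZ : Dn <= z by apply: le_trans Dle _; rewrite ler_piMr // (le_trans niz).
rewrite {1 2}/p clean_weight_scale expr1.
set cw := clean_weight d gamma _ N 1.
pose cwN := clean_weight d gamma 1 N 1.
have cwN0 : 0 <= cwN by exact: clean_weight_ge0.
have cwNl : gh - delta <= cwN by exact: le_trans tL NL.
have cwNu : cwN <= gh by have := clean_weight_le (d := d) g0 N 1 ler01 (lexx _) ghE gh0; rewrite expr1.
have qn : q * nu ^+ d = 1 - (d.+1 + N)%:R / n%:R.
  by rewrite nud /q mulrBl divff // gt_eqF.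
have cwP : (1 - (N * (d.+1 + N))%:R * n%:R^-1) * cwN <= cw.
  have x0 : 0 <= (d.+1 + N)%:R / n%:R :> R by rewrite mulr_ge0.
  have x1 : (d.+1 + N)%:R / n%:R <= 1 :> R by rewrite ler_pdivrMr // mul1r ler_nat.
  rewrite /cw qn; apply: le_trans (clean_weight_lower d g0 N 1 _ _); last 2 first.
  - by rewrite subr_ge0.
  - by rewrite gerBl.
  by apply: ler_wpM2r => //; rewrite natrM -mulrA; exact: bernoulli.
have := scaled_terms (delta := delta) d2 nu0 nu1 nud ni0 g0 gh0 l0 (le_trans ler01 X1) Dn0 z0 K2 nX nz niz Dle
  cwN0 cwNl cwNu cwP.
rewrite -/p -/C2 => sc.
apply: le_trans (_ : z + z + eps ^- 2 * (2 * gh * delta + z * C2) <= _).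
  by apply: lerD; [exact: lerD|rewrite ler_wpM2l].
rewrite le_eqVlt; apply/orP; left; apply/eqP; ring.
Qed.

End Limit.

Theorem theorem2 (R : realType) (d : nat) (gamma : R)
    (hd : (2 <= d)%N) (hgamma0 : 0 <= gamma)
    (hgamma : gamma < alpha R d `^ (- (d%:R)^-1)) :
  exists gammahat : R,
    smallest_nonneg_root (Qpoly d gamma) gammahat /\
    lm_cvg_in_prob d
      (fun n : nat => gamma * n%:R `^ (- (d%:R)^-1))
      (fun (n : nat) (Y : {set {set 'I_n}}) =>
         n%:R `^ ((d%:R)^-1) * contracted_fraction R d Y)
      gammahat.
Proof.
have d0 : (0 < d)%N by rewrite ltnW.
have ga := threshold_exp d0 hgamma0 hgamma.
have [gh [gr ghE ghL]] := smallest_root d0 hgamma0 (ltW ga).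
have gh0 : 0 <= gh by case: gr.
exists gh; split=> // eps e0; apply/cvgrPdist_le => e ee.
(* The part of the bound that does not vanish as [n] grows is [eps ^- 2 * (2 * gh * delta)],
   which this choice makes at most [e / 2]. *)
pose delta := e * eps ^+ 2 / (4 * (gh + 1)).
have e2 : 0 < eps ^+ 2 by rewrite exprn_gt0.
have de0 : 0 < delta by rewrite divr_gt0 ?mulr_gt0 // ltr_wpDl.
have [C C0 [n0 H]] := deviation_bound hd hgamma0 ga gh0 ghE ghL e0 de0.
have [b1 b1P] : exists b1, forall b, (b1 <= b)%N -> 2 ^- b <= e / (2 * (C + 1)).
  apply: half_expn_cvg; first by rewrite divr_gt0 // mulr_gt0 // ltr_wpDl.
  by exists (Num.truncn (e / (2 * (C + 1)))^-1).+1; exact: ltW (truncnS_gt _).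
exists (maxn (maxn n0 1) (2 ^ 2 ^ b1)) => // n /=; rewrite !geq_max => /andP[/andP[n0n n1] nb].
have [b blow] := H n n0n; have {}blow := b1P _ (blow _ nb).
rewrite -(@scale_inv R d n) -/(scale R d n) => /andP[pr0 le].
rewrite sub0r normrN ger0_norm //.
apply: le_trans le _.
have h1 : 2 ^- b * C <= e / 2.
  apply: le_trans (_ : e / (2 * (C + 1)) * (C + 1) <= _).
    apply: ler_pM => //.
    by rewrite lerDl.
  by rewrite le_eqVlt; apply/orP; left; apply/eqP; field; lra.
have h2 : eps ^- 2 * (2 * gh * delta) <= e / 2.
  rewrite /delta (_ : eps ^- 2 * _ = e / 2 * (gh / (gh + 1))); last by field; rewrite !gt_eqF //; lra.
  by rewrite ler_piMr ?divr_ge0 ?(ltW ee) // ler_pdivrMr ?mul1r ?lerDl // ltr_wpDl.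
lra.
Qed.
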